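(* Let $\{Y(t):t\in[0,1]\}$ be the LMSM with Hurst function $H(\cdot)$, where $H(\cdot)$ satisfies $|H(t_1)-H(t_2)|\le c_H|t_1-t_2|^{\rho_H}$ for all $t_1,t_2\in[0,1]$, for some constant $c_H$ and some $\rho_H$ with $1\ge\rho_H>\sup_{t\in[0,1]}H(t)$. Let $\beta\in(0,1/4]$ be a real number and $L\ge2$ an integer such that $$L>\frac{2}{\beta}+1.$$ Let $I\subseteq[0,1]$ be a fixed compact interval with non-empty interior. Then there exists an almost surely finite random variable $C>0$, not depending on $N$, such that almost surely, for every integer $N\ge3$ satisfying $\lambda(I)\ge4(L+1)N^{-1}(\log N)^2$, $$\big|\widehat H_N^\beta(I)-\min_{t\in I}H(t)\big|\le C\,\frac{\log\log N}{\log N},$$ where $\widehat H_N^\beta(I)=\beta^{-1}\log_2\Big(\mathcal T_\beta\Big(\frac{V_N^\beta(I)}{V_{2N}^\beta(I)}\Big)\Big)$.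
   Context: Setting: $\alpha\in(1,2)$ is fixed and $(\Omega,\mathcal F,\mathbb P)$ is a probability space carrying an independently scattered symmetric $\alpha$-stable ($S\alpha S$) random measure $Z_\alpha(ds)$ on $\mathbb R$ with Lebesgue control measure: for $f\in L^\alpha(\mathbb R)$, $\int_{\mathbb R}f(s)Z_\alpha(ds)$ is the real $S\alpha S$ random variable with characteristic function $\xi\mapsto\exp(-|\sigma\xi|^\alpha)$, where $\sigma=\|f\|_{L^\alpha(\mathbb R)}$, and integrals of functions with (a.e.) disjoint supports are independent. For $x,\kappa\in\mathbb R$, $(x)_+^\kappa=x^\kappa$ if $x>0$ and $0$ otherwise. For $(u,v)\in[0,1]\times(1/\alpha,1)$, $$X(u,v)=\int_{\mathbb R}\{(u-s)_+^{v-1/\alpha}-(-s)_+^{v-1/\alpha}\}Z_\alpha(ds),$$ identified with its version with continuous sample paths. The Hurst function $H:[0,1]\to(1/\alpha,1)$ takes values in a compact subinterval of $(1/\alpha,1)$. The Linear Multifractional Stable Motion (LMSM) with Hurst function $H$ is $Y(t)=X(t,H(t))$, $t\in[0,1]$. Notation: $\log$ is the natural logarithm, $\log_2$ the logarithm to base 2, $\lambda$ Lebesgue measure. For an integer $L\ge2$ and $l\in\{0,\dots,L\}$, $a_l=(-1)^{L-l}\binom{L}{l}$. For $N\ge L$ and $k\in\{0,\dots,N-L\}$, $d_{N,k}=\sum_{l=0}^L a_l Y((k+l)/N)$. For a compact interval $I\subseteq[0,1]$ with non-empty interior and $N\ge(L+1)\lambda(I)^{-1}$, $\nu_N(I)=\{k\in\{0,\dots,N-L\}:k/N\in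 I\}$, $|\nu_N(I)|$ is its cardinality, and $V_N^\beta(I)=|\nu_N(I)|^{-1}\sum_{k\in\nu_N(I)}|d_{N,k}|^\beta$. For $x\ge0$, $\mathcal T_\beta(x)=\min\{2^\beta,\max\{x,2^{\beta/2}\}\}$. *)

(* Defs.v *)
From HB Require Import structures.
From mathcomp Require Import all_boot all_order all_algebra.
From mathcomp Require Import all_classical all_reals all_analysis.
From mathcomp Require Import measurable_realfun.
From mathcomp Require Import complex.

Set Implicit Arguments.
Unset Strict Implicit.
Unset Printing Implicit Defensive.
Import Order.TTheory GRing.Theory Num.Theory.
Import numFieldNormedType.Exports.
Local Open Scope classical_set_scope.
Local Open Scope ring_scope.
Local Open Scope complex_scope.

Section StableIntegrals.
Context (R : realType) (d : measure_display) (T : measurableType d).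
Context (P : probability T R).

Definition charfun (X : T -> R) (xi : R) : R[i] :=
  fine 'E_P[fun w => cos (xi * X w)] +i* fine 'E_P[fun w => sin (xi * X w)].

Definition is_SaS (alpha sigma : R) (X : T -> R) : Prop :=
  forall xi : R, charfun X xi = (expR (- `|sigma * xi| `^ alpha))%:C.

(* Since the Borel sets B i may be the whole line, the product rule over the
   full family contains the product rules over all its subfamilies. *)
Definition mutually_independent (n : nat) (X : 'I_n -> T -> R) : Prop :=
  forall B : 'I_n -> set R, (forall i, measurable (B i)) ->
    P (\bigcap_i (X i @^-1` B i)) = (\prod_i P (X i @^-1` B i))%E.

(* The domain of Z consists of the Borel sets of finite Lebesgue measure; its
   values on the other sets are irrelevant. *)
Record is_SaS_random_measure (alpha : R) (Z : set R -> {RV P >-> R}) : Prop := {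
  SaSm_stable : forall A : set R,
    measurable A -> (lebesgue_measure A < +oo)%E ->
    is_SaS alpha (fine (lebesgue_measure A) `^ alpha^-1) (Z A);
  SaSm_independently_scattered : forall (n : nat) (A : 'I_n -> set R),
    (forall i, measurable (A i) /\ (lebesgue_measure (A i) < +oo)%E) ->
    trivIset setT A -> mutually_independent (fun i => Z (A i) : T -> R);
  SaSm_sigma_additive : forall A : (set R)^nat,
    (forall i, measurable (A i)) -> trivIset setT A ->
    (lebesgue_measure (\bigcup_i A i) < +oo)%E ->
    {ae P, forall w,
      series (fun i => Z (A i) w) @ \oo --> Z (\bigcup_i A i) w}
}.

(* J f is the integral of f against Z, for f in L^alpha. It is determined almost
   surely: by linearity on simple functions, then by density, because the scale
   parameter of J f - J g is the L^alpha norm of f - g. *)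
Record is_SaS_integral (alpha : R) (Z : set R -> {RV P >-> R})
    (J : (R -> R) -> {RV P >-> R}) : Prop := {
  SaSi_indic : forall A : set R,
    measurable A -> (lebesgue_measure A < +oo)%E ->
    {ae P, forall w, J \1_A w = Z A w};
  SaSi_linear : forall (a : R) (f g : R -> R),
    f \in Lfun lebesgue_measure alpha%:E ->
    g \in Lfun lebesgue_measure alpha%:E ->
    {ae P, forall w, J (fun s => a * f s + g s) w = a * J f w + J g w};
  SaSi_stable : forall f : R -> R,
    f \in Lfun lebesgue_measure alpha%:E ->
    is_SaS alpha (fine ('N[lebesgue_measure]_(alpha%:E)[EFin \o f])%E) (J f);
  SaSi_independent : forall (n : nat) (f : 'I_n -> R -> R),
    (forall i, f i \in Lfun lebesgue_measure alpha%:E) ->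
    (forall i j, i != j ->
      {ae lebesgue_measure, forall s : R, f i s = 0 \/ f j s = 0}) ->
    mutually_independent (fun i => J (f i) : T -> R)
}.

(* [powR] is not 0 at the left of the origin. *)
Definition pospow (x kappa : R) : R := if 0 < x then x `^ kappa else 0.

Definition lmsm_kernel (alpha u v s : R) : R :=
  pospow (u - s) (v - alpha^-1) - pospow (- s) (v - alpha^-1).

Definition field_domain (alpha : R) : set (R * R) :=
  `[0, 1] `*` `]alpha^-1, 1[.

Record is_lmsm_field (alpha : R) (J : (R -> R) -> {RV P >-> R})
    (X : R -> R -> {RV P >-> R}) : Prop := {
  field_version : forall u v : R, field_domain alpha (u, v) ->
    {ae P, forall w, X u v w = J (lmsm_kernel alpha u v) w};
  field_continuous : forall w : T,
    {within field_domain alpha, continuous (fun uv : R * R => X uv.1 uv.2 w)}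
}.

Definition lmsm (X : R -> R -> {RV P >-> R}) (H : R -> R) (t : R) (w : T) : R :=
  X t (H t) w.

End StableIntegrals.

Section Estimator.
Context (R : realType).

Definition filter_coef (L l : nat) : R := (-1) ^+ (L - l) * 'C(L, l)%:R.

Definition gen_increment (L : nat) (y : R -> R) (N k : nat) : R :=
  \sum_(l < L.+1) filter_coef L l * y ((k + l)%N%:R / N%:R).

(* N - L is truncated: N >= L is intended. *)
Definition nu (L N : nat) (I : set R) : {set 'I_(N - L).+1} :=
  [set k : 'I_(N - L).+1 | k%:R / N%:R \in I].

Definition power_variation (beta : R) (L : nat) (y : R -> R) (N : nat)
    (I : set R) : R :=
  #|nu L N I|%:R^-1 * \sum_(k in nu L N I) `|gen_increment L y N k| `^ beta.

Definition truncation (beta x : R) : R :=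
  Num.min (2 `^ beta) (Num.max x (2 `^ (beta / 2))).

Definition log2 (x : R) : R := ln x / ln 2.

Definition hurst_estimator (beta : R) (L : nat) (y : R -> R) (N : nat)
    (I : set R) : R :=
  beta^-1 * log2 (truncation beta
    (power_variation beta L y N I / power_variation beta L y (2 * N)%N I)).

Definition is_min (A : set R) (m : R) : Prop := A m /\ lbound A m.

End Estimator.

(* Main.v *)
Require Import Defs.
From HB Require Import structures.
From mathcomp Require Import all_boot all_order all_algebra.
From mathcomp Require Import all_classical all_reals all_analysis.
From mathcomp Require Import measurable_realfun.
From mathcomp Require Import ring lra.

(** Write I = [a, b] and m = min_I H. The idea is that the increment d_(N,k) is almost a
    symmetric alpha-stable variable with scale parameter N^(-H(k/N)) times a smooth
    positive function of H(k/N), so that the moment of order beta of |d_(N,k)| is a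
    constant times N^(-beta H(k/N)) s(H(k/N)). Averaged over I, these moments are
    dominated by the points where H is within a multiple of loglog N / log N of its
    minimum; on them, replacing N by 2N multiplies the moment by 2^(-beta m), up to a
    relative error of order loglog N / log N. Since moreover V_N follows its mean, the
    quotient V_N / V_(2N) is 2^(beta m) up to such an error, and a projection followed by
    a logarithm, both Lipschitz, gives the estimator.

    Three facts make this precise.

    - Freezing the Hurst index. Almost surely the field v |-> X(u, v) is Lipschitz,
      uniformly in u ([field_lipschitz]): mixed differences, of first order in u and of
      second order in v, are integrals whose kernels have small norm
      ([second_diff_controlled], [increment_mass]), so their moments are summable over a
      dyadic grid, and continuity extends the bound from the grid to the square. Hence
      replacing H((k+l)/N) by H(k/N) in d_(N,k) costs O(N^(-rho)), which is negligible
      before N^(-m) because rho exceeds m.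

    - Concentration. The frozen increment is the integral of a rescaled copy of the L-th
      difference psi of the truncated power. This function vanishes on the left of -L and
      decays on the right, all the faster as L is large ([psi_tail]). Cutting it at a
      distance B = N^(3/10) leaves a far part which the condition L > 2 / beta + 1 makes
      uniformly negligible, and near parts with disjoint supports, hence independent,
      along each residue class modulo B + L. Chernoff's inequality in each class, after
      clipping at N^(16/25), and the Borel-Cantelli lemma give a power saving
      ([frozen_variation_concentration], [increment_concentration]).

    - The mean. The exact value of the absolute moments of a stable variable follows from
      its characteristic function through an integral representation of |x|^p
      ([SaS_moment_identity]). Comparing the sum of the means at scale 2N with twice
      that at scale N, pair by pair, gives the relative error ([mean_sum_double],
      [variation_ratio]); the sum is at least of order N / (log N)^2 because H stays within
      O(1 / log N) of m on an interval of length (log N)^(-2) ([mean_sum_lower]).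

    The estimator takes its values in [1/2, 1], so that finitely many N are absorbed by a
    random constant ([random_constant]). *)

Set Implicit Arguments.
Unset Strict Implicit.
Unset Printing Implicit Defensive.
Import Order.TTheory GRing.Theory Num.Theory.
Import numFieldNormedType.Exports.
Local Open Scope classical_set_scope.
Local Open Scope ring_scope.

(** * Change of variables and power integrals *)

(** The image of Lebesgue measure under an affine map is proportional to it: both are
    Stieltjes measures that agree on intervals. *)
Lemma ge0_integral_affine (R : realType) (F : R -> \bar R) (c b : R) :
  c != 0 -> measurable_fun [set: R] F -> (forall x, (0 <= F x)%E) ->
  (\int[lebesgue_measure]_x F (c * x + b)%R
   = (`|c|^-1)%:E * \int[lebesgue_measure]_x F x)%E.
Proof.
move=> c0 mF F0.
pose phi : R -> measurableTypeR R := fun x => c * x + b.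
have mphi : measurable_fun setT phi.
  apply: (@measurable_funD _ _ R) => //; exact: (@measurable_funM _ _ R).
have k0 : 0 <= `|c| by [].
pose mu' := mscale (NngNum k0) (measure_function_pushforward__canonical__measure_function_Measure (@lebesgue_measure R) mphi).
have E (A : set R) : measurable A -> lebesgue_measure A = mu' A.
  apply: lebesgue_measure_unique => _ [[p q]] _ <-.
  change (lebesgue_measure `]p, q]%classic = (`|c|%:E * lebesgue_measure (phi @^-1` `]p, q]%classic))%E).
  have [c1|c1] := ltP 0 c.
    have -> : phi @^-1` `]p, q] = `](p - b) / c, (q - b) / c]%classic.
      apply/seteqP; split => x /=; rewrite !in_itv/= /phi ltr_pdivrMr// ler_pdivlMr//; lra.
    rewrite !lebesgue_measure_itv/= !lte_fin gtr0_norm// ltr_pM2r ?invr_gt0// ltrD2r.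
    case: ifP => _; last by rewrite mule0.
    by rewrite -!EFinD -EFinM; congr EFin; field.
  have c2 : c < 0 by rewrite lt_neqAle c0.
  have -> : phi @^-1` `]p, q] = `[(q - b) / c, (p - b) / c[%classic.
    apply/seteqP; split => x /=; rewrite !in_itv/= /phi ler_ndivrMr// ltr_ndivlMr//; lra.
  rewrite !lebesgue_measure_itv/= !lte_fin ltr0_norm// ltr_nM2r ?invr_lt0// ltrD2r.
  case: ifP => _; last by rewrite mule0.
  by rewrite -!EFinD -EFinM; congr EFin; field.
rewrite [in RHS](eq_measure_integral mu'); last by move=> A mA _; exact: E.
rewrite ge0_integral_mscale// ge0_integral_pushforward//.
rewrite muleA -EFinM mulVf ?normr_eq0// mul1e.
by rewrite preimage_setT.
Qed.


Lemma integral_powR_tail (R : realType) (A g : R) : 0 < A -> 1 < g ->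
  (\int[lebesgue_measure]_(x in `[A, +oo[) (x `^ (- g))%:E
   = (A `^ (1 - g) / (g - 1))%:E)%E.
Proof.
move=> A0 g1.
pose F x := - (x `^ (1 - g) / (g - 1)) : R.
have dF x : A / 2 < x -> is_derive x 1 F (x `^ (- g)).
  move=> Ax; have x0 : 0 < x by lra.
  have h : is_derive x 1 (fun x => x `^ (1 - g)) ((1 - g) * x `^ (1 - g - 1)).
    exact: is_derive1_powR.
  have := is_deriveZ (- (g - 1)^-1) h => /=.
  rewrite (_ : _ \*: _ = F); last first.
    by apply/funext => y/=; rewrite /F /GRing.scale/= mulNr mulrC.
  rewrite (_ : _ *: _ = x `^ (- g))//.
  rewrite /GRing.scale/= (_ : 1 - g - 1 = - g); last by ring.
  by field; lra.
rewrite (@ge0_continuous_FTC2y _ _ F _ 0).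
- by rewrite /F sub0e -EFinN opprK.
- by move=> x Ax; exact: powR_ge0.
- apply: derivable_within_continuous => x; rewrite in_itv/= andbT => Ax.
  have : is_derive x 1 (fun x : R => x `^ (- g)) (- g * x `^ (- g - 1)).
    by apply: is_derive1_powR; lra.
  by case.
- apply/cvgrPdist_le => e e0; near=> x.
  rewrite sub0r opprK ger0_norm; last by rewrite divr_ge0 ?powR_ge0//; lra.
  have e1 : 0 < (g - 1) * e by rewrite mulr_gt0//; lra.
  rewrite ler_pdivrMr; last lra.
  rewrite mulrC (_ : 1 - g = - (g - 1)); last by ring.
  have -> : (g - 1) * e = (((g - 1) * e) `^ (- (g - 1)^-1)) `^ (- (g - 1)).
    by rewrite -powRrM mulrNN mulVf ?powRr1//; lra.
  have M0 : 0 < ((g - 1) * e) `^ (- (g - 1)^-1) by exact: powR_gt0.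
  have Mx : ((g - 1) * e) `^ (- (g - 1)^-1) <= x by near: x; exact: nbhs_pinfty_ge.
  have x0 : 0 < x by exact: lt_le_trans Mx.
  rewrite !(powRN _ (g - 1)) lef_pV2 ?posrE ?powR_gt0//.
  by apply: ge0_ler_powR; rewrite ?nnegrE ?(ltW M0) ?(ltW x0)//; lra.
- by move=> x Ax; have [] := dF x ltac:(lra).
- have : is_derive A 1 F (A `^ (- g)) by apply: dF; lra.
  case=> /derivable1_diffP/differentiable_continuous cF _.
  by apply: cvg_at_right_filter.
- move=> x; rewrite in_itv/= andbT => Ax.
  by rewrite derive1E; have [] := dF x ltac:(lra).
Unshelve. all: by end_near. Qed.

Lemma integral_powR_near0 (R : realType) (a : R) : - 1 < a ->
  (\int[lebesgue_measure]_(x in `]0%R, 1%R]) (x `^ a)%:E <= ((a + 1)^-1)%:E)%E.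
Proof.
move=> a1.
pose F (i : nat) : set R := `[(i.+2%:R^-1), 1]%classic.
pose G x := x `^ (a + 1) / (a + 1) : R.
have mp (D : set R) : measurable D -> measurable_fun D (fun x : R => (x `^ a)%:E).
  by move=> mD; apply/measurable_EFinP; exact: measurable_funTS (measurable_powR a).
have dG (x : R) : 0 < x -> is_derive x 1 G (x `^ a).
  move=> x0; have h : is_derive x 1 (fun x => x `^ (a + 1)) ((a + 1) * x `^ (a + 1 - 1)).
    exact: is_derive1_powR.
  have := is_deriveZ (a + 1)^-1 h => /=.
  rewrite (_ : _ \*: _ = G); last first.
    by apply/funext => y/=; rewrite /G /GRing.scale/= mulrC.
  rewrite (_ : _ *: _ = x `^ a)// /GRing.scale/= addrK.
  by field; lra.
have FE : `]0%R, 1%R]%classic `<=` \bigcup_i F i.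
  move=> x; rewrite /= in_itv/= => /andP[x0 x1].
  exists (Num.trunc x^-1) => //; rewrite /F /= in_itv/= x1 andbT.
  rewrite -[leRHS]invrK lef_pV2 ?posrE ?invr_gt0//.
  have : x^-1 < (Num.trunc x^-1).+1%:R by apply: truncnS_gt.
  by move=> /ltW/le_trans; apply; rewrite ler_nat.
have nn (x : R) : (0 <= (x `^ a)%:E)%E by rewrite lee_fin powR_ge0.
have mF i : measurable (F i) by exact: measurable_itv.
apply: (@le_trans _ _ (\int[lebesgue_measure]_(x in \bigcup_i F i) (x `^ a)%:E)%E).
  apply: ge0_subset_integral => //.
  - by apply: bigcup_measurable => k _; exact: mF.
  - by apply: mp; apply: bigcup_measurable => k _; exact: mF.
have nd : nondecreasing_seq F.
  move=> i j ij; rewrite subsetEset => x; rewrite /F /= !in_itv/= => /andP[h ->].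
  by rewrite andbT; apply: le_trans h; rewrite lef_pV2 ?posrE// ler_nat.
have cv := @ge0_nondecreasing_set_cvg_integral _ (measurableTypeR R) R F (fun x : R => (x `^ a)%:E) (@lebesgue_measure R)
  nd mF (fun i => mp _ (mF i)) (fun i x _ => nn x).
rewrite -(cvg_lim _ cv)//; apply: lime_le; first by apply/cvg_ex; eexists; exact: cv.
apply: nearW => i.
rewrite (@continuous_FTC2 _ _ G).
- rewrite -EFinB lee_fin /G powR1 div1r gerBl divr_ge0 ?powR_ge0//; lra.
- by rewrite invf_lt1// ltr1n.
- apply: derivable_within_continuous => x; rewrite in_itv/= => /andP[xi _].
  have x0 : 0 < x by apply: lt_le_trans xi.
  by have [] := is_derive1_powR a x0.
- have ct (x : R) : 0 < x -> {for x, continuous G}.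
    by move=> /dG [] /derivable1_diffP/differentiable_continuous.
  split.
  + move=> x; rewrite in_itv/= => /andP[xi _].
    have x0 : 0 < x by apply: lt_trans xi.
    by have [] := dG _ x0.
  + by apply: cvg_at_right_filter; apply: ct.
  + by apply: cvg_at_left_filter; apply: ct.
- move=> x; rewrite in_itv/= => /andP[xi _].
  have x0 : 0 < x by apply: lt_trans xi.
  by rewrite derive1E; have [] := dG _ x0.
Qed.

(** * Absolute moments of symmetric stable laws *)

Lemma ge0_integral_setC (R : realType) (f : R -> \bar R) (A : set R) :
  measurable A -> measurable_fun [set: R] f -> (forall x, (0 <= f x)%E) ->
  (\int[lebesgue_measure]_x f x
   = \int[lebesgue_measure]_(x in A) f x + \int[lebesgue_measure]_(x in ~` A) f x)%E.
Proof.
move=> mA mf f0; rewrite -(setUv A) ge0_integral_setU//.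
- exact: measurableC.
- by rewrite setUv.
- by rewrite disj_set2E setICr.
Qed.

Lemma ge0_integral_split (R : realType) (f : R -> \bar R) (a : R) :
  measurable_fun [set: R] f -> (forall x, (0 <= f x)%E) ->
  (\int[lebesgue_measure]_x f x
   = \int[lebesgue_measure]_(x in `]-oo, a]) f x
     + \int[lebesgue_measure]_(x in `]a, +oo[) f x)%E.
Proof.
move=> mf f0; rewrite (@ge0_integral_setC _ _ `]-oo, a]%classic)//.
by congr (_ + _)%E; rewrite setCitvl.
Qed.

(** The two hypotheses on the exponents are the integrability of x^a at 0 and of
    x^(-g) at infinity. *)
Lemma le_integral_near0_tail (R : realType) (f : R -> R) (C1 C2 a g : R) :
  measurable_fun [set: R] f -> (forall x, 0 <= f x) ->
  (forall x : R, x <= 0 -> f x = 0) -> 0 <= C1 -> 0 <= C2 -> -1 < a -> 1 < g ->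
  (forall x : R, 0 < x -> x <= 1 -> f x <= C1 * x `^ a) ->
  (forall x, 1 <= x -> f x <= C2 * x `^ (- g)) ->
  (\int[lebesgue_measure]_x (f x)%:E <= (C1 / (a + 1) + C2 / (g - 1))%:E)%E.
Proof.
move=> mf f0 fN C10 C20 a1 g1 h1 h2.
have mfE (D : set R) : measurable D -> measurable_fun D (EFin \o f).
  by move=> mD; apply/measurable_EFinP; exact: measurable_funTS.
have mp (D : set R) (b : R) : measurable D -> measurable_fun D (fun x : R => (x `^ b)%:E).
  by move=> mD; apply/measurable_EFinP; exact: measurable_funTS (measurable_powR b).
have mpc (D : set R) (C b : R) : measurable D -> measurable_fun D (fun x : R => (C * x `^ b)%:E).
  move=> mD; apply/measurable_EFinP; apply: measurable_funTS.
  by apply: measurable_funM => //; exact: measurable_powR.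
have fE0 x : (0 <= (f x)%:E)%E by rewrite lee_fin.
rewrite (@ge0_integral_split _ _ 0)//; last exact: mfE.
rewrite integral0_eq ?add0e; last by move=> x; rewrite /= in_itv/= => x0; rewrite fN.
have -> : `]0%R, +oo[%classic = `]0%R, 1%R] `|` `]1%R, +oo[ :> set R.
  by rewrite -itv_bndbnd_setU ?bnd_simp.
rewrite ge0_integral_setU//=; last 2 first.
- by apply: mfE; exact: measurableU.
- rewrite disj_set2E; apply/eqP/seteqP; split => x //=; rewrite !in_itv/= andbT.
  by case=> /andP[_ x1]; rewrite ltNge x1.
rewrite EFinD; apply: leeD.
- apply: (@le_trans _ _ (\int[lebesgue_measure]_(x in `]0%R, 1%R]) (C1%:E * (x `^ a)%:E))%E).
    apply: ge0_le_integral => //; [exact: mfE|exact: mpc|].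
    by move=> x; rewrite /= in_itv/= => /andP[x0 x1]; rewrite lee_fin h1.
  rewrite ge0_integralZl_EFin//; last 2 first.
  - by move=> x _; rewrite lee_fin powR_ge0.
  - exact: mp.
  by rewrite EFinM lee_wpmul2l ?lee_fin// integral_powR_near0.
- apply: (@le_trans _ _ (\int[lebesgue_measure]_(x in `[1%R, +oo[) (C2%:E * (x `^ - g)%:E))%E).
    apply: (@le_trans _ _ (\int[lebesgue_measure]_(x in `[1%R, +oo[) (f x)%:E)%E).
      apply: ge0_subset_integral => //; first exact: mfE.
      by move=> x; rewrite /= !in_itv/= !andbT => /ltW.
    apply: ge0_le_integral => //; [exact: mfE|exact: mpc|].
    by move=> x; rewrite /= in_itv/= andbT => x1; rewrite lee_fin h2.
  rewrite ge0_integralZl_EFin//; last 2 first.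
  - by move=> x _; rewrite lee_fin powR_ge0.
  - exact: mp.
  rewrite integral_powR_tail// powR1 -EFinM lee_fin.
  by rewrite mul1r.
Qed.

Lemma measurable_pospow (R : realType) (k : R) :
  measurable_fun [set: R] (fun x : R => pospow x k).
Proof.
apply: (@measurable_fun_ifT _ _ _ _ (fun x : R => x `^ k) (fun=> 0) (fun x => 0 < x)) => //.
exact: measurable_fun_ltr.
Qed.

Lemma pospow_ge0 (R : realType) (x k : R) : 0 <= pospow x k.
Proof. by rewrite /pospow; case: ifP => // _; exact: powR_ge0. Qed.

Lemma measurable_cos (R : realType) : measurable_fun [set: R] (@cos R).
Proof. by apply: continuous_measurable_fun; exact: continuous_cos. Qed.

Lemma one_sub_cos_le (R : realType) (x : R) : 0 <= x -> 1 - cos x <= x.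
Proof.
rewrite le_eqVlt => /predU1P[<-|x0]; first by rewrite cos0 subrr.
have [c _ E] := @MVT R (@cos R) (fun x => - sin x) 0 x x0
  (fun y _ => is_derive_cos y) (continuous_subspaceT (@continuous_cos R)).
move: E; rewrite cos0 subr0 => E; have := sin_le1 c; nra.
Qed.

Section PowerTransform.
Context (R : realType).
Implicit Types (p c : R) (g : R -> R).

(** For 1 - cos and for 1 - exp(-|x|^alpha) this is the integral of g(x) x^(-1-p) over the
    half-line, which turns dilations of g into multiplication by a power. *)
Definition power_transform g p : \bar R :=
  (\int[lebesgue_measure]_x (g x * pospow x (- 1 - p))%:E)%E.

(** Substitution y = c x; the factor c^p is what makes these transforms produce absolute
    moments of order p. *)
Lemma power_transform_scale g p c : 0 < p -> 0 <= c ->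
  measurable_fun [set: R] g -> (forall x, 0 <= g x) -> g 0 = 0 ->
  (power_transform (fun x => g (c * x)%R) p = (c `^ p)%:E * power_transform g p)%E.
Proof.
move=> p0; rewrite le_eqVlt => /predU1P[<-|c0] mg g0 g00.
  rewrite powR0 ?gt_eqF// mul0e /power_transform.
  by apply: integral0_eq => x _; rewrite mul0r g00 mul0r.
pose F x : \bar R := (g x * pospow x (- 1 - p))%:E.
have mF : measurable_fun [set: R] F.
  by apply/measurable_EFinP; apply: measurable_funM => //; exact: measurable_pospow.
have F0 x : (0 <= F x)%E by rewrite lee_fin mulr_ge0 ?pospow_ge0.
have := @ge0_integral_affine R F c 0 (lt0r_neq0 c0) mF F0.
rewrite (gtr0_norm c0) => E.
have -> : (power_transform g p = c%:E * \int[lebesgue_measure]_x F (c * x + 0)%R)%E.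
  by rewrite E muleA -EFinM mulfV ?gt_eqF// mul1e.
rewrite muleA -EFinM -ge0_integralZl_EFin//; last 2 first.
- apply: (measurableT_comp mF); apply: (@measurable_funD _ _ R) => //.
- by rewrite mulr_ge0 ?powR_ge0// ltW.
apply: eq_integral => x _; rewrite /F addr0 -EFinM; congr EFin.
rewrite /pospow pmulr_rgt0//; case: ifPn => [x0|_]; last by rewrite !mulr0.
rewrite powRM ?(ltW c0) ?(ltW x0)// mulrCA; congr (_ * _).
rewrite mulrA -[X in c `^ p * X](powRr1 (ltW c0)) -!powRD ?(gt_eqF c0) ?implybT//.
by rewrite (_ : p + 1 + (-1 - p) = 0) ?powRr0 ?mul1r//; ring.
Qed.

End PowerTransform.

Section SaSMoments.
Context (R : realType).

Definition kolmogorov_const (p : R) : \bar R := power_transform (fun x => 1 - cos x) p.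

Definition stable_const (alpha p : R) : \bar R :=
  power_transform (fun x => 1 - expR (- (`|x| `^ alpha))) p.

Lemma stable_exponent_ge0 (alpha x : R) : 0 <= 1 - expR (- (`|x| `^ alpha)).
Proof. by rewrite subr_ge0 -expR0 ler_expR oppr_le0 powR_ge0. Qed.

Lemma measurable_stable_exponent (alpha : R) :
  measurable_fun [set: R] (fun x : R => 1 - expR (- (`|x| `^ alpha))).
Proof.
apply: measurable_funB => //; apply: measurableT_comp => //.
apply: measurableT_comp => //; exact: (measurableT_comp (measurable_powR _)).
Qed.

Lemma measurable_one_sub_cos : measurable_fun [set: R] (fun x : R => 1 - cos x).
Proof. by apply: measurable_funB => //; exact: measurable_cos. Qed.

Lemma one_sub_cos_ge0 (x : R) : 0 <= 1 - cos x.
Proof. by rewrite subr_ge0 cos_le1. Qed.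

(** It is enough to keep the integral over [1, 2]. *)
Lemma power_transform_gt0 (g : R -> R) (p c : R) : 0 < p -> 0 < c ->
  measurable_fun [set: R] g -> (forall x, 0 <= g x) ->
  (forall x, 1 <= x <= 2 -> c <= g x) ->
  ((c * 2 `^ (- 1 - p))%:E <= power_transform g p)%E.
Proof.
move=> p0 c0 mg g0 gc.
have mF : measurable_fun [set: R] (fun x => (g x * pospow x (- 1 - p))%:E).
  by apply/measurable_EFinP; apply: measurable_funM => //; exact: measurable_pospow.
have -> : ((c * 2 `^ (- 1 - p))%:E =
    \int[lebesgue_measure]_(x in `[1%R, 2%R]) (cst (c * 2 `^ (- 1 - p))%:E x))%E.
  rewrite integral_cst//= lebesgue_measure_itv/= lte_fin ltr1n/= -EFinD -EFinM.
  by congr EFin; rewrite (_ : 2 - 1 = 1) ?mulr1//; ring.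
apply: (@le_trans _ _ (\int[lebesgue_measure]_(x in `[1%R, 2%R])
    (g x * pospow x (- 1 - p))%:E)%E); last first.
  apply: ge0_subset_integral => // x _.
  by rewrite lee_fin mulr_ge0 ?pospow_ge0.
apply: ge0_le_integral => //.
- by move=> x _; rewrite lee_fin mulr_ge0 ?powR_ge0// ltW.
- exact: measurable_funTS.
- move=> x; rewrite /= in_itv/= => /andP[x1 x2]; rewrite lee_fin.
  have x0 : 0 < x by lra.
  rewrite ler_pM ?powR_ge0 ?(ltW c0)//; first by rewrite gc ?x1.
  rewrite /pospow x0 (_ : - 1 - p = - (1 + p)); last by ring.
  rewrite !powRN lef_pV2 ?posrE ?powR_gt0//.
  by apply: ge0_ler_powR; rewrite ?nnegrE//; lra.
Qed.

Lemma kolmogorov_const_gt0 (p : R) : 0 < p -> (0 < kolmogorov_const p)%E.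
Proof.
move=> p0; have h : cos (1 : R) < 1.
  rewrite lt_neqAle cos_le1 andbT; apply/negP => /eqP h.
  have := @cos_inj R 1 0; rewrite !in_itv/= cos0 h.
  have := pihalf_lt2 R; have := @pi_ge2 R => pi2 _ /(_ _ _ erefl) e.
  have /eqP : 1 = 0 :> R by apply: e; lra.
  by rewrite oner_eq0.
apply: lt_le_trans (power_transform_gt0 p0 (_ : 0 < 1 - cos 1) measurable_one_sub_cos one_sub_cos_ge0 _).
- by rewrite lte_fin mulr_gt0 ?powR_gt0//; lra.
- by rewrite subr_gt0.
- move=> x x12; rewrite lerD2l lerN2.
  have pi2 := @pi_ge2 R.
  by rewrite leNgt ltr_cos ?in_itv/= -?leNgt; lra.
Qed.

(** Near 0 the bound 1 - cos x <= x makes the integrand O(x^(-p)), integrable because p < 1;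
    at infinity it is O(x^(-1-p)). *)
Lemma kolmogorov_const_fin (p : R) : 0 < p < 1 -> (kolmogorov_const p < +oo)%E.
Proof.
move=> /andP[p0 p1].
have mF : measurable_fun [set: R] (fun x => (1 - cos x) * pospow x (- 1 - p)).
  by apply: measurable_funM; [exact: measurable_one_sub_cos|exact: measurable_pospow].
apply: le_lt_trans (le_integral_near0_tail (C1 := 1) (C2 := 2) (a := - p) (g := 1 + p) mF _ _ _ _ _ _ _ _) _ => //.
- by move=> x; rewrite mulr_ge0 ?pospow_ge0 ?one_sub_cos_ge0.
- by move=> x x0; rewrite /pospow ltNge x0/= mulr0.
- lra.
- lra.
- move=> x x0 x1; rewrite /pospow x0 mul1r [in leRHS](_ : - p = 1 + (- 1 - p)); last by ring.
  rewrite [in leRHS]powRD ?(gt_eqF x0) ?implybT// powRr1 ?(ltW x0)//.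
  by rewrite ler_wpM2r ?powR_ge0// one_sub_cos_le// ltW.
- move=> x x1; have x0 : 0 < x by lra.
  rewrite /pospow x0 opprD ler_wpM2r ?powR_ge0//.
  by have := cos_geN1 x; lra.
- by rewrite ltry.
Qed.

Lemma stable_const_gt0 (alpha p : R) : 0 < alpha -> 0 < p -> (0 < stable_const alpha p)%E.
Proof.
move=> al0 p0.
have h : 0 < 1 - expR (- 1) :> R.
  by rewrite subr_gt0 -[ltRHS]expR0 ltr_expR; lra.
apply: lt_le_trans (power_transform_gt0 p0 h (measurable_stable_exponent alpha)
   (stable_exponent_ge0 alpha) _).
  by rewrite lte_fin mulr_gt0 ?powR_gt0.
move=> x /andP[x1 x2]; rewrite lerD2l lerN2 ler_expR lerN2 ger0_norm; last lra.
have -> : (1 <= x `^ alpha) = (1 `^ alpha <= x `^ alpha) by rewrite powR1.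
by apply: ge0_ler_powR; rewrite ?nnegrE//; lra.
Qed.

(** Near 0 the integrand is O(x^(alpha-1-p)), integrable because p < alpha. *)
Lemma stable_const_fin (alpha p : R) : 0 < p < alpha -> (stable_const alpha p < +oo)%E.
Proof.
move=> /andP[p0 p1].
have mF : measurable_fun [set: R] (fun x => (1 - expR (- (`|x| `^ alpha))) * pospow x (- 1 - p)).
  by apply: measurable_funM; [exact: measurable_stable_exponent|exact: measurable_pospow].
apply: le_lt_trans (le_integral_near0_tail (C1 := 1) (C2 := 1) (a := alpha - 1 - p) (g := 1 + p) mF _ _ _ _ _ _ _ _) _ => //.
- by move=> x; rewrite mulr_ge0 ?pospow_ge0 ?stable_exponent_ge0.
- by move=> x x0; rewrite /pospow ltNge x0/= mulr0.
- lra.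
- lra.
- move=> x x0 x1; rewrite /pospow x0 mul1r [in leRHS](_ : alpha - 1 - p = alpha + (- 1 - p)); last by ring.
  rewrite [in leRHS]powRD ?(gt_eqF x0) ?implybT//.
  rewrite ler_wpM2r ?powR_ge0// gtr0_norm//.
  by have := expR_ge1Dx (- x `^ alpha); lra.
- move=> x x1; have x0 : 0 < x by lra.
  by rewrite /pospow x0 opprD ler_wpM2r ?powR_ge0 ?gerBl ?expR_ge0.
- by rewrite ltry.
Qed.


Lemma bounded_measurable_integrable d (T : measurableType d) (P : probability T R)
    (f : T -> R) (M : R) :
  measurable_fun setT f -> (forall w, `|f w| <= M) -> P.-integrable setT (EFin \o f).
Proof.
move=> mf fM; apply: measurable_bounded_integrable => //.
  by rewrite -ge0_fin_numE// fin_num_measure.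
exists M; split; first exact: num_real.
by move=> x Mx y _ /=; rewrite (le_trans (fM y))// ltW.
Qed.

(** Real part of the characteristic function. *)
Lemma SaS_one_sub_cos d (T : measurableType d) (P : probability T R)
    (alpha sigma : R) (X : {RV P >-> R}) (xi : R) : is_SaS P alpha sigma X ->
  (\int[P]_w (1 - cos (xi * X w))%:E = (1 - expR (- (`|sigma * xi| `^ alpha)))%:E)%E.
Proof.
move=> /(_ xi) /(congr1 (@complex.Re R)) /=; rewrite unlock => h.
have mc : measurable_fun setT (fun w => cos (xi * X w)).
  apply: (measurableT_comp (@measurable_cos R)).
  by apply: measurable_funM => //; exact: measurable_funP.
have ic := @bounded_measurable_integrable _ _ P _ 1 mc (fun w => cos_max _).
rewrite integralB_EFin//; last first.
  by apply: (@bounded_measurable_integrable _ _ P (cst 1) 1) => // w; rewrite normr1.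
rewrite EFinB -h fineK; last exact: integrable_fin_num.
congr (_ - _)%E; have := @expectation_cst _ _ _ P 1; rewrite unlock; exact.
Qed.

(** Integrate the representation |x|^p K_p = int (1 - cos(x xi)) xi^(-1-p) dxi against the law
    of X, exchange the integrals, and use the characteristic function: the inner integral
    becomes 1 - exp(-|sigma xi|^alpha), and scaling extracts sigma^p. *)
Lemma SaS_moment_identity d (T : measurableType d) (P : probability T R)
    (alpha sigma p : R) (X : {RV P >-> R}) :
  0 < alpha -> 0 < p -> 0 <= sigma -> is_SaS P alpha sigma X ->
  (\int[P]_w (`|X w| `^ p)%:E * kolmogorov_const p
   = (sigma `^ p)%:E * stable_const alpha p)%E.
Proof.
move=> al0 p0 s0 hX.
have mX : measurable_fun setT (X : T -> R) by exact: measurable_funP.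
have mXp : measurable_fun setT (fun w => (`|X w| `^ p)%:E).
  apply/measurable_EFinP; apply: (measurableT_comp (measurable_powR _)) => //.
  exact: measurableT_comp.
rewrite -ge0_integralZr//; last by rewrite ltW// kolmogorov_const_gt0.
pose f (z : T * measurableTypeR R) : \bar R :=
  ((1 - cos (z.2 * X z.1)) * pospow z.2 (- 1 - p))%:E.
have mf : measurable_fun setT f.
  apply/measurable_EFinP; apply: measurable_funM; last first.
    exact: (measurableT_comp (measurable_pospow _)).
  apply: (measurableT_comp measurable_one_sub_cos).
  by apply: measurable_funM => //; exact: measurableT_comp.
have f0 z : (0 <= f z)%E by rewrite lee_fin mulr_ge0 ?pospow_ge0 ?one_sub_cos_ge0.
transitivity (\int[P]_w \int[@lebesgue_measure R]_xi f (w, xi))%E.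
  apply: eq_integral => w _.
  rewrite /kolmogorov_const -power_transform_scale ?cos0 ?subrr//; last first.
    exact: measurable_one_sub_cos.
  apply: eq_integral => xi _; rewrite /f/=; congr (((1 - _) * _)%:E).
  by rewrite -[LHS]cos_norm -[RHS]cos_norm !normrM normr_id mulrC.
rewrite (@fubini_tonelli _ _ _ _ _ P lebesgue_measure f mf f0).
rewrite /stable_const -(power_transform_scale p0 s0 (measurable_stable_exponent alpha)
  (stable_exponent_ge0 alpha)); last first.
  by rewrite normr0 powR0 ?gt_eqF// oppr0 expR0 subrr.
apply: eq_integral => xi _; rewrite /f/=.
under eq_integral do rewrite EFinM muleC.
have mg : measurable_fun setT (fun w => (1 - cos (xi * X w))%:E).
  apply/measurable_EFinP; apply: (measurableT_comp measurable_one_sub_cos).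
  exact: measurable_funM.
have g0 w : setT w -> (0 <= (1 - cos (xi * X w))%:E)%E by rewrite lee_fin one_sub_cos_ge0.
rewrite (ge0_integralZl_EFin P measurableT g0 mg (pospow_ge0 _ _)).
by rewrite (SaS_one_sub_cos _ hX) muleC.
Qed.

(** A constant that depends on alpha and p alone. Only the positivity of K_p is used, so
    that exponents p >= 1, for which K_p may be infinite, are covered. *)
Lemma SaS_moment_le (alpha p : R) : 0 < p < alpha ->
  exists2 M : R, 0 <= M & forall d (T : measurableType d) (P : probability T R)
    (X : {RV P >-> R}) (sigma : R), 0 <= sigma -> is_SaS P alpha sigma X ->
    (\int[P]_w (`|X w| `^ p)%:E <= (M * sigma `^ p)%:E)%E.
Proof.
move=> /andP[p0 pa].
have fB : (stable_const alpha p < +oo)%E by apply: stable_const_fin; rewrite p0.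
have B0 : (0 < stable_const alpha p)%E by apply: stable_const_gt0 => //; lra.
have [a a0 aA] : exists2 a : R, 0 < a & (a%:E <= kolmogorov_const p)%E.
  have := kolmogorov_const_gt0 p0; case: (kolmogorov_const p) => [r|_|//].
    by rewrite lte_fin => r0; exists r.
  by exists 1; rewrite ?leey.
exists (fine (stable_const alpha p) / a).
  by rewrite divr_ge0 ?(ltW a0)// fine_ge0// ltW.
move=> d T P X sigma s0 hX.
have E := SaS_moment_identity (lt_trans p0 pa) p0 s0 hX.
have I0 : (0 <= \int[P]_w (`|X w| `^ p)%:E)%E.
  by apply: integral_ge0 => w _; rewrite lee_fin powR_ge0.
rewrite mulrAC EFinM lee_pdivlMr//.
apply: (@le_trans _ _ (\int[P]_w (`|X w| `^ p)%:E * kolmogorov_const p)%E).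
  by rewrite lee_wpmul2l.
rewrite E EFinM fineK; first by rewrite muleC.
by rewrite ge0_fin_numE// ltW.
Qed.

Lemma SaS_moment_eq (alpha p : R) : 0 < p < alpha -> p < 1 ->
  exists2 M : R, 0 < M & forall d (T : measurableType d) (P : probability T R)
    (X : {RV P >-> R}) (sigma : R), 0 <= sigma -> is_SaS P alpha sigma X ->
    (\int[P]_w (`|X w| `^ p)%:E = (M * sigma `^ p)%:E)%E.
Proof.
move=> /andP[p0 pa] p1.
have fB : (stable_const alpha p < +oo)%E by apply: stable_const_fin; rewrite p0.
have B0 : (0 < stable_const alpha p)%E by apply: stable_const_gt0 => //; lra.
have fA : (kolmogorov_const p < +oo)%E by apply: kolmogorov_const_fin; rewrite p0.
have A0 := kolmogorov_const_gt0 p0.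
exists (fine (stable_const alpha p) / fine (kolmogorov_const p)).
  by rewrite divr_gt0// fine_gt0// ?A0 ?B0.
move=> d T P X sigma s0 hX.
have := SaS_moment_identity (lt_trans p0 pa) p0 s0 hX.
have a0 : 0 < fine (kolmogorov_const p) by rewrite fine_gt0// A0.
rewrite -[X in (_ * X = _)%E]fineK; last by rewrite ge0_fin_numE// ltW.
rewrite -[X in (_ = _ * X)%E]fineK; last by rewrite ge0_fin_numE// ltW.
move: a0; set a := fine _; set b := fine _ => a0.
have : (0 <= \int[P]_w (`|X w| `^ p)%:E)%E.
  by apply: integral_ge0 => w _; rewrite lee_fin powR_ge0.
case: (integral _ _ _) => [r _|_|//].
- rewrite -!EFinM => -[E]; congr EFin.
  by rewrite mulrAC [b * _]mulrC -E mulfK// gt_eqF.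
- by rewrite gt0_mulye ?lte_fin// -EFinM.
Qed.

End SaSMoments.

(** * Independence and Chernoff bounds *)

Lemma expR_le_quadratic (R : realType) (y : R) : y <= 1 -> expR y <= 1 + y + y ^+ 2.
Proof.
move=> y1.
pose f (x : R) := (1 + x + x ^+ 2) * expR (- x).
pose df (x : R) := x * (1 - x) * expR (- x).
have dF (x : R) : is_derive x 1 f (df x).
  have h : is_derive x 1 (fun x : R => expR (- x)) (- expR (- x)).
    have := @is_derive1_comp R (@expR R) (-%R) x (expR (- x)) (- 1) _ _.
    by rewrite mulrN1; apply.
  have h2 : is_derive x 1 (fun x : R => 1 + x + x ^+ 2) (1 + 2 * x).
    apply: is_derive_eq; rewrite /GRing.scale/= ?expr1; ring.
  have := is_deriveM h2 h.
  have -> : (1 + x + x ^+ 2) *: - expR (- x) + expR (- x) *: (1 + 2 * x) = df x.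
    by rewrite /df /GRing.scale/=; ring.
  by [].
have cf (A : set R) : {within A, continuous f}.
  apply: continuous_subspaceT => x.
  by have [/derivable1_diffP/differentiable_continuous] := dF x.
suff : 1 <= f y.
  by rewrite /f expRN ler_pdivlMr ?expR_gt0// mul1r.
have f0 : f 0 = 1 by rewrite /f oppr0 expR0 expr0n/= !addr0 mulr1.
have [y0|y0|->] := ltgtP y 0; last by rewrite f0.
- have [c] := MVT y0 (fun x _ => dF x) (cf _).
  rewrite in_itv/= => /andP[_ c0]; rewrite f0 sub0r => E.
  have : df c * - y <= 0.
    rewrite /df mulr_le0_ge0//; last lra.
    rewrite mulr_le0_ge0 ?expR_ge0// mulr_le0_ge0//; lra.
  by rewrite -E; lra.
- have [c] := MVT y0 (fun x _ => dF x) (cf _).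
  rewrite in_itv/= => /andP[c0 cy]; rewrite f0 subr0 => E.
  have : 0 <= df c * y.
    rewrite /df mulr_ge0//; last lra.
    by rewrite mulr_ge0 ?expR_ge0// mulr_ge0//; lra.
  by rewrite -E; lra.
Qed.

Section Independence.
Context (R : realType) (d : measure_display) (T : measurableType d) (P : probability T R).

(** A family of factors is integrated one variable at a time: a product formula known for
    indicators of Borel sets passes to simple functions, then to monotone limits. *)
Lemma integral_factor_of_indic (X : T -> R) (G : T -> \bar R) (c : \bar R) (g : R -> R) :
  measurable_fun setT X -> measurable_fun setT G -> (forall w, (0 <= G w)%E) ->
  (0 <= c)%E ->
  (forall B : set R, measurable B ->
    (\int[P]_w (G w * (\1_B (X w))%:E) = c * \int[P]_w (\1_B (X w))%:E)%E) ->
  measurable_fun setT g -> (forall x, 0 <= g x) ->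
  (\int[P]_w (G w * (g (X w))%:E) = c * \int[P]_w (g (X w))%:E)%E.
Proof.
move=> mX mG G0 c0 H mg g0.
pose I (z : T * measurableTypeR R) : R := \1_[set x | z.2 < g x] (X z.1) * \1_`[0, +oo[%classic z.2.
pose S t : set R := [set x | t < g x].
have mS t : measurable (S t).
  rewrite (_ : S t = g @^-1` `]t, +oo[).
    by rewrite -[X in measurable X]setTI; exact: mg.
  by apply/seteqP; split => x /=; rewrite in_itv/= andbT.
have IE z : I z = if (z.2 < g (X z.1)) && (0 <= z.2) then 1 else 0.
  rewrite /I !indicE (_ : (X z.1 \in _) = (z.2 < g (X z.1))); last first.
    by apply/idP/idP; rewrite inE.
  rewrite (_ : (z.2 \in _) = (0 <= z.2)); last first.
    by apply/idP/idP; rewrite inE/= in_itv/= andbT.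
  by case: (_ < _); case: (_ <= _); rewrite ?mulr1 ?mulr0.
have mI : measurable_fun setT I.
  rewrite (_ : I = fun z => if (z.2 < g (X z.1)) && (0 <= z.2) then 1 else 0); last exact/funext.
  apply: measurable_fun_ifT => //; apply: measurable_and.
    apply: measurable_fun_ltr => //; apply: (measurableT_comp mg).
    exact: (measurableT_comp mX).
  exact: measurable_fun_ler.
have I0 z : 0 <= I z by rewrite IE; case: ifP.
have layer w : (\int[@lebesgue_measure R]_t (I (w, t))%:E = (g (X w))%:E)%E.
  transitivity (\int[@lebesgue_measure R]_t (\1_`[0, g (X w)[%classic t)%:E)%E.
    apply: eq_integral => t _; rewrite IE/= indicE; congr EFin.
    rewrite (_ : (t \in _) = (t < g (X w)) && (0 <= t)); first by case: ifP.
    by apply/idP/idP; rewrite inE/= in_itv/= andbC.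
  rewrite integral_indic// setIT.
  transitivity (@lebesgue_measure R [set` `[0, g (X w)[ ]) => //.
  rewrite lebesgue_measure_itv/= lte_fin.
  case: ltP => h; first by rewrite -EFinB subr0.
  by congr EFin; apply/eqP; rewrite eq_le g0 h.
have mGI : measurable_fun setT (fun z : T * measurableTypeR R => G z.1 * (I z)%:E)%E.
  apply: emeasurable_funM; first exact: (measurableT_comp mG).
  exact/measurable_EFinP.
have mIE : measurable_fun setT (fun z : T * measurableTypeR R => (I z)%:E).
  exact/measurable_EFinP.
have m1 (a : T) (f : T * measurableTypeR R -> \bar R) : measurable_fun setT f ->
    measurable_fun setT (fun t : measurableTypeR R => f (a, t)).
  by move=> mf; apply: (measurableT_comp mf).
have m2 (t : measurableTypeR R) (f : T * measurableTypeR R -> \bar R) : measurable_fun setT f ->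
    measurable_fun setT (fun w => f (w, t)).
  by move=> mf; apply: (measurableT_comp mf).
have E1 : (\int[P]_w (G w * (g (X w))%:E) =
    \int[P]_w \int[@lebesgue_measure R]_t (G w * (I (w, t))%:E))%E.
  apply: eq_integral => w _.
  rewrite ge0_integralZl//; first by rewrite layer.
  - exact: (m1 w _ mIE).
  - by move=> t _; rewrite lee_fin.
have E2 : (\int[P]_w (g (X w))%:E = \int[P]_w \int[@lebesgue_measure R]_t (I (w, t))%:E)%E.
  by apply: eq_integral => w _; rewrite layer.
rewrite E1 E2.
rewrite (@fubini_tonelli _ _ _ _ _ P lebesgue_measure _ mGI); last first.
  by move=> z; rewrite mule_ge0// lee_fin.
rewrite (@fubini_tonelli _ _ _ _ _ P lebesgue_measure _ mIE); last by move=> z; rewrite lee_fin.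
rewrite -ge0_integralZl//; last 2 first.
- apply: (@measurable_fun_fubini_tonelli_G _ _ _ _ _ P (fun z : T * measurableTypeR R => (I z)%:E)) => //.
- by move=> t _; apply: integral_ge0 => w _; rewrite lee_fin.
apply: eq_integral => t _.
have := H _ (mS t) => {}H.
have [t0|t0] := leP 0 t; last first.
  rewrite !integral0_eq ?mule0//.
  - by move=> w _; rewrite IE/= leNgt t0 andbF.
  - by move=> w _; rewrite IE/= leNgt t0 andbF mule0.
have Q w : I (w, t) = \1_(S t) (X w).
  rewrite IE/= t0 andbT indicE; case: ifPn => h; first by rewrite mem_set.
  by rewrite memNset//; apply/negP.
rewrite [X in _ = (c * X)%E](eq_integral (fun w => (\1_(S t) (X w))%:E)); last first.
  by move=> w _; rewrite Q.
by rewrite -H; apply: eq_integral => w _; rewrite Q.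
Qed.

(** Induction on the number of factors that are not yet indicators; the indicator case is
    the definition of independence. *)
Lemma independent_expectation_prod (n : nat) (X : 'I_n -> T -> R) (g : 'I_n -> R -> R) :
  (forall i, measurable_fun setT (X i)) -> mutually_independent P X ->
  (forall i, measurable_fun setT (g i)) -> (forall i x, 0 <= g i x) ->
  (\int[P]_w (\prod_i g i (X i w))%:E = \prod_i \int[P]_w (g i (X i w))%:E)%E.
Proof.
move=> mX indX.
suff H k : forall g : 'I_n -> R -> R,
    (forall i, measurable_fun setT (g i)) -> (forall i x, 0 <= g i x) ->
    (forall i : 'I_n, (k <= i)%N -> exists2 B : set R, measurable B & g i = \1_B) ->
    (\int[P]_w (\prod_i g i (X i w))%:E = \prod_i \int[P]_w (g i (X i w))%:E)%E.
  move=> mg g0; apply: (H n) => // i ni.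
  by have := ltn_ord i; rewrite ltnNge ni.
elim: k => [|k IH] {}g mg g0 gk.
  have /choice[B BP] : forall i, exists B : set R, measurable B /\ g i = \1_B.
    by move=> i; have [B mB ->] := gk i isT; exists B.
  have mXB i : measurable (X i @^-1` B i).
    by rewrite -[X in measurable X]setTI; apply: (mX i) => //; case: (BP i).
  have E i : (\int[P]_w (g i (X i w))%:E = P (X i @^-1` B i))%E.
    have [mB ->] := BP i; rewrite -[in RHS](setIT (X i @^-1` B i)) -integral_indic//.
  rewrite (eq_bigr _ (fun i _ => E i)) -(indX B) => [|i]; last by case: (BP i).
  rewrite -[in RHS](setIT (\bigcap_i _)) -integral_indic//; last first.
    by apply: fin_bigcap_measurable.
  apply: eq_integral => w _; congr EFin; rewrite indicE.
  have [h|h] := boolP (w \in _).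
    apply: big1 => i _; have [_ ->] := BP i; rewrite indicE mem_set//.
    by move: h; rewrite inE => /(_ i I).
  have [i hi] : exists i, ~ B i (X i w).
    by apply/existsNP => h2; move/negP: h; apply; rewrite inE => i _; exact: h2.
  rewrite (bigD1 i)//=; have [_ ->] := BP i.
  by rewrite indicE memNset// mul0r.
have [nk|kn] := leqP n k.
  by apply: IH => // i ki; have := ltn_ord i; rewrite ltnNge (leq_trans nk).
pose i0 := Ordinal kn.
have m0 (h : 'I_n -> R -> R) : (forall i, measurable_fun setT (h i)) ->
    measurable_fun setT (fun w => (\prod_(i | i != i0) h i (X i w))%:E).
  move=> mh; apply/measurable_EFinP.
  under eq_fun do rewrite big_mkcond/=.
  apply: (measurable_prod (h := fun i w => if i != i0 then h i (X i w) else 1)) => i _.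
  case: (i != i0) => //.
  exact: (measurableT_comp (mh i)).
rewrite (bigD1 i0)//= muleC.
rewrite -(integral_factor_of_indic (X := X i0) (G := fun w => (\prod_(i | i != i0) g i (X i w))%:E)) //.
- by apply: eq_integral => w _; rewrite (bigD1 i0)//= mulrC.
- exact: m0.
- by move=> w; rewrite lee_fin; apply: prodr_ge0.
- by apply: prode_ge0 => i _; apply: integral_ge0 => w _; rewrite lee_fin.
move=> B mB.
pose g' (i : 'I_n) := if i == i0 then \1_B else g i.
have gi0 : g' i0 = \1_B by rewrite /g' eqxx.
have gne i : i != i0 -> g' i = g i by rewrite /g' => /negbTE ->.
have : (\int[P]_w (\prod_i g' i (X i w))%:E = \prod_i \int[P]_w (g' i (X i w))%:E)%E.
  apply: IH.
  - by move=> i; rewrite /g'; case: (i == i0) => //; exact: measurable_indic.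
  - by move=> i x; rewrite /g'; case: (i == i0) => //; rewrite indicE.
  - move=> i ki; have [->|ii0] := eqVneq i i0; first by exists B.
    rewrite gne//; apply: gk; rewrite ltn_neqAle ki andbT; apply: contra ii0 => /eqP e.
    by apply/eqP/val_inj.
rewrite [in RHS](bigD1 i0)//= gi0 muleC => H.
rewrite (_ : \prod_(i < n | i != i0) \int[P]_w (g i (X i w))%:E =
  \prod_(i < n | i != i0) \int[P]_w (g' i (X i w))%:E)%E; last first.
  by apply: eq_bigr => i ii0; rewrite gne.
rewrite -H; apply: eq_integral => w _; rewrite [in RHS](bigD1 i0)//= gi0 -EFinM mulrC; congr (_ * _)%:E.
by apply: eq_bigr => i ii0; rewrite gne.
Qed.

Lemma bounded_rv_integrable (f : T -> R) (M : R) :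
  measurable_fun setT f -> (forall w, `|f w| <= M) -> P.-integrable setT (EFin \o f).
Proof. exact: bounded_measurable_integrable. Qed.

(** Apply exp(x) <= 1 + x + x^2, valid for x <= 1, then 1 + x <= exp(x). *)
Lemma le_exp_moment (y : T -> R) (M m2 s : R) :
  measurable_fun setT y -> 0 <= M -> (forall w, 0 <= y w <= M) -> `|s| * M <= 1 ->
  (\int[P]_w (y w ^+ 2)%:E <= m2%:E)%E ->
  (\int[P]_w (expR (s * y w))%:E
    <= (expR (s * (\int[P]_w y w)%R + s ^+ 2 * m2))%:E)%E.
Proof.
move=> my M0 yM sM hm2.
have my2 : measurable_fun setT (fun w => y w ^+ 2) by exact: measurable_funX.
have mexp : measurable_fun setT (fun w => expR (s * y w)).
  by apply: measurableT_comp => //; exact: measurable_funM.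
have ny w : `|y w| <= M by have /andP[h1 h2] := yM w; rewrite ger0_norm.
have sy w : s * y w <= 1.
  apply: le_trans sM; apply: (le_trans (ler_norm _)).
  by rewrite normrM ler_wpM2l.
have iy : P.-integrable setT (EFin \o y) by apply: (bounded_rv_integrable my ny).
have iy2 : P.-integrable setT (EFin \o (fun w => y w ^+ 2)).
  apply: (bounded_rv_integrable (M := M ^+ 2) my2) => w.
  by rewrite normrX lerXn2r ?nnegrE.
have i1 : P.-integrable setT (EFin \o cst (1 : R)).
  by apply: (bounded_rv_integrable (M := 1)) => // w; rewrite normr1.
have isy : P.-integrable setT (EFin \o (fun w => s * y w)).
  exact: (integrableZl measurableT s iy).
have is2 : P.-integrable setT (EFin \o (fun w => s ^+ 2 * y w ^+ 2)).
  exact: (integrableZl measurableT (s ^+ 2) iy2).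
have i1s : P.-integrable setT (EFin \o (fun w => cst 1 w + s * y w)).
  exact: (integrableD measurableT i1 isy).
have i1s2 : P.-integrable setT (EFin \o (fun w => cst 1 w + s * y w + s ^+ 2 * y w ^+ 2)).
  exact: (integrableD measurableT i1s is2).
apply: (@le_trans _ _ (\int[P]_w (cst 1 w + s * y w + s ^+ 2 * y w ^+ 2)%:E)%E).
  apply: ge0_le_integral => //.
  - exact/measurable_EFinP.
  - by have /integrableP[] := i1s2.
  - by move=> w _; rewrite lee_fin -exprMn; exact: expR_le_quadratic.
rewrite -[leLHS]fineK; last exact: (integrable_fin_num _ i1s2).
rewrite lee_fin.
rewrite -/(Rintegral P setT (fun w => cst 1 w + s * y w + s ^+ 2 * y w ^+ 2)).
rewrite (RintegralD measurableT i1s is2) (RintegralD measurableT i1 isy).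
rewrite (RintegralZl _ measurableT iy) (RintegralZl _ measurableT iy2).
have -> : (\int[P]_x cst 1 x = 1)%R.
  by rewrite /Rintegral; have := @expectation_cst _ _ _ P 1; rewrite unlock => ->.
have h2 : (\int[P]_x (y x ^+ 2))%R <= m2.
  rewrite -lee_fin /Rintegral fineK//; exact: (integrable_fin_num _ iy2).
apply: le_trans (expR_ge1Dx _); rewrite -addrA lerD2l lerD2l.
by rewrite ler_wpM2l// sqr_ge0.
Qed.

Section Chernoff.
Context (n : nat) (X : 'I_n -> T -> R) (g : 'I_n -> R -> R) (M m2 : R).
Context (mX : forall i, measurable_fun setT (X i)) (indX : mutually_independent P X).
Context (mg : forall i, measurable_fun setT (g i)) (M0 : 0 < M).
Context (gM : forall i x, 0 <= g i x <= M).
Context (hm2 : forall i, (\int[P]_w (g i (X i w) ^+ 2)%:E <= m2%:E)%E).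

Let mu i := (\int[P]_w (g i (X i w)))%R.

(** The parameter s = 1/M or -1/M is the largest for which the quadratic bound on the
    exponential applies to variables with values in [0, M]. *)
Lemma chernoff_one_sided (s t : R) : `|s| = M^-1 ->
  (P [set w | t <= (s * M) * \sum_i (g i (X i w) - mu i)]%R
    <= (expR (- (t / M) + n%:R * (m2 / M ^+ 2)))%:E)%E.
Proof.
move=> sM.
have mgX i : measurable_fun setT (fun w => g i (X i w)) by exact: (measurableT_comp (mg i)).
have mS : measurable_fun setT (fun w => \sum_i (g i (X i w) - mu i)).
  apply: measurable_sum => i.
  exact: measurable_funB.
set A := [set w | _].
have mA : measurable A.
  rewrite /A -[X in measurable X]setTI.
  apply: (measurable_fun_le (f := cst t) (g := fun w => s * M * \sum_i (g i (X i w) - mu i))) => //.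
  exact: measurable_funM.
pose c := - (t / M) - s * \sum_i mu i.
apply: (@le_trans _ _ (\int[P]_w (expR c * \prod_i expR (s * g i (X i w)))%:E)%E).
  rewrite -[P A]mul1e -(setIT A) -integral_indic// mul1e.
  apply: ge0_le_integral => //.
  - by apply/measurable_EFinP.
  - apply/measurable_EFinP; apply: measurable_funM => //.
    apply: (measurable_prod (h := fun i w => expR (s * g i (X i w)))) => i _.
    by apply: measurableT_comp => //; exact: measurable_funM.
  - move=> w _; rewrite lee_fin -expR_sum -expRD indicE.
    case: (boolP (w \in A)) => [|_]; last exact: expR_ge0.
    rewrite inE /A/= => h; rewrite -expR0 ler_expR /c -mulr_sumr.
    move: h; rewrite sumrB mulrAC -ler_pdivrMr// => h.
    by rewrite /mu in h *; lra.
under eq_integral do rewrite EFinM.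
rewrite ge0_integralZl_EFin ?expR_ge0//; last 2 first.
- by move=> w _; rewrite lee_fin prodr_ge0// => i _; exact: expR_ge0.
- apply/measurable_EFinP.
  apply: (measurable_prod (h := fun i w => expR (s * g i (X i w)))) => i _.
  by apply: measurableT_comp => //; exact: measurable_funM.
rewrite (independent_expectation_prod (g := fun i x => expR (s * g i x)) mX indX); last 2 first.
- by move=> i; apply: measurableT_comp => //; exact: measurable_funM.
- by move=> i x; exact: expR_ge0.
have sM1 : `|s| * M <= 1 by rewrite sM mulVf// gt_eqF.
apply: (@le_trans _ _ ((expR c)%:E * \prod_(i < n) (expR (s * mu i + s ^+ 2 * m2))%:E)%E).
  rewrite lee_wpmul2l ?lee_fin ?expR_ge0//.
  suff /andP[] : (0 <= \prod_i \int[P]_w (expR (s * g i (X i w)))%:E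
      <= \prod_(i < n) (expR (s * mu i + s ^+ 2 * m2))%:E)%E by [].
  apply: (big_ind2 (fun x y : \bar R => (0 <= x <= y)%E)) => [|x1 x2 y1 y2|i _].
  - by rewrite lee01 lexx.
  - by move=> /andP[? ?] /andP[? ?]; rewrite mule_ge0// lee_pmul.
  - apply/andP; split.
      by apply: integral_ge0 => w _; rewrite lee_fin expR_ge0.
    by apply: (le_exp_moment (M := M)) => //; exact: ltW.
rewrite prodEFin -EFinM lee_fin -expR_sum -expRD ler_expR /c.
rewrite big_split/= -mulr_sumr sumr_const card_ord -mulr_natl.
have -> : s ^+ 2 = M ^- 2 by rewrite -real_normK ?num_real// sM exprVn.
rewrite [m2 / _]mulrC; lra.
Qed.

Lemma chernoff_independent_sum (t : R) :
  (P [set w | t <= `|\sum_i (g i (X i w) - mu i)|]%R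
    <= (2 * expR (- (t / M) + n%:R * (m2 / M ^+ 2)))%:E)%E.
Proof.
have Mi : 0 < M^-1 by rewrite invr_gt0.
have h1 := @chernoff_one_sided M^-1 t (gtr0_norm Mi).
have Mn : `|- M^-1| = M^-1 by rewrite normrN gtr0_norm.
have h2 := @chernoff_one_sided (- M^-1) t Mn.
have mS : measurable_fun setT (fun w => \sum_i (g i (X i w) - mu i)).
  apply: measurable_sum => i.
  by apply: measurable_funB => //; exact: (measurableT_comp (mg i)).
have mA (k : R) : measurable [set w | t <= k * \sum_i (g i (X i w) - mu i)].
  rewrite -[X in measurable X]setTI.
  apply: (measurable_fun_le (f := cst t) (g := fun w => k * \sum_i (g i (X i w) - mu i))) => //.
  exact: measurable_funM.
have E : [set w | t <= `|\sum_i (g i (X i w) - mu i)|] =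
  [set w | t <= M^-1 * M * \sum_i (g i (X i w) - mu i)] `|`
  [set w | t <= - M^-1 * M * \sum_i (g i (X i w) - mu i)].
  apply/seteqP; split => w/=; rewrite mulNr mulVf ?gt_eqF// mul1r mulN1r.
    by case: (ger0P (\sum_i _)) => _ ?; [left|right].
  by case=> h; apply: le_trans h _; rewrite ?ler_norm// -normrN ler_norm.
rewrite E; apply: (le_trans (measureU2 _ (mA _) (mA _))).
by rewrite mulrDl !mul1r EFinD leeD.
Qed.

End Chernoff.
End Independence.

(** * Increments of functions with a power-type singularity *)

(** Bounded on a box, power decay on its right, zero on its left: the shape of every kernel
    below. *)
Lemma le_integral_box_tail (R : realType) (f : R -> R) (C1 C2 a b g : R) :
  measurable_fun [set: R] f -> (forall x, 0 <= f x) ->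
  0 <= C1 -> 0 <= C2 -> 0 < b -> - a <= b -> 1 < g ->
  (forall x : R, x <= - a -> f x = 0) ->
  (forall x : R, - a < x -> x <= b -> f x <= C1) ->
  (forall x : R, b <= x -> f x <= C2 * x `^ (- g)) ->
  (\int[lebesgue_measure]_x (f x)%:E
    <= (C1 * (a + b) + C2 * (b `^ (1 - g) / (g - 1)))%:E)%E.
Proof.
move=> mf f0 C10 C20 b0 ab g1 fN h1 h2.
have mfE (D : set R) : measurable D -> measurable_fun D (EFin \o f).
  by move=> mD; apply/measurable_EFinP; exact: measurable_funTS.
have mp (D : set R) (e : R) : measurable D -> measurable_fun D (fun x : R => (x `^ e)%:E).
  by move=> mD; apply/measurable_EFinP; exact: measurable_funTS (measurable_powR e).
have mpc (D : set R) (C e : R) : measurable D -> measurable_fun D (fun x : R => (C * x `^ e)%:E).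
  move=> mD; apply/measurable_EFinP; apply: measurable_funTS.
  by apply: measurable_funM => //; exact: measurable_powR.
have fE0 x : (0 <= (f x)%:E)%E by rewrite lee_fin.
rewrite (@ge0_integral_split _ _ (- a))//; last exact: mfE.
rewrite integral0_eq ?add0e; last by move=> x; rewrite /= in_itv/= => x0; rewrite fN.
have -> : `](- a)%R, +oo[%classic = `](- a)%R, b] `|` `]b, +oo[ :> set R.
  by rewrite -itv_bndbnd_setU ?bnd_simp.
rewrite ge0_integral_setU//=; last 2 first.
- by apply: mfE; exact: measurableU.
- rewrite disj_set2E; apply/eqP/seteqP; split => x //=; rewrite !in_itv/= andbT.
  by case=> /andP[_ x1]; rewrite ltNge x1.
rewrite EFinD; apply: leeD.
- apply: (@le_trans _ _ (\int[lebesgue_measure]_(x in `](- a)%R, b]) (cst C1%:E x))%E).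
    apply: ge0_le_integral => //; first exact: mfE.
    by move=> x; rewrite /= in_itv/= => /andP[x0 x1]; rewrite lee_fin h1.
  rewrite integral_cst//= lebesgue_measure_itv/= lte_fin; case: ifP => _.
    by rewrite -EFinD -EFinM opprK addrC.
  by rewrite mule0 lee_fin mulr_ge0// -lerBlDl sub0r.
- apply: (@le_trans _ _ (\int[lebesgue_measure]_(x in `[b, +oo[) (C2%:E * (x `^ - g)%:E))%E).
    apply: (@le_trans _ _ (\int[lebesgue_measure]_(x in `[b, +oo[) (f x)%:E)%E).
      apply: ge0_subset_integral => //; first exact: mfE.
      by move=> x; rewrite /= !in_itv/= !andbT => /ltW.
    apply: ge0_le_integral => //; [exact: mfE|exact: mpc|].
    by move=> x; rewrite /= in_itv/= andbT => x1; rewrite lee_fin h2.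
  rewrite ge0_integralZl_EFin//; last 2 first.
  - by move=> x _; rewrite lee_fin powR_ge0.
  - exact: mp.
  by rewrite integral_powR_tail// -EFinM lee_fin.
Qed.

Section PowerBounds.
Variable R : realType.
Implicit Types x y e h : R.

Lemma powR_between x (lo e hi : R) : 0 < x -> lo <= e <= hi ->
  x `^ e <= x `^ lo + x `^ hi.
Proof.
move=> x0 /andP[le eh]; have [x1|x1] := leP 1 x.
  by apply: le_trans (ler_powR x1 eh) _; rewrite lerDr powR_ge0.
have : x `^ e <= x `^ lo by apply: ger_powR => //; rewrite x0 ltW.
by move=> /le_trans; apply; rewrite lerDl powR_ge0.
Qed.

Lemma normr_ln_le x e : 0 < x -> 0 < e -> `|ln x| <= e^-1 * (x `^ e + x `^ (- e)).
Proof.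
move=> x0 e0; rewrite ler_pdivlMl//.
have h (y : R) : 0 < y -> e * ln y <= y `^ e.
  move=> y0; have := expR_ge1Dx (e * ln y).
  rewrite /powR (gt_eqF y0); lra.
have h1 := h _ x0; have xi : 0 < x^-1 by rewrite invr_gt0.
have := h _ xi; rewrite lnV ?posrE// -powR_inv1 ?(ltW x0)// -powRrM mulN1r => h2.
case: (ger0P (ln x)) => l0; have := powR_ge0 x e; have := powR_ge0 x (- e); lra.
Qed.

Lemma normr_expR_sub1 y : `|expR y - 1| <= `|y| * (1 + expR y).
Proof.
have h1 := expR_ge1Dx y; have h2 := expR_ge1Dx (- y).
have ey := expR_gt0 y; have h3 : expR y * (1 - y) <= 1.
  by rewrite -ler_pdivlMl// mulr1 -expRN.
have [y0|y0] := leP 0 y.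
  rewrite ger0_norm; last lra.
  rewrite (ger0_norm y0); nra.
rewrite ler0_norm; last first.
  by rewrite subr_le0 -[leRHS]expR0 ler_expR ltW.
rewrite (ltr0_norm y0); nra.
Qed.

Lemma powR_sub1_le x h : 0 < x -> `|x `^ h - 1| <= `|h| * `|ln x| * (1 + x `^ h).
Proof. by move=> x0; rewrite /powR (gt_eqF x0) -normrM normr_expR_sub1. Qed.

End PowerBounds.

Section Increments.
Context (R : realType) (alpha th Th : R).

(** The value of the bound of [unit_increment_mass] for A = 1: box (-1, 1] and tail of
    exponent alpha (1 - Th). *)
Definition increment_const : R :=
  (8 `^ alpha) * 2 + (4 `^ alpha) / (alpha * (1 - Th) - 1).

Lemma tail_exponent_gt1 : 1 < alpha -> Th < 1 - alpha^-1 -> 1 < alpha * (1 - Th) /\ Th < 1.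
Proof.
move=> al1 hT; have i0 : 0 < alpha^-1 by rewrite invr_gt0; lra.
split; last lra.
by rewrite -ltr_pdivrMl ?mulr1; lra.
Qed.

Lemma increment_const_ge0 : 1 < alpha -> Th < 1 - alpha^-1 -> 0 <= increment_const.
Proof.
move=> al1 hT; have [? _] := tail_exponent_gt1 al1 hT.
by rewrite addr_ge0 ?mulr_ge0 ?powR_ge0 ?invr_ge0//; lra.
Qed.

(** The exponents th <= Th control g near 0 and at infinity; g may thus be a combination of
    powers of x, with logarithmic factors, whose exponents lie strictly between them. *)
Definition power_controlled (A : R) (g dg : R -> R) : Prop :=
  [/\ measurable_fun [set: R] g, forall x : R, x <= 0 -> g x = 0,
      forall x : R, 0 < x -> `|g x| <= A * (x `^ th + x `^ Th),
      forall x : R, 0 < x -> is_derive x 1 g (dg x) &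
      forall x : R, 0 < x -> `|dg x| <= A * (x `^ (th - 1) + x `^ (Th - 1))].

(** For x <= 1 both values are bounded; for x > 1 the mean value theorem bounds the
    increment by x^(Th-1), whose power alpha is integrable when Th < 1 - 1/alpha. *)
Lemma unit_increment_mass (A : R) (g dg : R -> R) : 1 < alpha -> 0 < th -> th <= Th ->
  Th < 1 - alpha^-1 -> 0 <= A -> power_controlled A g dg ->
  (\int[lebesgue_measure]_x (`|g (x + 1)%R - g x| `^ alpha)%:E
    <= (A `^ alpha * increment_const)%:E)%E.
Proof.
move=> al1 th0 thTh hT A0 [mg gN gA dG dA].
have [te Th1] := tail_exponent_gt1 al1 hT.
have mf : measurable_fun [set: R] (fun x => `|g (x + 1) - g x| `^ alpha).
  apply: (measurableT_comp (measurable_powR alpha)).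
  apply: measurableT_comp => //; apply: measurable_funB => //.
  by apply: (measurableT_comp mg); exact: measurable_funD.
have p2 (x e : R) : 0 < x <= 2 -> 0 <= e <= 1 -> x `^ e <= 2.
  move=> /andP[x0 x2] /andP[e0 e1].
  apply: (@le_trans _ _ (2 `^ e)); first by apply: ge0_ler_powR; rewrite ?nnegrE//; lra.
  by rewrite -[leRHS]powRr1//; apply: ler_powR => //; lra.
have gb (x : R) : x <= 2 -> `|g x| <= 4 * A.
  have [x0 _|x0 x2] := leP x 0; first by rewrite gN// normr0; lra.
  apply: (le_trans (gA _ x0)); rewrite mulrC ler_wpM2r//.
  have := @p2 x th; have := @p2 x Th; rewrite x0 x2 => /(_ isT) h1 /(_ isT) h2.
  have := h1 ltac:(lra); have := h2 ltac:(lra); lra.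
apply: le_trans (le_integral_box_tail (C1 := (8 * A) `^ alpha) (C2 := (4 * A) `^ alpha)
   (a := 1) (b := 1) (g := alpha * (1 - Th)) mf _ _ _ _ _ _ _ _ _) _ => //.
- exact: powR_ge0.
- exact: powR_ge0.
- by move=> x x1; rewrite !gN ?subrr ?normr0 ?powR0 ?gt_eqF//; lra.
- move=> x x1 x2; apply: ge0_ler_powR; rewrite ?nnegrE//; [lra|lra|].
  apply: (le_trans (ler_normB _ _)).
  have := gb (x + 1) ltac:(lra); have := gb x ltac:(lra); lra.
- move=> x x1.
  have -> : x `^ (- (alpha * (1 - Th))) = (x `^ (- (1 - Th))) `^ alpha.
    by rewrite -powRrM; congr (_ `^ _); ring.
  rewrite -powRM ?powR_ge0//; last lra.
  have al0 : 0 <= alpha by lra.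
  have A40 : 0 <= 4 * A by lra.
  apply: ge0_ler_powR; rewrite ?nnegrE ?mulr_ge0 ?powR_ge0//.
  have cg : {within `[x, x + 1], continuous g}.
    apply: derivable_within_continuous => y; rewrite in_itv/= => /andP[xy _].
    by have [] := dG y ltac:(lra).
  have dG' (y : R) : y \in `]x, (x + 1)[ -> is_derive y 1 g (dg y).
    by rewrite in_itv/= => /andP[xy _]; apply: dG; lra.
  have xx1 : x < x + 1 by rewrite ltrDl.
  have [c] := MVT xx1 dG' cg.
  rewrite in_itv/= => /andP[xc _] ->.
  rewrite addrC addKr mulr1.
  have c0 : 0 < c by lra.
  apply: (le_trans (dA _ c0)).
  have h (e : R) : e <= Th -> c `^ (e - 1) <= x `^ (- (1 - Th)).
    move=> eT; apply: (@le_trans _ _ (c `^ (Th - 1))); first by apply: ler_powR; lra.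
    rewrite (_ : Th - 1 = - (1 - Th)); last by ring.
    rewrite !powRN lef_pV2 ?posrE ?powR_gt0//; last lra.
    by apply: ge0_ler_powR; rewrite ?nnegrE//; lra.
  rewrite (mulrC 4) -mulrA ler_wpM2l//.
  have := h th thTh; have := h Th (lexx _); have := powR_ge0 x (- (1 - Th)); lra.
- rewrite lee_fin powR1 mul1r /increment_const.
  have e8 : (8 * A) `^ alpha = A `^ alpha * 8 `^ alpha by rewrite powRM// mulrC.
  have e4 : (4 * A) `^ alpha = A `^ alpha * 4 `^ alpha by rewrite powRM// mulrC.
  by rewrite e8 e4 le_eqVlt; apply/orP; left; apply/eqP; ring.
Qed.

(** Self-similarity: x |-> g(delta x) is controlled with the constant A delta^th, since
    delta <= 1, and the substitution contributes one more factor delta. *)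
Lemma increment_mass (A delta : R) (g dg : R -> R) : 1 < alpha -> 0 < th ->
  th <= Th -> Th < 1 - alpha^-1 -> 0 <= A -> 0 < delta <= 1 ->
  power_controlled A g dg ->
  (\int[lebesgue_measure]_x (`|g (x + delta)%R - g x| `^ alpha)%:E
    <= (A `^ alpha * increment_const * delta `^ (1 + alpha * th))%:E)%E.
Proof.
move=> al1 th0 thTh hT A0 /andP[d0 d1] [mg gN gA dG dA].
pose F (x : R) := (`|g (x + delta) - g x| `^ alpha)%:E : \bar R.
have mF : measurable_fun [set: R] F.
  apply/measurable_EFinP; apply: (measurableT_comp (measurable_powR alpha)).
  apply: measurableT_comp => //; apply: measurable_funB => //.
  by apply: (measurableT_comp mg); exact: measurable_funD.
have F0 x : (0 <= F x)%E by rewrite lee_fin powR_ge0.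
have := @ge0_integral_affine R F delta 0 (lt0r_neq0 d0) mF F0.
rewrite (gtr0_norm d0) => E.
have -> : (\int[lebesgue_measure]_x F x = delta%:E * \int[lebesgue_measure]_x F (delta * x + 0)%R)%E.
  by rewrite E muleA -EFinM mulfV ?gt_eqF// mul1e.
pose gd (x : R) := g (delta * x); pose dgd (x : R) := delta * dg (delta * x).
have md : measurable_fun [set: R] (fun x : R => delta * x) by exact: measurable_funM.
have dTh : delta `^ Th <= delta `^ th.
  by apply: ger_powR => //; rewrite d0.
have pc : power_controlled (A * delta `^ th) gd dgd.
  split.
  - exact: (measurableT_comp mg).
  - by move=> x x0; rewrite /gd gN// pmulr_rle0.
  - move=> x x0; rewrite /gd; apply: le_trans (gA _ _) _; first by rewrite mulr_gt0.
    rewrite -mulrA ler_wpM2l// !powRM ?(ltW d0) ?(ltW x0)// mulrDr lerD2l.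
    by rewrite ler_wpM2r ?powR_ge0.
  - move=> x x0; have h := dG (delta * x) ltac:(by rewrite mulr_gt0).
    have h2 : is_derive x 1 (fun x : R => delta * x) delta.
      by apply: is_derive_eq; rewrite /GRing.scale/= mulr1.
    rewrite /dgd mulrC; exact: (@is_derive1_comp R g ( *%R delta) x _ _ h h2).
  - move=> x x0; rewrite /dgd normrM gtr0_norm//.
    apply: (@le_trans _ _ (delta * (A * ((delta * x) `^ (th - 1) + (delta * x) `^ (Th - 1))))).
      by rewrite ler_wpM2l ?(ltW d0)// dA// mulr_gt0.
    rewrite mulrCA -mulrA ler_wpM2l// !powRM ?(ltW d0) ?(ltW x0)//.
    have hd (e : R) : delta * delta `^ (e - 1) = delta `^ e.
      by rewrite -{1}(powRr1 (ltW d0)) -powRD ?(gt_eqF d0) ?implybT//; congr (_ `^ _); ring.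
    rewrite mulrDr !mulrA !hd mulrDr lerD2l.
    by rewrite ler_wpM2r ?powR_ge0.
have := unit_increment_mass al1 th0 thTh hT (mulr_ge0 A0 (powR_ge0 _ _)) pc.
rewrite (_ : (\int[lebesgue_measure]_x F (delta * x + 0)%R)%E =
   (\int[lebesgue_measure]_x (`|gd (x + 1)%R - gd x| `^ alpha)%:E)%E); last first.
  by apply: eq_integral => x _; rewrite /F /gd addr0 mulrDr mulr1.
move=> h; apply: (@le_trans _ _ (delta%:E * ((A * delta `^ th) `^ alpha * increment_const)%:E)%E).
  by rewrite lee_wpmul2l// lee_fin ltW.
rewrite -EFinM lee_fin powRM ?powR_ge0// -powRrM.
rewrite powRD ?(gt_eqF d0) ?implybT// powRr1 ?(ltW d0)// (mulrC alpha th).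
by rewrite le_eqVlt; apply/orP; left; apply/eqP; ring.
Qed.

End Increments.

(** * Truncated powers as functions of the exponent *)

Section ControlledKernels.
Context (R : realType).
Implicit Types x k h e th Th : R.

Lemma is_derive_pospow k x : 0 < x ->
  is_derive x 1 (fun y : R => pospow y k) (k * x `^ (k - 1)).
Proof.
move=> x0; apply: (near_eq_is_derive (f := fun y : R => y `^ k)).

  near=> y; rewrite /pospow ifT//; near: y; exact: lt_nbhsr.
exact: is_derive1_powR.
Unshelve. all: by end_near. Qed.

Lemma pospow_controlled k th Th : 0 < th -> th <= k -> k <= Th -> Th <= 1 ->
  power_controlled th Th 1 (fun x => pospow x k) (fun x => k * x `^ (k - 1)).
Proof.
move=> th0 thk kTh Th1; split.
- exact: measurable_pospow.
- by move=> x x0; rewrite /pospow ltNge x0.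
- move=> x x0; rewrite /pospow x0 mul1r ger0_norm ?powR_ge0//.
  by apply: powR_between; rewrite ?thk.
- by move=> x x0; exact: is_derive_pospow.
- move=> x x0; rewrite mul1r normrM ger0_norm; last lra.
  rewrite ger0_norm ?powR_ge0//; apply: (@le_trans _ _ (x `^ (k - 1))).
    by rewrite ler_piMl ?powR_ge0//; lra.
  by apply: powR_between => //; apply/andP; split; lra.
Qed.

Lemma powR_mul_between x (lo hi e d : R) : 0 < x -> lo <= hi ->
  (x `^ e + x `^ (- e)) * (x `^ lo + x `^ hi) <=
  4 * (x `^ (lo - `|e|) + x `^ (hi + `|e|)).
Proof.
move=> x0 lohi; have xn : x != 0 by rewrite gt_eqF.
have en := ler_norm e; have en2 := ler_norm (- e); rewrite normrN in en2.
have h r : lo - `|e| <= r <= hi + `|e| ->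
  x `^ r <= x `^ (lo - `|e|) + x `^ (hi + `|e|) by move=> ?; exact: powR_between.
rewrite mulrDl !mulrDr -!powRD ?xn ?implybT//.
have := h (e + lo) ltac:(apply/andP; split; lra).
have := h (e + hi) ltac:(apply/andP; split; lra).
have := h (- e + lo) ltac:(apply/andP; split; lra).
have := h (- e + hi) ltac:(apply/andP; split; lra).
lra.
Qed.

(** Mean value theorem in the exponent; the logarithm is absorbed by small powers x^e and
    x^(-e). *)
Lemma powR_sub_le (x k k' k0 km e : R) : 0 < x -> 0 < e ->
  k0 <= k <= km -> k0 <= k' <= km ->
  `|x `^ k - x `^ k'| <= `|k - k'| * (8 / e * (x `^ (k0 - e) + x `^ (km + e))).
Proof.
move=> x0 e0.
wlog kk : k k' / k' <= k.
  move=> W; have [/W|/ltW/W] := leP k' k; first exact.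
  by move=> H h1 h2; rewrite distrC [X in X * _]distrC; exact: H.
move=> /andP[k0k kkm] /andP[k0k' kkm'].
have xn : x != 0 by rewrite gt_eqF.
have -> : x `^ k - x `^ k' = x `^ k' * (x `^ (k - k') - 1).
  by rewrite mulrBr -powRD ?xn ?implybT// mulr1; congr (_ `^ _ - _); ring.
rewrite normrM ger0_norm ?powR_ge0// mulrC.
apply: (@le_trans _ _ ((`|k - k'| * `|ln x| * (1 + x `^ (k - k'))) * x `^ k')).
  by rewrite ler_wpM2r ?powR_ge0// powR_sub1_le.
rewrite -!mulrA ler_wpM2l// mulrDl mul1r -powRD ?xn ?implybT// subrK.
have h1 : x `^ k' + x `^ k <= 2 * (x `^ k0 + x `^ km).
  have := @powR_between _ x k0 k' km x0; have := @powR_between _ x k0 k km x0.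
  by rewrite k0k kkm k0k' kkm' => /(_ isT) ? /(_ isT) ?; lra.
apply: (@le_trans _ _ ((e^-1 * (x `^ e + x `^ (- e))) * (2 * (x `^ k0 + x `^ km)))).
  by rewrite ler_pM ?addr_ge0 ?powR_ge0// normr_ln_le.
have k0km : k0 <= km by lra.
have := @powR_mul_between x k0 km e 0 x0 k0km; rewrite (gtr0_norm e0) => h2.
have i0 : 0 < e^-1 by rewrite invr_gt0.
have -> : e^-1 * (x `^ e + x `^ (- e)) * (2 * (x `^ k0 + x `^ km)) =
  2 * e^-1 * ((x `^ e + x `^ (- e)) * (x `^ k0 + x `^ km)) by ring.
have -> : 8 * (e^-1 * (x `^ (k0 - e) + x `^ (km + e))) =
  2 * e^-1 * (4 * (x `^ (k0 - e) + x `^ (km + e))) by ring.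
by rewrite ler_wpM2l// mulr_ge0// ltW.
Qed.

(** Second difference of step h of the truncated power with respect to the exponent. *)
Definition second_diff (k1 h x : R) : R :=
  pospow x (k1 + 2 * h) - 2 * pospow x (k1 + h) + pospow x k1.

Definition dsecond_diff (k1 h x : R) : R :=
  (k1 + 2 * h) * x `^ (k1 + 2 * h - 1) - 2 * ((k1 + h) * x `^ (k1 + h - 1))
  + k1 * x `^ (k1 - 1).

Lemma sqr_ln_le x e : 0 < x -> 0 < e ->
  ln x ^+ 2 <= 8 / e ^+ 2 * (x `^ e + x `^ (- e)).
Proof.
move=> x0 e0; have e2 : 0 < e / 2 by lra.
have h := normr_ln_le x0 e2.
have xn : x != 0 by rewrite gt_eqF.
have a0 := powR_ge0 x (e / 2); have b0 := powR_ge0 x (- (e / 2)).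
have E1 : x `^ e = (x `^ (e / 2)) ^+ 2.
  by rewrite expr2 -powRD ?xn ?implybT//; congr (_ `^ _); field.
have E2 : x `^ (- e) = (x `^ (- (e / 2))) ^+ 2.
  by rewrite expr2 -powRD ?xn ?implybT//; congr (_ `^ _); field.
rewrite E1 E2 -real_normK ?num_real//.
move: h a0 b0; set a := x `^ (e / 2); set b := x `^ (- (e / 2)) => h a0 b0.
apply: (@le_trans _ _ (((e / 2)^-1 * (a + b)) ^+ 2)).
  by rewrite lerXn2r ?nnegrE// mulr_ge0 ?addr_ge0// invr_ge0 ltW.
have -> : ((e / 2)^-1 * (a + b)) ^+ 2 = 8 / e ^+ 2 * ((a + b) ^+ 2 / 2).
  by field; lra.
rewrite ler_wpM2l//; first by rewrite mulr_ge0// invr_ge0 exprn_ge0// ltW.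
have h3 := sqr_ge0 (a - b); rewrite ler_pdivrMr// -subr_ge0.
by rewrite (_ : _ - _ = (a - b) ^+ 2)//; ring.
Qed.

(** The second difference in the exponent is x^k1 (x^h - 1)^2, hence of order
    h^2 (log x)^2 x^k1. The quadratic gain h^2 is what makes the second differences of the
    field in v summable along dyadic grids. *)
Lemma second_diff_controlled (k0 km k1 h e : R) : 0 < e -> 0 <= h ->
  0 < k0 - e -> k0 <= k1 -> k1 + 2 * h <= km -> km + e <= 1 ->
  power_controlled (k0 - e) (km + e) ((256 / e ^+ 2 + 32 / e) * h ^+ 2)
    (second_diff k1 h) (dsecond_diff k1 h).
Proof.
move=> e0 h0 k0e k01 k1m kme.
have ms (k : R) := @measurable_pospow R k.
have c1 : 0 < e^-1 by rewrite invr_gt0.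
have h20 : 0 <= h ^+ 2 by rewrite exprn_ge0.
have core x : 0 < x ->
   x `^ k1 * (x `^ h - 1) ^+ 2 <= (128 / e ^+ 2) * h ^+ 2 * (x `^ (k0 - e) + x `^ (km + e)).
  move=> x0; have xn : x != 0 by rewrite gt_eqF.
  have q0 := powR_ge0 x h; have p0 := powR_ge0 x k1.
  have := powR_sub1_le h x0; rewrite (ger0_norm h0) => hs.
  have s1 : (x `^ h - 1) ^+ 2 <= h ^+ 2 * ln x ^+ 2 * (1 + x `^ h) ^+ 2.
    rewrite -(@real_normK _ (x `^ h - 1)) ?num_real// -(@real_normK _ (ln x)) ?num_real//.
    rewrite -!exprMn lerXn2r ?nnegrE// !mulr_ge0// addr_ge0//.
  have s2 : x `^ k1 * (1 + x `^ h) ^+ 2 <= 4 * (x `^ k0 + x `^ km).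
    have -> : x `^ k1 * (1 + x `^ h) ^+ 2 = x `^ k1 + 2 * x `^ (k1 + h) + x `^ (k1 + 2 * h).
      rewrite (_ : k1 + 2 * h = k1 + h + h); last by ring.
      rewrite !powRD ?xn ?implybT//; ring.
    have := @powR_between _ x k0 k1 km x0 ltac:(apply/andP; split; lra).
    have := @powR_between _ x k0 (k1 + h) km x0 ltac:(apply/andP; split; lra).
    have := @powR_between _ x k0 (k1 + 2 * h) km x0 ltac:(apply/andP; split; lra).
    lra.
  have s3 := sqr_ln_le x0 e0.
  have k0km : k0 <= km by lra.
  have := @powR_mul_between x k0 km e 0 x0 k0km; rewrite (gtr0_norm e0) => s4.
  have w0 : 0 <= x `^ k0 + x `^ km by rewrite addr_ge0 ?powR_ge0.
  apply: (@le_trans _ _ (x `^ k1 * (h ^+ 2 * ln x ^+ 2 * (1 + x `^ h) ^+ 2))).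
    by rewrite ler_wpM2l.
  have -> : x `^ k1 * (h ^+ 2 * ln x ^+ 2 * (1 + x `^ h) ^+ 2) =
    h ^+ 2 * ((ln x ^+ 2) * (x `^ k1 * (1 + x `^ h) ^+ 2)) by ring.
  rewrite [leRHS]mulrAC [leRHS]mulrC ler_wpM2l//.
  apply: (@le_trans _ _ ((8 / e ^+ 2 * (x `^ e + x `^ (- e))) * (4 * (x `^ k0 + x `^ km)))).
    by rewrite ler_pM ?sqr_ge0// mulr_ge0// sqr_ge0.
  have -> : 8 / e ^+ 2 * (x `^ e + x `^ (- e)) * (4 * (x `^ k0 + x `^ km)) =
     32 / e ^+ 2 * ((x `^ e + x `^ (- e)) * (x `^ k0 + x `^ km)) by field; lra.
  have -> : 128 / e ^+ 2 * (x `^ (k0 - e) + x `^ (km + e)) =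
     32 / e ^+ 2 * (4 * (x `^ (k0 - e) + x `^ (km + e))) by field; lra.
  by rewrite ler_wpM2l// mulr_ge0// invr_ge0 exprn_ge0// ltW.
have sdE x : 0 < x -> second_diff k1 h x = x `^ k1 * (x `^ h - 1) ^+ 2.
  move=> x0; rewrite /second_diff /pospow x0.
  rewrite (_ : k1 + 2 * h = k1 + h + h); last by ring.
  by rewrite !powRD ?(gt_eqF x0) ?implybT//; ring.
split.
- by apply: measurable_funD => //; apply: measurable_funB => //; exact: measurable_funM.
- by move=> x x0; rewrite /second_diff /pospow ltNge x0/= mulr0 subr0 addr0.
- move=> x x0; rewrite sdE// ger0_norm; last by rewrite mulr_ge0 ?powR_ge0// sqr_ge0.
  apply: (le_trans (core x x0)); rewrite ler_wpM2r ?addr_ge0 ?powR_ge0//.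
  rewrite ler_wpM2r//; have : 0 <= 128 / e ^+ 2 by rewrite mulr_ge0// invr_ge0 exprn_ge0// ltW.
  have : 0 <= 32 / e by rewrite mulr_ge0// ltW.
  lra.
- move=> x x0; apply: is_deriveD; last exact: is_derive_pospow.
  apply: is_deriveB; first exact: is_derive_pospow.
  exact: (is_deriveZ 2 (is_derive_pospow (k1 + h) x0)).
- move=> x x0; have xn : x != 0 by rewrite gt_eqF.
  have xi : 0 < x^-1 by rewrite invr_gt0.
  have pm (k : R) : x `^ (k - 1) = x^-1 * x `^ k.
    by rewrite powRD ?xn ?implybT// powR_inv1 ?(ltW x0)// mulrC.
  have -> : dsecond_diff k1 h x =
    x^-1 * (k1 * (x `^ k1 * (x `^ h - 1) ^+ 2) + 2 * h * (x `^ (k1 + h) * (x `^ h - 1))).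
    rewrite /dsecond_diff !pm (_ : k1 + 2 * h = k1 + h + h); last by ring.
    by rewrite !powRD ?xn ?implybT//; ring.
  rewrite !pm -mulrDr [leRHS]mulrCA normrM (gtr0_norm xi) ler_wpM2l ?(ltW xi)//.
  set W := x `^ (k0 - e) + x `^ (km + e).
  have W0 : 0 <= W by rewrite addr_ge0 ?powR_ge0.
  have C := core x x0.
  have q0 : 0 <= x `^ k1 * (x `^ h - 1) ^+ 2 by rewrite mulr_ge0 ?powR_ge0// sqr_ge0.
  have B : `|x `^ (k1 + h) * (x `^ h - 1)| <= h * (16 / e) * W.
    have -> : x `^ (k1 + h) * (x `^ h - 1) = x `^ (k1 + 2 * h) - x `^ (k1 + h).
      rewrite (_ : k1 + 2 * h = k1 + h + h); last by ring.
      by rewrite !powRD ?xn ?implybT//; ring.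
    have := @powR_sub_le x (k1 + 2 * h) (k1 + h) k0 km e x0 e0
      ltac:(apply/andP; split; lra) ltac:(apply/andP; split; lra).
    rewrite (_ : k1 + 2 * h - (k1 + h) = h); last by ring.
    rewrite (ger0_norm h0) -/W => /le_trans; apply.
    rewrite -(mulrA h) ler_wpM2l// ler_wpM2r//.
    by rewrite ler_pM2r// ler_nat.
  apply: (le_trans (ler_normD _ _)).
  rewrite normrM (ger0_norm q0) ger0_norm; last lra.
  rewrite normrM (@ger0_norm _ (2 * h)); last lra.
  apply: (@le_trans _ _ (128 / e ^+ 2 * h ^+ 2 * W + 2 * h * (h * (16 / e) * W))).
    apply: lerD; last by rewrite ler_wpM2l//; lra.
    apply: le_trans C; rewrite ler_piMl//; lra.
  have -> : 2 * h * (h * (16 / e) * W) = 32 / e * h ^+ 2 * W by ring.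
  rewrite -mulrDl ler_wpM2r// -mulrDl ler_wpM2r// lerD2r ler_wpM2r ?ler_nat//.
  by rewrite invr_ge0 exprn_ge0// ltW.
Qed.

End ControlledKernels.

(** * Moments of stable integrals, iterated differences *)

Section AlphaMass.
Context (R : realType).
Implicit Types (f g : R -> R).

(** The power alpha of the norm of f in L^alpha, that is, sigma^alpha for the stable
    integral of f. It is additive and homogeneous, and avoids roots. *)
Definition alpha_mass (alpha : R) f : \bar R :=
  (\int[lebesgue_measure]_s (`|f s| `^ alpha)%:E)%E.

Lemma measurable_alpha_integrand (alpha : R) f : measurable_fun [set: R] f ->
  measurable_fun [set: R] (fun s => (`|f s| `^ alpha)%:E).
Proof.
move=> mf; apply/measurable_EFinP; apply: (measurableT_comp (measurable_powR alpha)).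
exact: measurableT_comp.
Qed.

Lemma alpha_mass_ge0 (alpha : R) f : (0 <= alpha_mass alpha f)%E.
Proof. by apply: integral_ge0 => s _; rewrite lee_fin powR_ge0. Qed.

Lemma le_alpha_mass (alpha : R) f g : 0 <= alpha -> measurable_fun [set: R] f ->
  measurable_fun [set: R] g -> (forall s, `|f s| <= `|g s|) ->
  (alpha_mass alpha f <= alpha_mass alpha g)%E.
Proof.
move=> al0 mf mg fg; apply: ge0_le_integral => //.
- exact: measurable_alpha_integrand.
- exact: measurable_alpha_integrand.
- by move=> s _; rewrite lee_fin; apply: ge0_ler_powR; rewrite ?nnegrE.
Qed.

Lemma alpha_mass_scale (alpha c : R) f : 0 <= alpha -> measurable_fun [set: R] f ->
  alpha_mass alpha (fun s => c * f s) = ((`|c| `^ alpha)%:E * alpha_mass alpha f)%E.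
Proof.
move=> al0 mf; rewrite /alpha_mass -ge0_integralZl_EFin ?powR_ge0//.
- by apply: eq_integral => s _; rewrite normrM powRM.
- exact: measurable_alpha_integrand.
Qed.

Lemma alpha_mass_affine (alpha c b : R) f : c != 0 -> measurable_fun [set: R] f ->
  alpha_mass alpha (fun s => f (c * s + b)) = ((`|c|^-1)%:E * alpha_mass alpha f)%E.
Proof.
move=> c0 mf.
rewrite -(@ge0_integral_affine R (fun s => (`|f s| `^ alpha)%:E) c b c0)//.
exact: measurable_alpha_integrand.
Qed.

Lemma fine_Lnorm_alpha_mass (alpha : R) f : 0 < alpha ->
  (alpha_mass alpha f < +oo)%E ->
  fine ('N[lebesgue_measure]_(alpha%:E)[EFin \o f])%E
    = (fine (alpha_mass alpha f)) `^ alpha^-1.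
Proof.
move=> al0 h; rewrite unlock /Lnorm.
have -> : (\int[lebesgue_measure]_x (`|(EFin \o f) x| `^ alpha))%E = alpha_mass alpha f by [].
rewrite -[in LHS](@fineK _ (alpha_mass alpha f)) ?poweR_EFin//.
by rewrite ge0_fin_numE// alpha_mass_ge0.
Qed.

Lemma Lfun_alpha_mass (alpha : R) f : 0 < alpha -> measurable_fun [set: R] f ->
  (alpha_mass alpha f < +oo)%E -> f \in Lfun lebesgue_measure alpha%:E.
Proof.
move=> al0 mf h; rewrite inE; apply/andP; split; rewrite inE//=.
rewrite /finite_norm unlock /Lnorm.
have -> : (\int[lebesgue_measure]_x (`|(EFin \o f) x| `^ alpha))%E = alpha_mass alpha f by [].
by rewrite poweR_lty.
Qed.

Lemma Lfun_alpha_massP (alpha : R) f : 0 < alpha -> f \in Lfun lebesgue_measure alpha%:E ->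
  measurable_fun [set: R] f /\ (alpha_mass alpha f < +oo)%E.
Proof.
move=> al0; rewrite inE => /andP[]; rewrite !inE/= => mf.
rewrite /finite_norm => h; split => //.
have := poweR_Lnorm lebesgue_measure (EFin \o f) (lt0r_neq0 al0).
rewrite -/(alpha_mass alpha f) => <-.
by rewrite poweR_lty.
Qed.

(** A quasi-triangle inequality is enough: it serves to prove finiteness only. *)
Lemma le_alpha_massD (alpha : R) f g : 0 < alpha -> measurable_fun [set: R] f ->
  measurable_fun [set: R] g ->
  (alpha_mass alpha (fun s => f s + g s)%R
    <= (2 `^ alpha)%:E * (alpha_mass alpha f + alpha_mass alpha g))%E.
Proof.
move=> al0 mf mg.
have nn (h : R -> R) (s : R) : (0 <= (`|h s| `^ alpha)%:E)%E by rewrite lee_fin powR_ge0.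
have mm := measurable_alpha_integrand alpha.
rewrite /alpha_mass -ge0_integralD//; try (by move=> s _; exact: nn); try exact: mm.
rewrite -ge0_integralZl_EFin ?powR_ge0//; last 2 first.
- by move=> s _; rewrite adde_ge0.
- by apply: emeasurable_funD; exact: mm.
apply: ge0_le_integral => //.
- by apply: mm; exact: measurable_funD.
- apply: emeasurable_funM => //; apply: emeasurable_funD; exact: mm.
move=> s _; rewrite -EFinD -EFinM lee_fin.
wlog fg : f g mf mg / `|f s| <= `|g s|.
  move=> W; have [|/ltW] := leP `|f s| `|g s|; first exact: W.
  by move=> /(W _ _ mg mf); rewrite addrC [X in _ * X]addrC.
apply: (@le_trans _ _ ((2 * `|g s|) `^ alpha)).
  apply: ge0_ler_powR; rewrite ?nnegrE ?mulr_ge0//; first exact: ltW.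
  by apply: (le_trans (ler_normD _ _)); lra.
by rewrite powRM// ler_wpM2l ?powR_ge0// lerDr powR_ge0.
Qed.

End AlphaMass.

Section StableMoments.
Context (R : realType) (d : measure_display) (T : measurableType d) (P : probability T R).
Context (alpha : R) (Z : set R -> {RV P >-> R}) (J : (R -> R) -> {RV P >-> R}).

Lemma integral_moment_le (p : R) : is_SaS_integral alpha Z J -> 0 < p < alpha ->
  exists2 M : R, 0 <= M & forall (f : R -> R) (m : R), measurable_fun [set: R] f ->
    0 <= m -> (alpha_mass alpha f <= m%:E)%E ->
    (\int[P]_w (`|J f w| `^ p)%:E <= (M * m `^ (p / alpha))%:E)%E.
Proof.
move=> HJ /[dup] hp /andP[p0 pa]; have al0 : 0 < alpha by lra.
have [M M0 HM] := SaS_moment_le hp.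
exists M => // f m mf m0 fm.
have ffin : (alpha_mass alpha f < +oo)%E by apply: le_lt_trans fm _; rewrite ltry.
have fL := Lfun_alpha_mass al0 mf ffin.
have := HM _ _ P (J f) _ _ (SaSi_stable HJ fL).
rewrite fine_Lnorm_alpha_mass// => h.
apply: (le_trans (h (powR_ge0 _ _))); rewrite lee_fin ler_wpM2l//.
rewrite -powRrM mulrC; apply: ge0_ler_powR; rewrite ?nnegrE ?divr_ge0 ?(ltW p0) ?(ltW al0)//.
- by rewrite fine_ge0// alpha_mass_ge0.
- rewrite -lee_fin fineK// ge0_fin_numE// alpha_mass_ge0//.
Qed.

Lemma integral_moment_eq (p : R) : is_SaS_integral alpha Z J -> 0 < p < alpha -> p < 1 ->
  exists2 M : R, 0 < M & forall (f : R -> R), measurable_fun [set: R] f ->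
    (alpha_mass alpha f < +oo)%E ->
    (\int[P]_w (`|J f w| `^ p)%:E = (M * fine (alpha_mass alpha f) `^ (p / alpha))%:E)%E.
Proof.
move=> HJ /[dup] hp /andP[p0 pa] p1; have al0 : 0 < alpha by lra.
have [M M0 HM] := SaS_moment_eq hp p1.
exists M => // f mf ffin.
have fL := Lfun_alpha_mass al0 mf ffin.
have := HM _ _ P (J f) _ _ (SaSi_stable HJ fL).
rewrite fine_Lnorm_alpha_mass// => h.
by rewrite (h (powR_ge0 _ _)) -powRrM [alpha^-1 * p]mulrC.
Qed.

End StableMoments.

Section FiniteDifferences.
Context (R : realType).
Implicit Types (f df : R -> R) (x : R).

(** Recursive form of the L-th forward difference, for which derivatives and bounds are
    obtained by induction. *)
Fixpoint fdiff (L : nat) f x : R :=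
  if L is L'.+1 then fdiff L' f (x + 1) - fdiff L' f x else f x.

Lemma fdiff_sum L f x :
  fdiff L f x = \sum_(l < L.+1) filter_coef R L l * f (x + l%:R).
Proof.
elim: L x => [|L IH] x.
  by rewrite big_ord1 /filter_coef/= expr0 bin0 mul1r mul1r addr0.
rewrite [LHS]/= !IH.
rewrite [in RHS]big_ord_recl /= /filter_coef subn0 bin0.
have -> : \sum_(i < L.+1) (-1) ^+ (L.+1 - bump 0 i) * 'C(L.+1, bump 0 i)%:R * f (x + (bump 0 i)%:R)
  = \sum_(i < L.+1) (-1) ^+ (L - i) * 'C(L, i)%:R * f (x + 1 + i%:R)
   - \sum_(i < L) (-1) ^+ (L - bump 0 i) * 'C(L, bump 0 i)%:R * f (x + (bump 0 i)%:R).
  have -> : \sum_(i < L) (-1) ^+ (L - bump 0 i) * 'C(L, bump 0 i)%:R * f (x + (bump 0 i)%:R)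
   = \sum_(i < L.+1) (-1) ^+ (L - bump 0 i) * 'C(L, bump 0 i)%:R * f (x + (bump 0 i)%:R).
    by rewrite big_ord_recr/= /bump/= add1n bin_small// mulr0 mul0r addr0.
  rewrite -sumrB; apply: eq_bigr => i _; rewrite /bump/= add1n subSS binS natrD.
  have iL : (i <= L)%N by rewrite -ltnS.
  have -> : x + (i.+1)%:R = x + 1 + i%:R by rewrite -addrA nat1r.
  have [->|iL2] := eqVneq (i : nat) L.
    by rewrite bin_small// subnn subnS subnn/= add0r mulr0 mul0r subr0.
  have h : (L - i = (L - i.+1).+1)%N by rewrite subnS prednK// subn_gt0 ltn_neqAle iL2.
  by rewrite h exprS; ring.
rewrite [X in _ - X = _]big_ord_recl /= subn0 bin0 addr0 exprS; ring.
Qed.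

Lemma is_derive_fdiff L f df x :
  (forall y : R, 0 < y -> is_derive y 1 f (df y)) -> 0 < x ->
  is_derive x 1 (fdiff L f) (fdiff L df x).
Proof.
elim: L x => [|L IH] x H x0 /=; first exact: H.
apply: is_deriveB; last exact: IH.
have h : is_derive (x + 1) 1 (fdiff L f) (fdiff L df (x + 1)) by apply: IH => //; lra.
have h2 : is_derive x 1 (fun x : R => x + 1) 1.
  by apply: is_derive_eq; rewrite addr0.
have := @is_derive1_comp R (fdiff L f) (fun x : R => x + 1) x _ _ h h2.
by rewrite mulr1.
Qed.

Lemma fdiffZ L c f x : fdiff L (fun y => c * f y) x = c * fdiff L f x.
Proof. by elim: L x => [//|L IH] x /=; rewrite !IH mulrBr. Qed.

Lemma fdiffB L f g x : fdiff L (fun y => f y - g y) x = fdiff L f x - fdiff L g x.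
Proof. by elim: L x => [//|L IH] x /=; rewrite !IH; ring. Qed.

Lemma eq_fdiff L f g x : (forall l : nat, (l <= L)%N -> f (x + l%:R) = g (x + l%:R)) ->
  fdiff L f x = fdiff L g x.
Proof.
move=> fg; rewrite !fdiff_sum; apply: eq_bigr => l _; rewrite fg//.
by rewrite -ltnS.
Qed.

Lemma fdiff_le L f x (M : R) : (forall l : nat, (l <= L)%N -> `|f (x + l%:R)| <= M) ->
  `|fdiff L f x| <= 2 ^+ L * M.
Proof.
elim: L x => [|L IH] x H /=; first by rewrite expr0 mul1r -[x]addr0; exact: (H 0%N).
apply: (le_trans (ler_normB _ _)); rewrite exprS.
have h1 : `|fdiff L f (x + 1)| <= 2 ^+ L * M.
  by apply: IH => l lL; have := H l.+1 lL; rewrite -addrA nat1r.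
have h2 : `|fdiff L f x| <= 2 ^+ L * M by apply: IH => l lL; apply: H; rewrite leqW.
lra.
Qed.

Lemma measurable_fdiff L f : measurable_fun [set: R] f -> measurable_fun [set: R] (fdiff L f).
Proof.
move=> mf; elim: L => [//|L IH] /=; apply: measurable_funB => //.
by apply: (measurableT_comp IH); exact: measurable_funD.
Qed.

(** Each difference is a value of the derivative at a point on the right, by the mean value
    theorem, and the negative power is decreasing. *)
Lemma fdiff_powR_le L (k x : R) : k <= 1 -> 0 < x ->
  `|fdiff L (fun y : R => y `^ k) x| <= (\prod_(i < L) `|k - i%:R|) * x `^ (k - L%:R).
Proof.
elim: L k x => [|L IH] k x k1 x0.
  by rewrite big_ord0 mul1r subr0/= ger0_norm ?powR_ge0.
rewrite [X in `|X|]/=.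
pose f : R -> R := fun y : R => y `^ k.
have dF (y : R) : 0 < y -> is_derive y 1 (fdiff L f) (k * fdiff L (fun y : R => y `^ (k - 1)) y).
  move=> y0; rewrite -fdiffZ.
  by apply: is_derive_fdiff => // z z0; exact: is_derive1_powR.
have cg : {within `[x, x + 1], continuous (fdiff L f)}.
  apply: derivable_within_continuous => y; rewrite in_itv/= => /andP[xy _].
  by have [] := dF y ltac:(lra).
have dG' (y : R) : y \in `]x, (x + 1)[ -> is_derive y 1 (fdiff L f) (k * fdiff L (fun y : R => y `^ (k - 1)) y).
  by rewrite in_itv/= => /andP[xy _]; apply: dF; lra.
have xx1 : x < x + 1 by rewrite ltrDl.
have [c] := MVT xx1 dG' cg.
rewrite in_itv/= => /andP[xc _] ->.
have -> : x + 1 - x = 1 by ring.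
rewrite mulr1 normrM big_ord_recl/= subr0 -mulrA ler_wpM2l//.
have c0 : 0 < c by lra.
apply: (le_trans (IH (k - 1) c ltac:(lra) c0)).
have -> : \prod_(i < L) `|k - 1 - i%:R| = \prod_(i < L) `|k - (bump 0 i)%:R|.
  by apply: eq_bigr => i _; rewrite /bump/= add1n -nat1r opprD addrA.
rewrite ler_wpM2l ?prodr_ge0//.
have -> : k - 1 - L%:R = - (1 + L%:R - k) by ring.
have -> : k - L.+1%:R = - (1 + L%:R - k) by rewrite -nat1r; ring.
rewrite !powRN lef_pV2 ?posrE ?powR_gt0//.
apply: ge0_ler_powR; rewrite ?nnegrE ?(ltW x0) ?(ltW c0) ?(ltW xc)//.
have : 0 <= L%:R :> R by []. lra.
Qed.

Lemma fdiff_powR_le_fact L (k x : R) : 0 <= k <= 1 -> 0 < x ->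
  `|fdiff L (fun y : R => y `^ k) x| <= L`!%:R * x `^ (k - L%:R).
Proof.
move=> /andP[k0 k1] x0; apply: (le_trans (fdiff_powR_le L k1 x0)).
rewrite ler_wpM2r ?powR_ge0//.
elim: L => [|L IH]; first by rewrite big_ord0.
rewrite big_ord_recr/= factS natrM mulrC ler_pM ?prodr_ge0//.
rewrite -nat1r; have : 0 <= L%:R :> R by [].
move: (L%:R : R) => y y0.
by rewrite ler_norml; apply/andP; split; lra.
Qed.

End FiniteDifferences.

(** * The kernel of one increment *)

Section IncrementKernel.
Context (R : realType) (alpha : R) (L : nat).
Implicit Types v x : R.

(** The L-th difference of the truncated power: up to scaling, the kernel of an increment of
    order L of the field with constant second argument v. *)
Definition psi v x : R := fdiff L (fun y => pospow y (v - alpha^-1)) x.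

Lemma measurable_psi v : measurable_fun [set: R] (psi v).
Proof. by apply: measurable_fdiff; exact: measurable_pospow. Qed.

Lemma psi_eq0 v x : x <= - L%:R -> psi v x = 0.
Proof.
move=> xL; apply/eqP; rewrite -normr_eq0 eq_le normr_ge0 andbT.
rewrite -[leRHS](mulr0 (2 ^+ L)); apply: fdiff_le => l lL.
rewrite /pospow ltNge ifF ?normr0//; apply/negbF.
have : l%:R <= L%:R :> R by rewrite ler_nat.
lra.
Qed.

Lemma psi_box v x : alpha^-1 < v < 1 -> 0 < alpha -> x <= 1 -> `|psi v x| <= 2 ^+ L * (L%:R + 1).
Proof.
move=> /andP[v0 v1] al0 x1; apply: fdiff_le => l lL.
have lL' : l%:R <= L%:R :> R by rewrite ler_nat.
have i0 : 0 < alpha^-1 by rewrite invr_gt0.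
rewrite ger0_norm ?pospow_ge0// /pospow; case: ifPn => [y0|_]; last first.
  by rewrite addr_ge0.
have L0 : 0 <= L%:R :> R by [].
apply: (@le_trans _ _ ((L%:R + 1) `^ (v - alpha^-1))).
  by apply: ge0_ler_powR; rewrite ?nnegrE; lra.
by apply: ler1_powR; lra.
Qed.

(** L differences of a power lower its exponent by L. *)
Lemma psi_tail v x : alpha^-1 < v < 1 -> 0 < alpha -> 0 < x ->
  `|psi v x| <= L`!%:R * x `^ (v - alpha^-1 - L%:R).
Proof.
move=> /andP[v0 v1] al0 x0; rewrite /psi.
have i0 : 0 < alpha^-1 by rewrite invr_gt0.
rewrite (@eq_fdiff _ L _ (fun y => y `^ (v - alpha^-1))); last first.
  by move=> l lL; rewrite /pospow ltr_wpDr.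
by apply: fdiff_powR_le_fact => //; apply/andP; split; lra.
Qed.

Lemma psi_tail_alpha v x : alpha^-1 < v < 1 -> 1 < alpha -> (2 <= L)%N -> 1 <= x ->
  `|psi v x| `^ alpha <= L`!%:R `^ alpha * x `^ (- (alpha * (L%:R - 1) + 1)).
Proof.
move=> hv al1 L2 x1; have al0 : 0 < alpha by lra.
have x0 : 0 < x by lra.
have -> : x `^ (- (alpha * (L%:R - 1) + 1)) = (x `^ (1 - alpha^-1 - L%:R)) `^ alpha.
  by rewrite -powRrM; congr (_ `^ _); field; lra.
rewrite -powRM ?powR_ge0//; apply: ge0_ler_powR; rewrite ?nnegrE ?mulr_ge0 ?powR_ge0 ?(ltW al0)//.
apply: (le_trans (psi_tail hv al0 x0)); rewrite ler_wpM2l//.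
by apply: ler_powR => //; move/andP: hv => [? ?]; lra.
Qed.

Definition psi_mass_bound : R :=
  (2 ^+ L * (L%:R + 1)) `^ alpha * (L%:R + 1)
  + L`!%:R `^ alpha * (1 `^ (1 - (alpha * (L%:R - 1) + 1)) / (alpha * (L%:R - 1) + 1 - 1)).

Lemma L_exponent : 1 < alpha -> (2 <= L)%N -> 1 < alpha * (L%:R - 1).
Proof.
move=> al1 L2; have : 2 <= L%:R :> R by rewrite (ler_nat _ 2).
nra.
Qed.

Lemma psi_mass_le v : 1 < alpha -> (2 <= L)%N -> alpha^-1 < v < 1 ->
  (alpha_mass alpha (psi v) <= psi_mass_bound%:E)%E.
Proof.
move=> al1 L2 hv; have al0 : 0 < alpha by lra.
have e1 := L_exponent al1 L2.
have mf : measurable_fun [set: R] (fun x => `|psi v x| `^ alpha).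
  by apply/measurable_EFinP; exact: measurable_alpha_integrand (measurable_psi v).
apply: (le_integral_box_tail (a := L%:R) mf) => //; rewrite ?powR_ge0//.
- lra.
- by move=> x xL; rewrite psi_eq0// normr0 powR0// gt_eqF.
- move=> x _ x1; apply: ge0_ler_powR; rewrite ?nnegrE ?(ltW al0)//.
  exact: psi_box.
- by move=> x x1; exact: psi_tail_alpha.
Qed.

Lemma psi_mass_fin v : 1 < alpha -> (2 <= L)%N -> alpha^-1 < v < 1 ->
  (alpha_mass alpha (psi v) < +oo)%E.
Proof.
by move=> al1 L2 hv; apply: le_lt_trans (psi_mass_le al1 L2 hv) _; rewrite ltry.
Qed.

(** With the convention s = (k - x) / N, the points x > B are those of the distant past. *)
Definition cut_far (B : R) (f : R -> R) x : R := if x <= B then 0 else f x.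
Definition cut_near (B : R) (f : R -> R) x : R := if x <= B then f x else 0.

Lemma measurable_cut_far (B : R) (f : R -> R) : measurable_fun [set: R] f -> measurable_fun [set: R] (cut_far B f).
Proof.
move=> mf; rewrite /cut_far /cut_near; apply: (measurable_fun_ifT (g := fun _ : R => 0 : R) (h := f) (f := fun x : R => x <= B)) => //.
exact: measurable_fun_ler.
Qed.

Lemma measurable_cut_near (B : R) (f : R -> R) : measurable_fun [set: R] f -> measurable_fun [set: R] (cut_near B f).
Proof.
move=> mf; rewrite /cut_far /cut_near; apply: (measurable_fun_ifT (g := f) (h := fun _ : R => 0 : R) (f := fun x : R => x <= B)) => //.
exact: measurable_fun_ler.
Qed.

Definition far_mass_const : R := L`!%:R `^ alpha / (alpha * (L%:R - 1)).

Lemma psi_far_mass_le v (B : R) : 1 < alpha -> (2 <= L)%N -> alpha^-1 < v < 1 -> 1 <= B ->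
  (alpha_mass alpha (cut_far B (psi v)) <=
    (far_mass_const * B `^ (- (alpha * (L%:R - 1))))%:E)%E.
Proof.
move=> al1 L2 hv B1; have al0 : 0 < alpha by lra.
have e1 := L_exponent al1 L2.
have mf : measurable_fun [set: R] (fun x => `|cut_far B (psi v) x| `^ alpha).
  apply/measurable_EFinP; apply: measurable_alpha_integrand.
  exact: measurable_cut_far (measurable_psi v).
apply: le_trans (le_integral_box_tail (C1 := 0) (C2 := L`!%:R `^ alpha) (a := - B) (b := B)
   (g := alpha * (L%:R - 1) + 1) mf _ _ _ _ _ _ _ _ _) _ => //; rewrite ?powR_ge0//.
- lra.
- by rewrite opprK.
- lra.
- by move=> x; rewrite opprK /cut_far => ->; rewrite normr0 powR0// gt_eqF.
- by move=> x; rewrite opprK => Bx xB; have := lt_le_trans Bx xB; rewrite ltxx.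
- move=> x Bx; rewrite /cut_far; case: ifP => _.
    by rewrite normr0 powR0 ?gt_eqF// mulr_ge0 ?powR_ge0.
  by apply: psi_tail_alpha => //; lra.
- rewrite mul0r add0r lee_fin /far_mass_const.
  rewrite (_ : 1 - (alpha * (L%:R - 1) + 1) = - (alpha * (L%:R - 1))); last by ring.
  rewrite (_ : alpha * (L%:R - 1) + 1 - 1 = alpha * (L%:R - 1)); last by ring.
  by rewrite mulrCA mulrC -mulrA mulrCA.
Qed.

(** On [1/2 - L, 1 - L] only the last translate is nonzero, and it is at least 1/2. *)
Lemma psi_mass_lower v : 1 < alpha -> alpha^-1 < v < 1 ->
  ((2^-1 * 2^-1 `^ alpha)%:E <= alpha_mass alpha (psi v))%E.
Proof.
move=> al1 /andP[v0 v1]; have al0 : 0 < alpha by lra.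
have i0 : 0 < alpha^-1 by rewrite invr_gt0.
pose a : R := 2^-1 - L%:R; pose b : R := 1 - L%:R.
have psiE x : a <= x <= b -> psi v x = (x + L%:R) `^ (v - alpha^-1).
  move=> /andP[xa xb]; rewrite /psi fdiff_sum big_ord_recr/= big1 ?add0r.
    rewrite /filter_coef subnn expr0 binn !mul1r /pospow ifT//.
    by rewrite /a in xa; lra.
  move=> i _; rewrite /pospow ifF ?mulr0//; apply/negbTE; rewrite -leNgt.
  have : i.+1%:R <= L%:R :> R by rewrite ler_nat ltn_ord.
  by rewrite -nat1r; rewrite /b in xb; lra.
have ab : a < b by rewrite /a /b; lra.
have -> : ((2^-1 * 2^-1 `^ alpha)%:E =
   \int[lebesgue_measure]_(x in `[a, b]) (cst (2^-1 `^ alpha)%:E x))%E.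
  rewrite integral_cst//= lebesgue_measure_itv/= lte_fin ab -EFinD -EFinM.
  by congr EFin; rewrite mulrC; congr (_ * _); rewrite /a /b; lra.
apply: (@le_trans _ _ (\int[lebesgue_measure]_(x in `[a, b]) (`|psi v x| `^ alpha)%:E)%E); last first.
  apply: ge0_subset_integral => //; exact: measurable_alpha_integrand (measurable_psi v).
apply: ge0_le_integral => //.
- by move=> x _; rewrite /cst/= lee_fin powR_ge0.
- apply: measurable_funTS; exact: measurable_alpha_integrand (measurable_psi v).
- move=> x; rewrite /= in_itv/= => xab; rewrite lee_fin.
  apply: ge0_ler_powR; rewrite ?nnegrE ?(ltW al0)//.
  rewrite psiE// ger0_norm ?powR_ge0//; move/andP: xab => [xa xb].
  apply: (@le_trans _ _ (x + L%:R)); first by rewrite /a in xa; lra.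
  by apply: ger1_powR; [rewrite /a in xa; rewrite /b in xb; apply/andP; split; lra|lra].
Qed.

Lemma psi_diff_box (h1 h2 v v' x : R) : 1 < alpha < 2 -> alpha^-1 < h1 -> h2 < 1 ->
  h1 <= v <= h2 -> h1 <= v' <= h2 -> - L%:R < x ->
  `|psi v x - psi v' x| <= 2 ^+ L * (`|v - v'| * (32 / (h1 - alpha^-1) * (1 + (L%:R + Num.max x 1)))).
Proof.
move=> /andP[al1 al2] h1a h21 hv hv' xL; rewrite -fdiffB; apply: fdiff_le => l lL.
have lL' : l%:R <= L%:R :> R by rewrite ler_nat.
have i0 : 0 < alpha^-1 by rewrite invr_gt0; lra.
pose e := (h1 - alpha^-1) / 2; have e0 : 0 < e by rewrite /e; lra.
have m1 : 1 <= Num.max x 1 by rewrite le_max lexx orbT.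
have L0 : 0 <= L%:R :> R by [].
have RHS0 : 0 <= `|v - v'| * (32 / (h1 - alpha^-1) * (1 + (L%:R + Num.max x 1))).
  by rewrite mulr_ge0// mulr_ge0 ?divr_ge0//; lra.
rewrite /pospow; case: ifPn => [y0|_]; last by rewrite subrr normr0.
set y := x + l%:R in y0 *.
have := @powR_sub_le R y (v - alpha^-1) (v' - alpha^-1) (h1 - alpha^-1) (1 - alpha^-1) e y0 e0.
move/andP: hv => [hv1 hv2]; move/andP: hv' => [hv1' hv2'].
move=> /(_ ltac:(apply/andP; split; lra) ltac:(apply/andP; split; lra)) /le_trans; apply.
rewrite (_ : v - alpha^-1 - (v' - alpha^-1) = v - v'); last by ring.
rewrite ler_wpM2l//.
have ym : y <= L%:R + Num.max x 1.
  have : x <= Num.max x 1 by rewrite le_max lexx.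
  rewrite /y; lra.
have pw (r : R) : 0 <= r <= 1 -> y `^ r <= 1 + (L%:R + Num.max x 1).
  move=> /andP[r0 r1]; apply: (@le_trans _ _ ((1 + (L%:R + Num.max x 1)) `^ r)).
    by apply: ge0_ler_powR; rewrite ?nnegrE; lra.
  by apply: ler1_powR; lra.
have -> : 32 / (h1 - alpha^-1) = 8 / e * 2 by rewrite /e invfM invrK; ring.
have c8 : 0 <= 8 / e by rewrite divr_ge0// ltW.
rewrite -(mulrA (8 / e)) ler_wpM2l//.
have ia2 : 2^-1 < alpha^-1 by rewrite ltf_pV2 ?posrE//; lra.
have := pw (h1 - alpha^-1 - e) ltac:(rewrite /e; apply/andP; split; lra).
have := pw (1 - alpha^-1 + e) ltac:(rewrite /e; apply/andP; split; lra).
lra.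
Qed.

Definition psi_diff_const (h1 : R) : R :=
  (2 ^+ L * (32 / (h1 - alpha^-1) * (2 + L%:R))) `^ alpha * (L%:R + 1)
  + (2 ^+ L * (32 / (h1 - alpha^-1) * (2 + L%:R)) * (2 * L`!%:R)) `^ (alpha / 2)
    / (alpha / 2 * (L%:R - 2) - 1).

(** For large x the difference is bounded both by |v - v'| x and by x^(1-L); the geometric
    mean of the two keeps half a power of |v - v'| and stays integrable for L >= 5. *)
Lemma psi_diff_mass_le (h1 h2 v v' : R) : 1 < alpha < 2 -> (5 <= L)%N ->
  alpha^-1 < h1 -> h2 < 1 -> h1 <= v <= h2 -> h1 <= v' <= h2 ->
  (alpha_mass alpha (fun x => psi v x - psi v' x)%R <=
    (psi_diff_const h1 * `|v - v'| `^ (alpha / 2))%:E)%E.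
Proof.
move=> /[dup] al12 /andP[al1 al2] L5 h1a h21 hv hv'; have al0 : 0 < alpha by lra.
have L5' : 5 <= L%:R :> R by rewrite (ler_nat _ 5).
have i0 : 0 < alpha^-1 by rewrite invr_gt0.
have [hv1 hv2] := andP hv; have [hv1' hv2'] := andP hv'.
have e1 : 1 < alpha / 2 * (L%:R - 2) by nra.
have dm : measurable_fun [set: R] (fun x => psi v x - psi v' x).
  by apply: measurable_funB; exact: measurable_psi.
have mf : measurable_fun [set: R] (fun x => `|psi v x - psi v' x| `^ alpha).
  by apply/measurable_EFinP; exact: measurable_alpha_integrand.
pose D := `|v - v'|; have D0 : 0 <= D by exact: normr_ge0.
have D1 : D <= 1 by rewrite /D ler_norml; apply/andP; split; lra.
have [K [KE K0]] : exists K : R, K = 2 ^+ L * (32 / (h1 - alpha^-1) * (2 + L%:R)) /\ 0 <= K.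
  eexists; split; first reflexivity.
  by rewrite !mulr_ge0 ?exprn_ge0 ?invr_ge0//; lra.
apply: le_trans (le_integral_box_tail (C1 := K `^ alpha * D `^ (alpha / 2))
   (C2 := (K * (2 * L`!%:R) * D) `^ (alpha / 2)) (a := L%:R) (b := 1)
   (g := alpha / 2 * (L%:R - 2)) mf _ _ _ _ _ _ _ _ _) _ => //; rewrite ?mulr_ge0 ?powR_ge0//.
- by move=> x xL; rewrite !psi_eq0// subrr normr0 powR0// gt_eqF.
- move=> x xL x1.
  apply: (@le_trans _ _ (K `^ alpha * D `^ alpha)).
    rewrite -powRM//; apply: ge0_ler_powR; rewrite ?nnegrE ?mulr_ge0 ?(ltW al0)//.
    have := psi_diff_box al12 h1a h21 hv hv' xL; rewrite max_r//.
    rewrite (_ : 1 + (L%:R + 1) = 2 + L%:R); last by ring.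
    by move=> /le_trans; apply; rewrite -/D KE le_eqVlt; apply/orP; left; apply/eqP; ring.
  rewrite ler_wpM2l ?powR_ge0//; move: D0; rewrite le_eqVlt => /predU1P[<-|D0'].
    by rewrite !powR0// gt_eqF//; lra.
  by apply: ger_powR; [rewrite D0'|lra].
- move=> x x1; have x0 : 0 < x by lra.
  have -> : `|psi v x - psi v' x| `^ alpha = (`|psi v x - psi v' x| ^+ 2) `^ (alpha / 2).
    by rewrite -powR_mulrn// -powRrM; congr (_ `^ _); field.
  have -> : x `^ (- (alpha / 2 * (L%:R - 2))) = (x `^ (2 - L%:R)) `^ (alpha / 2).
    by rewrite -powRrM; congr (_ `^ _); ring.
  have KD0 : 0 <= K * (2 * L`!%:R) * D by rewrite !mulr_ge0.
  rewrite -powRM ?powR_ge0//; apply: ge0_ler_powR; rewrite ?nnegrE ?mulr_ge0 ?powR_ge0 ?exprn_ge0//; first lra.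
  have b1 : `|psi v x - psi v' x| <= K * D * x.
    have xL : - L%:R < x by lra.
    have := psi_diff_box al12 h1a h21 hv hv' xL; rewrite max_l// => /le_trans; apply.
    rewrite -/D KE (_ : 2 ^+ L * (32 / (h1 - alpha^-1) * (2 + L%:R)) * D * x =
      2 ^+ L * (D * (32 / (h1 - alpha^-1) * ((2 + L%:R) * x)))); last by ring.
    rewrite ler_wpM2l ?exprn_ge0// ler_wpM2l// ler_wpM2l ?divr_ge0//; first lra.
    by rewrite mulrDl; nra.
  have tl (u : R) : alpha^-1 < u < 1 -> `|psi u x| <= L`!%:R * x `^ (1 - L%:R).
    move=> hu; have := psi_tail hu al0 x0 => /le_trans; apply.
    rewrite ler_wpM2l//; apply: ler_powR => //; move/andP: hu => [? ?]; lra.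
  have b2 : `|psi v x - psi v' x| <= 2 * L`!%:R * x `^ (1 - L%:R).
    apply: (le_trans (ler_normB _ _)).
    have := tl v ltac:(apply/andP; split; lra); have := tl v' ltac:(apply/andP; split; lra).
    lra.
  apply: (@le_trans _ _ ((K * D * x) * (2 * L`!%:R * x `^ (1 - L%:R)))).
    by rewrite expr2 ler_pM.
  rewrite le_eqVlt; apply/orP; left; apply/eqP.
  have -> : x `^ (2 - L%:R) = x * x `^ (1 - L%:R).
    rewrite -{2}(powRr1 (ltW x0)) -powRD ?(gt_eqF x0) ?implybT//.
    by congr (_ `^ _); ring.
  ring.
- rewrite lee_fin /psi_diff_const -KE -/D powR1.
  have -> : (K * (2 * L`!%:R) * D) `^ (alpha / 2) =
    (K * (2 * L`!%:R)) `^ (alpha / 2) * D `^ (alpha / 2).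
    by rewrite powRM// !mulr_ge0.
  by rewrite le_eqVlt; apply/orP; left; apply/eqP; ring.
Qed.

End IncrementKernel.

(** * Kernels of the field and of the frozen increments *)

Section KernelMass.
Context (R : realType) (alpha : R).

(** The same bound as [increment_mass] for kernels reflected and translated as in the
    definition of the field. *)
Lemma controlled_increment_mass (th Th A u u' : R) (g dg : R -> R) : 1 < alpha -> 0 < th ->
  th <= Th -> Th < 1 - alpha^-1 -> 0 <= A -> power_controlled th Th A g dg ->
  u < u' -> u' - u <= 1 ->
  (alpha_mass alpha (fun s => g (u' - s) - g (u - s))%R
    <= (A `^ alpha * increment_const alpha Th * (u' - u) `^ (1 + alpha * th))%:E)%E.
Proof.
move=> al1 th0 thTh hT A0 gc uu' u1.
have [mg _ _ _ _] := gc.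
pose f (x : R) := g (x + (u' - u)) - g x.
have mf : measurable_fun [set: R] f.
  apply: measurable_funB => //; apply: (measurableT_comp mg).
  exact: measurable_funD.
have -> : (fun s => g (u' - s) - g (u - s)) = (fun s => f (- 1 * s + u)).
  by apply/funext => s; rewrite /f; congr (g _ - g _); ring.
rewrite alpha_mass_affine ?oppr_eq0 ?oner_eq0// normrN1 invr1 mul1e.
by apply: (increment_mass al1 th0 thTh hT A0 _ gc); apply/andP; split; lra.
Qed.

Lemma measurable_lmsm_kernel (u v : R) : measurable_fun [set: R] (lmsm_kernel alpha u v).
Proof.
apply: measurable_funB.
  apply: (measurableT_comp (measurable_pospow (v - alpha^-1))).
  by apply: measurable_funB.
by apply: (measurableT_comp (measurable_pospow (v - alpha^-1))).
Qed.

Lemma lmsm_kernel0 (v : R) : lmsm_kernel alpha 0 v = fun=> 0.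
Proof. by apply/funext => s; rewrite /lmsm_kernel sub0r subrr. Qed.

Lemma alpha_mass0 : 0 < alpha -> alpha_mass alpha (fun=> 0) = 0%E.
Proof.
by move=> al0; apply: integral0_eq => s _; rewrite normr0 powR0// gt_eqF.
Qed.

(** The exponent v - 1/alpha lies in (0, 1 - 1/alpha), so that the truncated power is
    controlled by itself. *)
Lemma lmsm_kernel_mass_fin (u v : R) : 1 < alpha -> alpha^-1 < v < 1 -> 0 <= u <= 1 ->
  (alpha_mass alpha (lmsm_kernel alpha u v) < +oo)%E.
Proof.
move=> al1 /andP[v0 v1] /andP[]; rewrite le_eqVlt => /predU1P[<- _|u0 u1].
  by rewrite lmsm_kernel0 alpha_mass0//; lra.
have i0 : 0 < alpha^-1 by rewrite invr_gt0; lra.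
have pc := @pospow_controlled R (v - alpha^-1) (v - alpha^-1) (v - alpha^-1)
  ltac:(lra) (lexx _) (lexx _) ltac:(lra).
have v2 : 0 < v - alpha^-1 by lra.
have v3 : v - alpha^-1 < 1 - alpha^-1 by lra.
have u2 : u - 0 <= 1 by lra.
have := controlled_increment_mass al1 v2 (lexx _) v3 ler01 pc u0 u2.
have -> : (fun s : R => pospow (u - s) (v - alpha^-1) - pospow (0 - s) (v - alpha^-1)) =
  lmsm_kernel alpha u v by apply/funext => s; rewrite /lmsm_kernel sub0r.
by move=> /le_lt_trans; apply; rewrite ltry.
Qed.

Lemma lmsm_kernel_Lfun (u v : R) : 1 < alpha -> alpha^-1 < v < 1 -> 0 <= u <= 1 ->
  lmsm_kernel alpha u v \in Lfun lebesgue_measure alpha%:E.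
Proof.
move=> al1 hv hu; apply: Lfun_alpha_mass; first lra.
  exact: measurable_lmsm_kernel.
exact: lmsm_kernel_mass_fin.
Qed.

Lemma pospow_scale (c y k : R) : 0 < c -> pospow (y / c) k = c `^ (- k) * pospow y k.
Proof.
move=> c0; rewrite /pospow; have -> : (0 < y / c) = (0 < y) by rewrite pmulr_lgt0 ?invr_gt0.
case: ifPn => [y0|]; last by rewrite mulr0.
rewrite powRM ?invr_ge0 ?(ltW y0) ?(ltW c0)// mulrC; congr (_ * _).
by rewrite -powR_inv1 ?(ltW c0)// -powRrM mulN1r.
Qed.

Context (L : nat).

Definition frozen_kernel (N k : nat) (v s : R) : R :=
  N%:R `^ (- (v - alpha^-1)) * psi alpha L v (k%:R - N%:R * s).
Definition frozen_near (B : R) (N k : nat) (v s : R) : R :=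
  N%:R `^ (- (v - alpha^-1)) * cut_near B (psi alpha L v) (k%:R - N%:R * s).
Definition frozen_far (B : R) (N k : nat) (v s : R) : R :=
  N%:R `^ (- (v - alpha^-1)) * cut_far B (psi alpha L v) (k%:R - N%:R * s).

Lemma frozen_near_far B N k v s :
  frozen_kernel N k v s = frozen_near B N k v s + frozen_far B N k v s.
Proof.
rewrite /frozen_kernel /frozen_near /frozen_far /cut_near /cut_far -mulrDr.
by case: ifP => _; rewrite ?addr0 ?add0r.
Qed.

(** The terms (-s)_+^(v-1/alpha) cancel because the coefficients of the L-th difference sum
    to 0. *)
Lemma frozen_kernel_sum N k v s : (0 < N)%N -> (0 < L)%N ->
  \sum_(l < L.+1) filter_coef R L l * lmsm_kernel alpha ((k + l)%N%:R / N%:R) v s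
    = frozen_kernel N k v s.
Proof.
move=> N0 L0; have N0' : 0 < N%:R :> R by rewrite ltr0n.
under eq_bigr do rewrite /lmsm_kernel mulrBr.
rewrite sumrB -mulr_suml.
have -> : \sum_(i < L.+1) filter_coef R L i = 0.
  have := @fdiff_sum R L (fun=> 1) 0; under eq_bigr do rewrite mulr1.
  by move=> <-; case: (L) L0 => //= L' _; rewrite !fdiff_sum subrr.
rewrite mul0r subr0 /frozen_kernel /psi fdiff_sum mulr_sumr.
apply: eq_bigr => l _; rewrite mulrCA -pospow_scale//; congr (_ * pospow _ _).
by rewrite natrD; field; rewrite pnatr_eq0 -lt0n.
Qed.

Lemma measurable_scaled (g : R -> R) (c N k : R) : measurable_fun [set: R] g ->
  measurable_fun [set: R] (fun s => c * g (k - N * s)).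
Proof.
move=> mg; apply: measurable_funM => //; apply: (measurableT_comp mg).
by apply: measurable_funB => //; exact: measurable_funM.
Qed.

(** Self-similarity: the substitution contributes N^(-1), which turns N^(-alpha(v-1/alpha))
    into N^(-alpha v). *)
Lemma scaled_mass (g : R -> R) (N k : nat) (v : R) : 1 < alpha -> (0 < N)%N ->
  measurable_fun [set: R] g ->
  alpha_mass alpha (fun s => N%:R `^ (- (v - alpha^-1)) * g (k%:R - N%:R * s))
   = ((N%:R `^ (- (alpha * v)))%:E * alpha_mass alpha g)%E.
Proof.
move=> al1 N0 mg; have N0' : 0 < N%:R :> R by rewrite ltr0n.
have al0 : 0 < alpha by lra.
have mg' : measurable_fun [set: R] (fun s : R => g (- N%:R * s + k%:R)).
  apply: (measurableT_comp mg); exact: measurable_funD.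
have -> : (fun s : R => N%:R `^ (- (v - alpha^-1)) * g (k%:R - N%:R * s)) =
   (fun s : R => N%:R `^ (- (v - alpha^-1)) * g (- N%:R * s + k%:R)).
  by apply/funext => s; congr (_ * g _); ring.
have N1 : - N%:R != 0 :> R by rewrite oppr_eq0 gt_eqF.
rewrite (alpha_mass_scale _ (ltW al0) mg') (alpha_mass_affine alpha k%:R N1 mg).
rewrite muleA -EFinM normrN (gtr0_norm N0') ger0_norm ?powR_ge0// -powRrM.
congr (_%:E * _)%E; rewrite -(@powR_inv1 _ N%:R (ltW N0')) -powRD ?(gt_eqF N0') ?implybT//.
by congr (_ `^ _); field; lra.
Qed.

End KernelMass.

Section LinearIntegral.
Context (R : realType) (d : measure_display) (T : measurableType d) (P : probability T R).
Context (alpha : R) (Z : set R -> {RV P >-> R}) (J : (R -> R) -> {RV P >-> R}).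
Context (HJ : is_SaS_integral alpha Z J) (al1 : 1 < alpha).

Lemma cst0_Lfun : (fun _ : R => 0 : R) \in Lfun lebesgue_measure alpha%:E.
Proof.
have al0 : 0 < alpha by have := al1; lra.
by apply: Lfun_alpha_mass => //; rewrite alpha_mass0.
Qed.

Lemma integral_cst0 : {ae P, forall w, J (fun=> 0) w = 0}.
Proof.
have := SaSi_linear HJ 1 cst0_Lfun cst0_Lfun.
apply: filterS => w; rewrite (_ : (fun s : R => 1 * 0 + 0) = (fun=> 0)); last first.
  by apply/funext => s; rewrite mulr0 addr0.
move: (J _ w) => x; lra.
Qed.

Lemma Lfun_lincomb (n : nat) (c : 'I_n -> R) (f : 'I_n -> R -> R) :
  (forall i, f i \in Lfun lebesgue_measure alpha%:E) ->
  (fun s => \sum_i c i * f i s) \in Lfun lebesgue_measure alpha%:E.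
Proof.
have al0 : 0 < alpha by have := al1; lra.
elim: n c f => [|n IH] c f fL.
  rewrite (_ : (fun s => _) = (fun=> 0)); first exact: cst0_Lfun.
  by apply/funext => s; rewrite big_ord0.
rewrite (_ : (fun s => _) = (fun s => c ord0 * f ord0 s + \sum_(i < n) c (lift ord0 i) * f (lift ord0 i) s)); last first.
  by apply/funext => s; rewrite big_ord_recl.
have [m1 l1] := Lfun_alpha_massP al0 (fL ord0).
have [m2 l2] := Lfun_alpha_massP al0 (IH (fun i => c (lift ord0 i)) (fun i => f (lift ord0 i)) (fun i => fL _)).
have m3 : measurable_fun [set: R] (fun s => c ord0 * f ord0 s) by exact: measurable_funM.
apply: (Lfun_alpha_mass al0 (measurable_funD m3 m2)).
apply: le_lt_trans (le_alpha_massD al0 m3 m2) _.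
apply: lte_mul_pinfty; [by rewrite lee_fin powR_ge0|by []|].
apply: lte_add_pinfty; last exact: l2.
rewrite (alpha_mass_scale _ (ltW al0) m1).
by apply: lte_mul_pinfty; [rewrite lee_fin powR_ge0| |exact: l1].
Qed.

Lemma integral_lincomb (n : nat) (c : 'I_n -> R) (f : 'I_n -> R -> R) :
  (forall i, f i \in Lfun lebesgue_measure alpha%:E) ->
  {ae P, forall w, J (fun s => \sum_i c i * f i s) w = \sum_i c i * J (f i) w}.
Proof.
elim: n c f => [|n IH] c f fL.
  rewrite (_ : (fun s => _) = (fun=> 0)); last by apply/funext => s; rewrite big_ord0.
  by apply: filterS integral_cst0 => w ->; rewrite big_ord0.
rewrite (_ : (fun s => _) = (fun s => c ord0 * f ord0 s + \sum_(i < n) c (lift ord0 i) * f (lift ord0 i) s)); last first.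
  by apply/funext => s; rewrite big_ord_recl.
have h := SaSi_linear HJ (c ord0) (fL ord0) (Lfun_lincomb (fun i => c (lift ord0 i)) (fun i => fL (lift ord0 i))).
apply: filterS2 h (IH (fun i => c (lift ord0 i)) _ (fun i => fL (lift ord0 i))) => w -> ->.
by rewrite big_ord_recl.
Qed.

End LinearIntegral.

(** * Lipschitz bounds from dyadic differences *)

Section Dyadic.
Context (R : realType).
Implicit Types (G g : R -> R) (K rho tau B : R).

Definition dyadic (n i : nat) : R := i%:R / 2 ^+ n.

Lemma dyadic_double n i : dyadic n.+1 (i.*2) = dyadic n i.
Proof.
rewrite /dyadic -muln2 natrM exprS; field.
by rewrite expf_neq0.
Qed.

Lemma geometric_sum_le rho n : 0 <= rho < 1 -> \sum_(i < n) rho ^+ i <= (1 - rho)^-1.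
Proof.
move=> /andP[r0 r1]; have d0 : 0 < 1 - rho by lra.
rewrite -[leRHS]mul1r ler_pdivlMr// mulrC.
have -> : (1 - rho) * \sum_(i < n) rho ^+ i = 1 - rho ^+ n.
  elim: n => [|n IH]; first by rewrite big_ord0 mulr0 expr0 subrr.
  by rewrite big_ord_recr/= mulrDr IH exprS; ring.
by rewrite gerBl exprn_ge0.
Qed.

(** Any grid point of level q is reached from 0 by moving at most once per level, since
    every other point of a level belongs to the previous one. *)
Lemma dyadic_chain G K rho : 0 <= K -> 0 <= rho < 1 -> G 0 = 0 ->
  (forall q r, (r < 2 ^ q)%N -> `|G (dyadic q r.+1) - G (dyadic q r)| <= K * rho ^+ q) ->
  forall q r, (r <= 2 ^ q)%N -> `|G (dyadic q r)| <= K / (1 - rho).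
Proof.
move=> K0 hr G0 H q r rq.
suff h : `|G (dyadic q r)| <= K * \sum_(i < q.+1) rho ^+ i.
  by apply: (le_trans h); rewrite ler_wpM2l// geometric_sum_le.
have [r0 r1] := andP hr.
elim: q r rq => [|q IH] r.
  rewrite expn0 big_ord1 expr0 mulr1; case: r => [_|[_|//]].
    by rewrite /dyadic mul0r G0 normr0.
  have := H 0%N 0%N isT; rewrite /dyadic mul0r G0 subr0 expr0 mulr1.
  exact.
move=> rq; rewrite big_ord_recr/= mulrDr.
have e2 : (2 ^ q.+1 = (2 ^ q).*2)%N by rewrite expnS mul2n.
rewrite -(odd_double_half r); case: (boolP (odd r)) => o; last first.
  rewrite add0n dyadic_double.
  have h : (r./2 <= 2 ^ q)%N by rewrite -leq_double -e2; apply: leq_trans rq; rewrite -{2}(odd_double_half r) leq_addl.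
  by apply: (le_trans (IH _ h)); rewrite lerDl mulr_ge0// exprn_ge0.
have lt : (r./2.*2 < 2 ^ q.+1)%N by apply: leq_trans rq; rewrite -{2}(odd_double_half r) o.
have h : (r./2 <= 2 ^ q)%N by rewrite -leq_double -e2 ltnW.
have h1 := H q.+1 r./2.*2 lt.
have h2 := IH _ h; rewrite -dyadic_double in h2.
rewrite /= add1n -[X in `|X|](subrK (G (dyadic q.+1 r./2.*2))).
apply: (le_trans (ler_normD _ _)); rewrite addrC; exact: lerD.
Qed.

(** The slope over half an interval differs from the slope over the interval by the second
    difference divided by the length; with tau < 1/2 these corrections have a finite sum. *)
Lemma dyadic_slopes g K tau B : 0 <= K -> 0 <= tau < 2^-1 -> `|g 1 - g 0| <= B ->
  (forall j i, (i < 2 ^ j)%N ->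
    `|g (dyadic j.+1 i.*2) - 2 * g (dyadic j.+1 i.*2.+1) + g (dyadic j.+1 i.*2.+2)| <= K * tau ^+ j) ->
  forall j i, (i < 2 ^ j)%N ->
    `|g (dyadic j i.+1) - g (dyadic j i)| <= (B + K / (1 - 2 * tau)) / 2 ^+ j.
Proof.
move=> K0 /andP[t0 t1] hB H j i ij.
have p2 n : 0 < 2 ^+ n :> R by rewrite exprn_gt0.
rewrite ler_pdivlMr//.
suff h : `|g (dyadic j i.+1) - g (dyadic j i)| * 2 ^+ j <= B + K * \sum_(k < j) (2 * tau) ^+ k.
  by apply: (le_trans h); rewrite lerD2l ler_wpM2l// geometric_sum_le//; apply/andP; split; lra.
elim: j i ij => [|j IH] i.
  rewrite expn0 => ij; have -> : i = 0%N by move: ij; case: i.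
  by rewrite big_ord0 mulr0 addr0 expr0 mulr1 /dyadic expr0 !divr1.
have e2 : (2 ^ j.+1 = (2 ^ j).*2)%N by rewrite expnS mul2n.
move=> ij; have hij : (i./2 < 2 ^ j)%N.
  by rewrite ltn_half_double -e2.
have h1 := H j _ hij; have h2 := IH _ hij.
rewrite -(dyadic_double j i./2.+1) -(dyadic_double j i./2) doubleS in h2.
rewrite big_ord_recr/= mulrDr addrA exprMn mulrCA.
have h3 : `|g (dyadic j.+1 i./2.*2) - 2 * g (dyadic j.+1 i./2.*2.+1) + g (dyadic j.+1 i./2.*2.+2)| * 2 ^+ j
   <= 2 ^+ j * (K * tau ^+ j) by rewrite mulrC ler_wpM2l// ltW.
have iE := odd_double_half i; move: hij h1 h2 h3 iE.
move: i./2 => i2 _; move: (odd i) => b h1 h2 h3 <-; move: h1 h2 h3.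
set x := g (dyadic _ i2.*2); set y := g (dyadic _ i2.*2.+1); set z := g (dyadic _ i2.*2.+2).
move=> h1 h2 h3; rewrite exprS.
case: b => /=; rewrite ?add1n ?add0n -/x -/y -/z.
- have -> : `|z - y| * (2 * 2 ^+ j) = `|(z - x) + (x - 2 * y + z)| * 2 ^+ j.
    rewrite mulrA; congr (_ * _).
    rewrite (_ : z - x + (x - 2 * y + z) = 2 * (z - y)); last by ring.
    by rewrite normrM mulrC ger0_norm.
  apply: (@le_trans _ _ ((`|z - x| + `|x - 2 * y + z|) * 2 ^+ j)).
    by rewrite ler_wpM2r ?ler_normD// ltW.
  by rewrite mulrDl lerD.
- have -> : `|y - x| * (2 * 2 ^+ j) = `|(z - x) - (x - 2 * y + z)| * 2 ^+ j.
    rewrite mulrA; congr (_ * _).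
    rewrite (_ : z - x - (x - 2 * y + z) = 2 * (y - x)); last by ring.
    by rewrite normrM mulrC ger0_norm.
  apply: (@le_trans _ _ ((`|z - x| + `|x - 2 * y + z|) * 2 ^+ j)).
    by rewrite ler_wpM2r ?ler_normB// ltW.
  by rewrite mulrDl lerD.
Qed.

Lemma dyadic_lipschitz g (M : R) j i i' : 
  (forall i, (i < 2 ^ j)%N -> `|g (dyadic j i.+1) - g (dyadic j i)| <= M / 2 ^+ j) ->
  (i <= 2 ^ j)%N -> (i' <= 2 ^ j)%N ->
  `|g (dyadic j i) - g (dyadic j i')| <= M * `|dyadic j i - dyadic j i'|.
Proof.
move=> H; wlog ii : i i' / (i' <= i)%N.
  move=> W h1 h2; have [/W|/ltnW/W] := leqP i' i; first exact.
  by rewrite distrC [X in _ * X]distrC; exact.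
have p2 : 0 < 2 ^+ j :> R by rewrite exprn_gt0.
move=> ij _; rewrite -(subnK ii) in ij *; move: (i - i')%N ij => n.
have -> : `|dyadic j (n + i') - dyadic j i'| = n%:R / 2 ^+ j.
  rewrite /dyadic -mulrBl natrD addrK ger0_norm// divr_ge0// ltW.
elim: n => [|n IH] ij; first by rewrite add0n subrr normr0 mul0r mulr0.
rewrite addSn -[X in `|X|](subrKA (g (dyadic j (n + i')))).
apply: (le_trans (ler_normD _ _)).
rewrite -natr1 mulrDl mulrDr addrC; apply: lerD; last by rewrite mul1r H.
by apply: IH; exact: ltnW.
Qed.

Definition dyadic_floor (n : nat) (x : R) : nat := Num.trunc (x * 2 ^+ n).

Lemma dyadic_floor_le n x : 0 <= x <= 1 -> (dyadic_floor n x <= 2 ^ n)%N.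
Proof.
move=> /andP[x0 x1]; have p2 : 0 < 2 ^+ n :> R by rewrite exprn_gt0.
rewrite -(ler_nat R) natrX; apply: (@le_trans _ _ (x * 2 ^+ n)).
  by rewrite truncn_le mulr_ge0// ltW.
by rewrite ler_piMl// ltW.
Qed.

Lemma dyadic_floor_near n x : 0 <= x -> `|dyadic n (dyadic_floor n x) - x| <= 2^-1 ^+ n.
Proof.
move=> x0; have p2 : 0 < 2 ^+ n :> R by rewrite exprn_gt0.
have h0 : 0 <= x * 2 ^+ n by rewrite mulr_ge0// ltW.
have h1 : (dyadic_floor n x)%:R <= x * 2 ^+ n by rewrite truncn_le.
have h2 : x * 2 ^+ n < (dyadic_floor n x).+1%:R by have /andP[] := truncn_itv h0.
have -> : dyadic n (dyadic_floor n x) - x = ((dyadic_floor n x)%:R - x * 2 ^+ n) / 2 ^+ n.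
  by rewrite /dyadic mulrBl mulfK// gt_eqF.
rewrite normrM exprVn normfV (gtr0_norm p2) ler_piMl ?invr_ge0 ?(ltW p2)//.
rewrite -natr1 in h2; rewrite ler_norml; apply/andP; split; lra.
Qed.

Lemma cvg_dyadic_floor x : 0 <= x -> (fun n => dyadic n (dyadic_floor n x)) @ \oo --> x.
Proof.
move=> x0; apply/cvgrPdist_le => e e0.
have h : (fun n => (2^-1 : R) ^+ n) @ \oo --> (0 : R).
  by apply: cvg_expr; rewrite ger0_norm ?invr_ge0// invf_lt1// ltr1n.
move/cvgrPdist_le : h => /(_ e e0); apply: filterS => n.
rewrite sub0r normrN ger0_norm ?exprn_ge0 ?invr_ge0// => h.
by rewrite distrC; apply: le_trans h; exact: dyadic_floor_near.
Qed.

End Dyadic.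

(** * Almost sure bounds from summable moments *)

Section Summation.
Context (R : realType) (d : measure_display) (T : measurableType d) (P : probability T R).

Lemma le_geometric_eseries (c r : R) : 0 <= c -> 0 <= r < 1 ->
  (\sum_(n <oo) (c * r ^+ n)%:E <= (c / (1 - r))%:E)%E.
Proof.
move=> c0 hr; have [r0 r1] := andP hr.
have nn n : (0 <= (c * r ^+ n)%:E)%E by rewrite lee_fin mulr_ge0// exprn_ge0.
apply: lime_le; first by apply: is_cvg_nneseries => n _ _; exact: nn.
apply: nearW => n; rewrite sumEFin lee_fin -mulr_sumr ler_wpM2l//.
by rewrite big_mkord geometric_sum_le.
Qed.

Lemma nneseries_term_le (u : nat -> \bar R) (n : nat) : (forall k, (0 <= u k)%E) ->
  (u n <= \sum_(k <oo) u k)%E.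
Proof.
move=> u0; apply: (@le_trans _ _ (\sum_(0 <= k < n.+1) u k)%E).
  by rewrite big_nat_recr//= leeDr// sume_ge0.
by apply: nneseries_lim_ge => k _ _.
Qed.

(** The sum of all the variables has a finite mean, hence is finite almost surely and bounds
    each of them. There are 2^j 2^q variables at level (j, q), which is why the moments
    carry the factors 1/2. *)
Lemma ae_bounded_of_summable_moments (Y : nat -> nat -> nat -> nat -> T -> R) (C ra rb : R) :
  0 <= C -> 0 <= ra < 1 -> 0 <= rb < 1 ->
  (forall j q i r, measurable_fun setT (Y j q i r)) -> (forall j q i r w, 0 <= Y j q i r w) ->
  (forall j q i r, (i < 2 ^ j)%N -> (r < 2 ^ q)%N ->
    (\int[P]_w (Y j q i r w)%:E <= (C * (ra / 2) ^+ j * (rb / 2) ^+ q)%:E)%E) ->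
  {ae P, forall w, exists2 K : R, 0 <= K & forall j q i r, (i < 2 ^ j)%N -> (r < 2 ^ q)%N ->
     Y j q i r w <= K}.
Proof.
move=> C0 hra hrb mY Y0 HY.
have [ra0 ra1] := andP hra; have [rb0 rb1] := andP hrb.
pose s j q w : R := \sum_(i < 2 ^ j) \sum_(r < 2 ^ q) Y j q i r w.
have ms j q : measurable_fun setT (s j q).
  by apply: measurable_sum => i; apply: measurable_sum => r; exact: mY.
have s0 j q w : 0 <= s j q w by rewrite sumr_ge0// => i _; rewrite sumr_ge0.
have is' j q : (\int[P]_w (s j q w)%:E <= (C * ra ^+ j * rb ^+ q)%:E)%E.
  rewrite /s; under eq_integral do rewrite -sumEFin.
  rewrite ge0_integral_sum//; last 2 first.
  - by move=> i; apply/measurable_EFinP; apply: measurable_sum => r; exact: mY.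
  - by move=> i w _; rewrite lee_fin sumr_ge0.
  have E : (C * ra ^+ j * rb ^+ q)%:E = (\sum_(i < 2 ^ j) \sum_(r < 2 ^ q) (C * (ra / 2) ^+ j * (rb / 2) ^+ q)%:E)%E.
    under eq_bigr do rewrite sumEFin sumr_const card_ord.
    rewrite sumEFin sumr_const card_ord; congr EFin.
    rewrite -mulrnA -[RHS]mulr_natr natrM !natrX !expr_div_n; field.
    by rewrite !expf_neq0.
  rewrite E; apply: lee_sum => i _.
  under eq_integral do rewrite -sumEFin.
  rewrite ge0_integral_sum//; last 2 first.
  - by move=> r; apply/measurable_EFinP; exact: mY.
  - by move=> r w _; rewrite lee_fin.
  by apply: lee_sum => r _; exact: HY.
pose S w : \bar R := (\sum_(j <oo) \sum_(q <oo) (s j q w)%:E)%E.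
have mq j : measurable_fun setT (fun w => \sum_(q <oo) (s j q w)%:E)%E.
  by apply: ge0_emeasurable_sum => [k w _ _|k _]; [rewrite lee_fin|exact/measurable_EFinP].
have q0 j w : (0 <= \sum_(q <oo) (s j q w)%:E)%E.
  by apply: nneseries_ge0 => k _ _; rewrite lee_fin.
have mS : measurable_fun setT S.
  by apply: ge0_emeasurable_sum => [k w _ _|k _]; [exact: q0|exact: mq].
have S0 w : (0 <= S w)%E by apply: nneseries_ge0 => k _ _; exact: q0.
have iS : (\int[P]_w S w <= (C / (1 - rb) / (1 - ra))%:E)%E.
  rewrite /S integral_nneseries//.
  apply: (@le_trans _ _ (\sum_(j <oo) (C / (1 - rb) * ra ^+ j)%:E)%E); last first.
    by apply: le_geometric_eseries => //; rewrite divr_ge0//; lra.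
  apply: lee_nneseries => [j _ _|j _]; first by apply: integral_ge0.
  rewrite integral_nneseries//; last 2 first.
  - by move=> q; exact/measurable_EFinP.
  - by move=> q w _; rewrite lee_fin.
  apply: (@le_trans _ _ (\sum_(q <oo) (C * ra ^+ j * rb ^+ q)%:E)%E).
    by apply: lee_nneseries => [q _ _|q _]; [apply: integral_ge0 => w _; rewrite lee_fin|exact: is'].
  rewrite mulrAC; apply: le_geometric_eseries => //.
  by rewrite mulr_ge0// exprn_ge0.
have intS : P.-integrable setT S.
  apply/integrableP; split => //.
  under eq_integral do rewrite gee0_abs//.
  by apply: le_lt_trans iS _; rewrite ltry.
apply: filterS (integrable_ae measurableT intS) => w /(_ I) Sw.
exists (fine (S w)); first exact: fine_ge0.
move=> j q i r ij rq.
rewrite -lee_fin fineK//; apply: (@le_trans _ _ (s j q w)%:E).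
  rewrite lee_fin /s (bigD1 (Ordinal ij))//= (bigD1 (Ordinal rq))//= -addrA lerDl.
  by rewrite addr_ge0// ?sumr_ge0// => k _; rewrite sumr_ge0.
apply: (@le_trans _ _ (\sum_(q <oo) (s j q w)%:E)%E).
  by apply: (nneseries_term_le (u := fun q => (s j q w)%:E)) => k; rewrite lee_fin.
by apply: (nneseries_term_le (u := fun j => (\sum_(q <oo) (s j q w)%:E)%E)).
Qed.

End Summation.

(** * The field is Lipschitz in its second variable *)

Section FieldLipschitz.
Context (R : realType) (d : measure_display) (T : measurableType d) (P : probability T R).
Context (alpha : R) (Z : set R -> {RV P >-> R}) (J : (R -> R) -> {RV P >-> R}).
Context (X : R -> R -> {RV P >-> R}).

Lemma ltr_powR_base (a x y : R) : 1 < a -> x < y -> a `^ x < a `^ y.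
Proof.
move=> a1 xy; have a0 : 0 < a by lra.
by rewrite /powR (gt_eqF a0) ltr_expR ltr_pM2r// ln_gt0.
Qed.

Lemma powRX (z x : R) (n : nat) : 0 <= z -> (z ^+ n) `^ x = (z `^ x) ^+ n.
Proof.
move=> z0; rewrite -(powR_mulrn n z0) -(powR_mulrn n (powR_ge0 z x)).
by rewrite -!powRrM mulrC.
Qed.

(** First difference in u, on the grid of level q, of the second difference in v, on the grid
    of level j + 1 of [g1, g2]. *)
Definition mixed_diff (g1 g2 : R) (j q i r : nat) (w : T) : R :=
  let F u k := X u (g1 + dyadic R j.+1 k * (g2 - g1)) w in
  let u' := dyadic R q r.+1 in let u := dyadic R q r in
  (F u' i.*2 - 2 * F u' i.*2.+1 + F u' i.*2.+2)
  - (F u i.*2 - 2 * F u i.*2.+1 + F u i.*2.+2).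

Lemma measurable_mixed_diff g1 g2 j q i r : measurable_fun setT (mixed_diff g1 g2 j q i r).
Proof.
rewrite /mixed_diff; apply: measurable_funB; apply: measurable_funD => //;
  apply: measurable_funB => //; exact: measurable_funM.
Qed.

Lemma dyadicS n i : dyadic R n i.+1 = dyadic R n i + 2^-1 ^+ n.
Proof. by rewrite /dyadic -natr1 mulrDl mul1r exprVn. Qed.

Lemma dyadic_itv n i : (i <= 2 ^ n)%N -> 0 <= dyadic R n i <= 1.
Proof.
move=> h; have p2 : 0 < 2 ^+ n :> R by rewrite exprn_gt0.
rewrite divr_ge0 ?(ltW p2)//= ler_pdivrMr// mul1r -natrX ler_nat//.
Qed.

Lemma mixed_diff_repr (g1 g2 : R) (j q i r : nat) :
  is_SaS_integral alpha Z J -> is_lmsm_field alpha J X -> 1 < alpha ->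
  alpha^-1 < g1 -> g1 <= g2 -> g2 < 1 -> (i < 2 ^ j)%N -> (r < 2 ^ q)%N ->
  let h := (g2 - g1) * 2^-1 ^+ j.+1 in
  let k := g1 + dyadic R j.+1 i.*2 * (g2 - g1) - alpha^-1 in
  {ae P, forall w, mixed_diff g1 g2 j q i r w =
    J (fun s => second_diff k h (dyadic R q r.+1 - s) - second_diff k h (dyadic R q r - s)) w}.
Proof.
move=> HJ HX al1 g1a g12 g21 ij rq h k.
pose u' := dyadic R q r.+1; pose u := dyadic R q r.
pose v0 := g1 + dyadic R j.+1 i.*2 * (g2 - g1).
pose v1 := g1 + dyadic R j.+1 i.*2.+1 * (g2 - g1).
pose v2 := g1 + dyadic R j.+1 i.*2.+2 * (g2 - g1).
have v1E : v1 = v0 + h by rewrite /v1 /v0 /h dyadicS; ring.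
have v2E : v2 = v0 + 2 * h by rewrite /v2 /v0 /h !dyadicS; ring.
have hu' : 0 <= u' <= 1 by apply: dyadic_itv.
have hu : 0 <= u <= 1 by apply: dyadic_itv; exact: ltnW.
have e2 : (2 ^ j.+1 = (2 ^ j).*2)%N by rewrite expnS mul2n.
have hv (l : nat) : (l <= i.*2.+2)%N -> alpha^-1 < g1 + dyadic R j.+1 l * (g2 - g1) < 1.
  move=> li; have /andP[a0 a1] : 0 <= dyadic R j.+1 l <= 1.
    apply: dyadic_itv; apply: (leq_trans li); rewrite e2 -doubleS leq_double//.
  by apply/andP; split; nra.
have hv0 : alpha^-1 < v0 < 1 by apply: hv; apply: leqW; apply: leqW.
have hv1 : alpha^-1 < v1 < 1 by apply: hv; rewrite ltnS.
have hv2 : alpha^-1 < v2 < 1 by apply: hv.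
have fd a b : 0 <= a <= 1 -> alpha^-1 < b < 1 -> field_domain alpha (a, b).
  by move=> ha hb; split; rewrite /= in_itv.
have rep a b : 0 <= a <= 1 -> alpha^-1 < b < 1 ->
    {ae P, forall w, X a b w = J (lmsm_kernel alpha a b) w}.
  by move=> ha hb; apply: (field_version HX); exact: fd.
pose cs := [:: 1; -2; 1; -1; 2; -1] : seq R.
pose us := [:: u'; u'; u'; u; u; u]; pose vs := [:: v0; v1; v2; v0; v1; v2].
pose f (l : 'I_6) s := lmsm_kernel alpha (nth 0 us l) (nth 0 vs l) s.
have fL l : f l \in Lfun lebesgue_measure alpha%:E.
  apply: lmsm_kernel_Lfun => //.
    by case: l => -[|[|[|[|[|[|//]]]]]].
  by case: l => -[|[|[|[|[|[|//]]]]]].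
have lin := integral_lincomb HJ al1 (fun l : 'I_6 => nth 0 cs l) fL.
have r1 := rep u' v0 hu' hv0; have r2 := rep u' v1 hu' hv1; have r3 := rep u' v2 hu' hv2.
have r4 := rep u v0 hu hv0; have r5 := rep u v1 hu hv1; have r6 := rep u v2 hu hv2.
apply: filterS3 (lin) (filterI r1 (filterI r2 r3)) (filterI r4 (filterI r5 r6)) => w lw.
move=> [E1 [E2 E3]] [E4 [E5 E6]].
rewrite /mixed_diff -/u' -/u -/v0 -/v1 -/v2 E1 E2 E3 E4 E5 E6.
have <- : (fun s => \sum_(l < 6) nth 0 cs l * f l s) =
   (fun s => second_diff k h (u' - s) - second_diff k h (u - s)).
  apply/funext => s; rewrite !big_ord_recl big_ord0 /f /cs /us /vs /= /lmsm_kernel /second_diff.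
  rewrite v1E v2E.
  have -> : v0 + h - alpha^-1 = k + h by rewrite /k /v0; ring.
  have -> : v0 + 2 * h - alpha^-1 = k + 2 * h by rewrite /k /v0; ring.
  rewrite /v0 -/k; ring.
rewrite lw !big_ord_recl big_ord0 /f /cs /us /vs /= addr0; ring.
Qed.

(** The kernel is the increment, over a length 2^(-q), of the second difference in the
    exponent, of step 2^(-j-1); [increment_mass] gives 2^(-q(1 + alpha th)) = 2^(-q alpha v')
    and [second_diff_controlled] gives the power 4^(-j). *)
Lemma mixed_diff_moment (g1 g2 p : R) :
  is_SaS_integral alpha Z J -> is_lmsm_field alpha J X -> 1 < alpha < 2 ->
  alpha^-1 < g1 -> g1 <= g2 -> g2 < 1 -> 0 < p < alpha ->
  exists v' C : R, [/\ (g1 + alpha^-1) / 2 <= v', 0 <= C &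
    forall j q i r, (i < 2 ^ j)%N -> (r < 2 ^ q)%N ->
    (\int[P]_w (`|mixed_diff g1 g2 j q i r w| `^ p)%:E
      <= (C * (4^-1 `^ p) ^+ j * (2^-1 `^ (p * v')) ^+ q)%:E)%E].
Proof.
move=> HJ HX /andP[al1 al2] g1a g12 g21 hp.
have al0 : 0 < alpha by lra.
have i0 : 0 < alpha^-1 by rewrite invr_gt0.
have ia2 : 2^-1 < alpha^-1 by rewrite ltf_pV2 ?posrE//; lra.
have [p0 pa] := andP hp.
pose e := Num.min ((g1 - alpha^-1) / 2) ((1 - g2) / 2).
have e0 : 0 < e by rewrite lt_min; apply/andP; split; lra.
have e1 : e <= (g1 - alpha^-1) / 2 by rewrite ge_min lexx.
have e2 : e <= (1 - g2) / 2 by rewrite ge_min lexx orbT.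
pose th := g1 - alpha^-1 - e; pose Th := g2 - alpha^-1 + e.
have th0 : 0 < th by rewrite /th; lra.
have thTh : th <= Th by rewrite /th /Th; lra.
have Th1 : Th < 1 - alpha^-1 by rewrite /Th; lra.
pose v' := alpha^-1 + th.
have [M M0 HM] := integral_moment_le HJ hp.
pose Ce : R := 256 / e ^+ 2 + 32 / e.
have Ce0 : 0 <= Ce.
  have e00 := ltW e0.
  apply: addr_ge0; apply: divr_ge0; [exact: ler0n|exact: exprn_ge0|exact: ler0n|exact: e00].
pose IC := increment_const alpha Th.
have IC0 : 0 <= IC by apply: increment_const_ge0.
pose C := M * ((Ce * ((g2 - g1) ^+ 2 / 4)) `^ p * IC `^ (p / alpha)).
have C0 : 0 <= C by rewrite /C !mulr_ge0 ?powR_ge0.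
exists v', C; split => //; first by rewrite /v' /th; lra.
move=> j q i r ij rq.
pose h := (g2 - g1) * 2^-1 ^+ j.+1.
pose k := g1 + dyadic R j.+1 i.*2 * (g2 - g1) - alpha^-1.
have z0 n : 0 < 2^-1 ^+ n :> R by rewrite exprn_gt0// invr_gt0.
have h0 : 0 <= h by rewrite mulr_ge0 ?(ltW (z0 _))//; lra.
pose f s := second_diff k h (dyadic R q r.+1 - s) - second_diff k h (dyadic R q r - s).
have rep := mixed_diff_repr HJ HX al1 g1a g12 g21 ij rq.
have dl : dyadic R q r.+1 - dyadic R q r = 2^-1 ^+ q by rewrite dyadicS; ring.
have e22 : (2 ^ j.+1 = (2 ^ j).*2)%N by rewrite expnS mul2n.
have /andP[d0 _] : 0 <= dyadic R j.+1 i.*2 <= 1.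
  by apply: dyadic_itv; rewrite e22 leq_double ltnW.
have /andP[_ d2] : 0 <= dyadic R j.+1 i.*2.+2 <= 1.
  by apply: dyadic_itv; rewrite e22 -doubleS leq_double.
have pc : power_controlled th Th (Ce * h ^+ 2) (second_diff k h) (dsecond_diff k h).
  apply: second_diff_controlled => //.
  - by rewrite /k; nra.
  - rewrite /k /h; rewrite !dyadicS in d2; move: d2; set z := 2^-1 ^+ _; set y := dyadic _ _ _; nra.
  - by lra.
have A0 : 0 <= Ce * h ^+ 2 by rewrite mulr_ge0// exprn_ge0.
have mass : (alpha_mass alpha f <= ((Ce * h ^+ 2) `^ alpha * IC * (2^-1 ^+ q) `^ (1 + alpha * th))%:E)%E.
  rewrite -dl; apply: controlled_increment_mass pc _ _ => //.
  - by rewrite -subr_gt0 dl.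
  - by rewrite dl exprn_ile1// ?invr_ge0// invf_le1// ler1n.
have [msd _ _ _ _] := pc.
have mf : measurable_fun [set: R] f.
  by apply: measurable_funB; apply: (measurableT_comp msd); exact: measurable_funB.
have m0 : 0 <= (Ce * h ^+ 2) `^ alpha * IC * (2^-1 ^+ q) `^ (1 + alpha * th).
  by rewrite !mulr_ge0 ?powR_ge0.
have := HM f _ mf m0 mass.
rewrite (_ : (\int[P]_w (`|J f w| `^ p)%:E)%E = (\int[P]_w (`|mixed_diff g1 g2 j q i r w| `^ p)%:E)%E); last first.
  apply: ae_eq_integral => //.
  - apply/measurable_EFinP; apply: (measurableT_comp (measurable_powR p)).
    exact: measurableT_comp.
  - apply/measurable_EFinP; apply: (measurableT_comp (measurable_powR p)).
    by apply: measurableT_comp => //; exact: measurable_mixed_diff.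
  - by apply: filterS rep => w -> _.
move=> /le_trans; apply; rewrite lee_fin le_eqVlt; apply/orP; left; apply/eqP.
rewrite powRM ?mulr_ge0 ?powR_ge0// powRM ?powR_ge0// -!powRrM.
have -> : alpha * (p / alpha) = p by field; lra.
have -> : (1 + alpha * th) * (p / alpha) = p * v' by rewrite /v'; field; lra.
have -> : Ce * h ^+ 2 = Ce * ((g2 - g1) ^+ 2 / 4) * 4^-1 ^+ j.
  have -> : 4^-1 ^+ j = (2^-1 ^+ j) ^+ 2 :> R.
    by rewrite -exprM mulnC exprM; congr (_ ^+ j); field.
  rewrite -mulrA; congr (Ce * _); rewrite /h (exprS 2^-1 j).
  by move: (2^-1 ^+ j) => z; field.
rewrite powRM ?exprn_ge0 ?invr_ge0//; last by rewrite mulr_ge0// divr_ge0// sqr_ge0.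
rewrite !powRX ?invr_ge0// /C; ring.
Qed.

Lemma within_continuous_cvg (S U : topologicalType) (A : set S) (f : S -> U)
    (I : Type) (F : set_system I) (FF : Filter F) (z : I -> S) (x : S) :
  {within A, continuous f} -> A x -> (\forall i \near F, A (z i)) ->
  z @ F --> x -> (f \o z) @ F --> f x.
Proof.
move=> /subspace_continuousP cf Ax Az zx.
apply: cvg_comp (cf x Ax) => V; rewrite /within/= => hV.
have h : F (z @^-1` [set y | A y -> V y]) by exact: zx.
by apply: filterS2 h Az => i /= h1 h2; exact: h1.
Qed.

Lemma field_slice_bounded (g : R) (w : T) : is_lmsm_field alpha J X ->
  alpha^-1 < g < 1 -> exists B : R, forall u, 0 <= u <= 1 -> `|X u g w| <= B.
Proof.
move=> HX hg; pose f (u : R) := `|X u g w|.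
have cf : {within `[0, 1], continuous f}.
  apply/subspace_continuousP => x; rewrite /= in_itv/= => hx.
  apply: cvg_norm.
  apply: (@within_continuous_cvg _ _ (field_domain alpha) (fun uv : R * R => X uv.1 uv.2 w)
     R (within `[0, 1] (nbhs x)) _ (fun u => (u, g)) (x, g)).
  - exact: (field_continuous HX).
  - by split => /=; rewrite in_itv.
  - rewrite near_withinE; apply: nearW => u /= hu; split => /=; rewrite in_itv//=.
  - apply: (@cvg_trans _ ((fun u : R => (u, g)) @ nbhs x)).
      by apply: cvg_app; exact: cvg_within.
    have h1 : (fun u : R => u) @ x --> x by exact: cvg_id.
    have h2 : (fun _ : R => g) @ x --> g by exact: cvg_cst.
    exact: (cvg_pair h1 h2).
have [c _ H] := EVT_max (@ler01 R) cf.
by exists (f c) => u hu; apply: H; rewrite in_itv.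
Qed.

Ltac forget := clear - R d T P alpha Z J X.

(** Choose p with 1/v' < p < alpha. The moments of order p of the mixed differences, divided by
    (tau^j rho^q)^p with 2^(1/p) / 4 < tau < 1/2 and 2^(1/p) 2^(-v') < rho < 1, are summable
    over the grid, hence almost surely |mixed difference| <= K tau^j rho^q. Summing over q
    bounds second differences in v at each grid value of u, as the field vanishes at u = 0;
    summing over j bounds the slopes in v. Continuity extends the bound to the square. *)
Lemma field_lipschitz (g1 g2 : R) : is_SaS_integral alpha Z J -> is_lmsm_field alpha J X ->
  1 < alpha < 2 -> alpha^-1 < g1 -> g1 < g2 -> g2 < 1 ->
  {ae P, forall w, exists2 C : R, 0 <= C & forall u v v', 0 <= u <= 1 ->
     g1 <= v <= g2 -> g1 <= v' <= g2 -> `|X u v w - X u v' w| <= C * `|v - v'|}.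
Proof.
move=> HJ HX /[dup] al12 /andP[al1 al2] g1a g12 g21.
have i0 : 0 < alpha^-1 by rewrite invr_gt0; lra.
pose vm := (g1 + alpha^-1) / 2; have vm0 : 0 < vm by rewrite /vm; lra.
have vm1 : vm < 1 by rewrite /vm; lra.
have vma : vm^-1 < alpha by rewrite -[ltRHS]invrK ltf_pV2 ?posrE// /vm; lra.
have vmi : 1 < vm^-1 by rewrite invf_gt1.
(* vm is a lower bound of the regularity exponent v' in u, and 1 / vm < p < alpha. *)
pose p := (vm^-1 + alpha) / 2.
have p1 : 1 < p by rewrite /p; lra.
have pa : p < alpha by rewrite /p; lra.
have pv : vm^-1 < p by rewrite /p; lra.
have p0 : 0 < p by lra.
have pi : p^-1 < vm by rewrite -[ltRHS]invrK ltf_pV2 ?posrE ?invr_gt0.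
have pi1 : p^-1 < 1 by lra.
have hp : 0 < p < alpha by rewrite p0.
have [v' [C [v'm C0 HM]]] := mixed_diff_moment HJ HX al12 g1a (ltW g12) g21 hp.
rewrite -/vm in v'm.
(* c1^p = 2 compensates the number of grid points, doubled at each level. *)
pose c1 : R := 2 `^ p^-1.
have c10 : 0 < c1 by rewrite powR_gt0.
have c12 : c1 < 2 by rewrite -[ltRHS]powRr1//; apply: ltr_powR_base => //; rewrite ltr1n.
have c1p : c1 `^ p = 2 by rewrite -powRrM mulVf ?powRr1// gt_eqF.
pose tau := (c1 / 4 + 2^-1) / 2.
have tau0 : 0 < tau by rewrite /tau; lra.
have tau1 : tau < 2^-1 by rewrite /tau; lra.
have tauc : c1 / 4 < tau by rewrite /tau; lra.
have b1 : c1 * 2^-1 `^ v' < 1.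
  rewrite -[2^-1]powR_inv1// -powRrM -powRD ?pnatr_eq0 ?implybT// mulN1r.
  by rewrite -[ltRHS](powRr0 2); apply: ltr_powR_base; [rewrite ltr1n|lra].
have b0 : 0 < c1 * 2^-1 `^ v' by rewrite mulr_gt0 ?powR_gt0 ?invr_gt0.
pose rho := (c1 * 2^-1 `^ v' + 1) / 2.
have rho0 : 0 < rho by rewrite /rho; lra.
have rho1 : rho < 1 by rewrite /rho; lra.
have rhoc : c1 * 2^-1 `^ v' < rho by rewrite /rho; lra.
have tp0 : 0 < tau `^ p by rewrite powR_gt0.
have rp0 : 0 < rho `^ p by rewrite powR_gt0.
pose ra := 2 * 4^-1 `^ p / tau `^ p; pose rb := 2 * 2^-1 `^ (p * v') / rho `^ p.
have hra : 0 <= ra < 1.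
  rewrite /ra divr_ge0 ?mulr_ge0 ?powR_ge0//= ltr_pdivrMr// mul1r.
  rewrite -{1}c1p -powRM ?(ltW c10) ?invr_ge0//.
  by apply: gt0_ltr_powR => //; rewrite nnegrE ?(ltW tau0)// mulr_ge0 ?(ltW c10)// invr_ge0.
have hrb : 0 <= rb < 1.
  rewrite /rb divr_ge0 ?mulr_ge0 ?powR_ge0//= ltr_pdivrMr// mul1r.
  have -> : 2^-1 `^ (p * v') = (2^-1 `^ v') `^ p by rewrite mulrC powRrM.
  rewrite -{1}c1p -powRM ?(ltW c10) ?powR_ge0//.
  by apply: gt0_ltr_powR => //; rewrite nnegrE ltW.
pose Wt (j q : nat) := (tau `^ p) ^+ j * (rho `^ p) ^+ q.
have Wt0 j q : 0 < Wt j q by rewrite mulr_gt0// exprn_gt0.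
pose Y (j q i r : nat) w := (Wt j q)^-1 * `|mixed_diff g1 g2 j q i r w| `^ p.
have mDp j q i r : measurable_fun setT (fun w => `|mixed_diff g1 g2 j q i r w| `^ p).
  apply: (measurableT_comp (measurable_powR p)); apply: measurableT_comp => //.
  exact: measurable_mixed_diff.
have Wi0 j q : 0 <= (Wt j q)^-1 by rewrite invr_ge0 ltW.
have hY : {ae P, forall w, exists2 K : R, 0 <= K & forall j q i r, (i < 2 ^ j)%N -> (r < 2 ^ q)%N ->
     Y j q i r w <= K}.
  apply: (ae_bounded_of_summable_moments C0 hra hrb).
  - by move=> j q i r; apply: measurable_funM.
  - by move=> j q i r w; rewrite mulr_ge0 ?powR_ge0.
  - move=> j q i r ij rq; rewrite /Y; under eq_integral do rewrite EFinM.
    rewrite ge0_integralZl_EFin//; last exact/measurable_EFinP.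
    apply: (@le_trans _ _ (((Wt j q)^-1)%:E * (C * (4^-1 `^ p) ^+ j * (2^-1 `^ (p * v')) ^+ q)%:E)%E).
      by apply: lee_wpmul2l; [rewrite lee_fin|exact: HM].
    rewrite -EFinM lee_fin le_eqVlt; apply/orP; left; apply/eqP.
    have -> : ra / 2 = 4^-1 `^ p / tau `^ p by rewrite /ra; field; rewrite gt_eqF.
    have -> : rb / 2 = 2^-1 `^ (p * v') / rho `^ p by rewrite /rb; field; rewrite gt_eqF.
    rewrite !expr_div_n /Wt; field.
    by apply/andP; split; apply: expf_neq0; rewrite gt_eqF.
pose grid j i := g1 + dyadic R j i * (g2 - g1).
have hgrid j i : (i <= 2 ^ j)%N -> g1 <= grid j i <= g2.
  move=> /dyadic_itv /andP[]; rewrite /grid; move: (dyadic R j i) g12; clear => x h3 h1 h2.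
  by apply/andP; split; nra.
have dom u v : 0 <= u <= 1 -> g1 <= v <= g2 -> field_domain alpha (u, v).
  by move=> hu /andP[v1 v2]; split; rewrite /= in_itv//=; apply/andP; split; move: v1 v2 g1a g21; forget; lra.
have h0 : {ae P, forall w, forall j i, (i <= 2 ^ j)%N -> X 0 (grid j i) w = 0}.
  apply: ae_foralln => j; apply: ae_foralln => i.
  have [ij|ij] := leqP i (2 ^ j); last by apply: filterE.
  have hv := field_version HX (dom 0 (grid j i) ltac:(by rewrite lexx ler01) (hgrid _ _ ij)).
  by apply: filterS2 hv (integral_cst0 HJ al1) => w -> ; rewrite lmsm_kernel0.
apply: filterS2 hY h0 => w [K K0 HK] H0.
have g1d : alpha^-1 < g1 < 1 by rewrite g1a (lt_trans g12).
have g2d : alpha^-1 < g2 < 1 by rewrite (lt_trans g1a).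
have [B1 HB1] := field_slice_bounded w HX g1d.
have [B2 HB2] := field_slice_bounded w HX g2d.
pose K' := K `^ p^-1; have K'0 : 0 <= K' by exact: powR_ge0.
have hD j q i r : (i < 2 ^ j)%N -> (r < 2 ^ q)%N ->
    `|mixed_diff g1 g2 j q i r w| <= (K' * tau ^+ j) * rho ^+ q.
  move=> ij rq; have := HK j q i r ij rq; rewrite /Y ler_pdivrMl// => h.
  have -> : `|mixed_diff g1 g2 j q i r w| = (`|mixed_diff g1 g2 j q i r w| `^ p) `^ p^-1.
    by rewrite -powRrM mulfV ?powRr1// gt_eqF.
  have -> : K' * tau ^+ j * rho ^+ q = (Wt j q * K) `^ p^-1.
    rewrite powRM ?(ltW (Wt0 _ _))// /Wt powRM ?exprn_ge0 ?powR_ge0//.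
    rewrite !powRX ?powR_ge0// -!powRrM mulfV ?gt_eqF// !powRr1 ?(ltW tau0) ?(ltW rho0)//.
    by rewrite /K'; ring.
  apply: ge0_ler_powR; rewrite ?nnegrE ?powR_ge0 ?invr_ge0 ?(ltW p0)//.
  by rewrite mulr_ge0// ltW.
pose M1 := K' / (1 - rho); have M10 : 0 <= M1 by rewrite divr_ge0// subr_ge0 ltW.
pose G j i (u : R) := X u (grid j.+1 i.*2) w - 2 * X u (grid j.+1 i.*2.+1) w + X u (grid j.+1 i.*2.+2) w.
have e2 j : (2 ^ j.+1 = (2 ^ j).*2)%N by rewrite expnS mul2n.
have hG j i q r : (i < 2 ^ j)%N -> (r <= 2 ^ q)%N -> `|G j i (dyadic R q r)| <= M1 * tau ^+ j.
  move=> ij rq; have := @dyadic_chain R (G j i) (K' * tau ^+ j) rho.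
  rewrite (_ : M1 * tau ^+ j = K' * tau ^+ j / (1 - rho)); last by rewrite /M1 mulrAC.
  apply => //.
  - by rewrite mulr_ge0// exprn_ge0// ltW.
  - by rewrite (ltW rho0).
  - have i2 : (i.*2.+2 <= 2 ^ j.+1)%N by rewrite e2 -doubleS leq_double.
    by rewrite /G !H0 ?mulr0 ?subrr ?addr0//; [exact: ltnW i2|exact: ltnW (ltnW i2)].
  - by move=> q' r' rq'; exact: hD.
pose M2 := (B1 + B2) + M1 / (1 - 2 * tau).
pose F u t := X u (g1 + t * (g2 - g1)) w.
have hF j q r i i' : (r <= 2 ^ q)%N -> (i <= 2 ^ j)%N -> (i' <= 2 ^ j)%N ->
    `|F (dyadic R q r) (dyadic R j i) - F (dyadic R q r) (dyadic R j i')|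
      <= M2 * `|dyadic R j i - dyadic R j i'|.
  move=> rq ij ij'; apply: (dyadic_lipschitz (g := F (dyadic R q r))) => // k kj.
  apply: (@dyadic_slopes R (F (dyadic R q r)) M1 tau (B1 + B2)) => //.
  - by rewrite (ltW tau0).
  - have -> : F (dyadic R q r) 1 = X (dyadic R q r) g2 w by rewrite /F; congr (X _ _ w); ring.
    have -> : F (dyadic R q r) 0 = X (dyadic R q r) g1 w by rewrite /F; congr (X _ _ w); ring.
    have hu := dyadic_itv rq.
    apply: (le_trans (ler_normB _ _)); rewrite addrC.
    by apply: lerD; [exact: HB1|exact: HB2].
  - by move=> j' i2 ij2; exact: hG.
have M20 : 0 <= M2.
  rewrite /M2 addr_ge0//; last by rewrite divr_ge0//; move: tau1; forget; lra.
  have u0 : 0 <= (0 : R) <= 1 by rewrite lexx ler01.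
  by apply: addr_ge0; [exact: le_trans (HB1 0 u0)|exact: le_trans (HB2 0 u0)].
have dg : 0 < g2 - g1 by rewrite subr_gt0.
exists (M2 / (g2 - g1)); first by rewrite divr_ge0// ltW.
move=> u v v2 hu hv hv2.
pose t := (v - g1) / (g2 - g1); pose t2 := (v2 - g1) / (g2 - g1).
have ht x : g1 <= x <= g2 -> 0 <= (x - g1) / (g2 - g1) <= 1.
  move=> /andP[x1 x2]; rewrite divr_ge0 ?(ltW dg) ?subr_ge0//= ler_pdivrMr// mul1r.
  by rewrite lerD2r.
have cvF x : g1 <= x <= g2 ->
   (fun n => F (dyadic R n (dyadic_floor n u)) (dyadic R n (dyadic_floor n ((x - g1) / (g2 - g1))))) @ \oo --> X u x w.
  move=> hx; pose s := (x - g1) / (g2 - g1).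
  have hs := ht x hx; have [s0 s1] := andP hs; have [u0 u1] := andP hu.
  apply: (@within_continuous_cvg _ _ (field_domain alpha) (fun uv : R * R => X uv.1 uv.2 w)
     nat \oo _ (fun n => (dyadic R n (dyadic_floor n u), grid n (dyadic_floor n s))) (u, x)).
  - exact: (field_continuous HX).
  - exact: dom.
  - apply: filterE => n; apply: dom; last by apply: hgrid; exact: dyadic_floor_le.
    by apply: dyadic_itv; exact: dyadic_floor_le.
  - have cu := cvg_dyadic_floor u0; have cs := cvg_dyadic_floor s0.
    have cg : (fun n => grid n (dyadic_floor n s)) @ \oo --> x.
      have -> : x = g1 + s * (g2 - g1) by rewrite /s mulfVK ?gt_eqF//; ring.
      have c3 : (fun _ : nat => g2 - g1) @ \oo --> g2 - g1 by exact: cvg_cst.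
      have c4 : (fun _ : nat => g1) @ \oo --> g1 by exact: cvg_cst.
      exact: (cvgD c4 (cvgM cs c3)).
    exact: (cvg_pair cu cg).
have c1' := cvF v hv; have c2' := cvF v2 hv2.
have := ht v hv; have := ht v2 hv2; rewrite -/t -/t2 => ht2 ht1.
have lhs : (fun n => `|F (dyadic R n (dyadic_floor n u)) (dyadic R n (dyadic_floor n t))
      - F (dyadic R n (dyadic_floor n u)) (dyadic R n (dyadic_floor n t2))|) @ \oo
    --> `|X u v w - X u v2 w|.
  by apply: cvg_norm; exact: (cvgB c1' c2').
have [t0 _] := andP ht1; have [t20 _] := andP ht2.
have rhs : (fun n => M2 * `|dyadic R n (dyadic_floor n t) - dyadic R n (dyadic_floor n t2)|) @ \oo
    --> M2 * `|t - t2|.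
  apply: cvgMr; apply: cvg_norm; apply: cvgB; exact: cvg_dyadic_floor.
have -> : M2 / (g2 - g1) * `|v - v2| = M2 * `|t - t2|.
  rewrite /t /t2 -mulrBl normrM normfV (gtr0_norm dg).
  by rewrite (_ : v - g1 - (v2 - g1) = v - v2); [ring|ring].
have hle n : `|F (dyadic R n (dyadic_floor n u)) (dyadic R n (dyadic_floor n t))
      - F (dyadic R n (dyadic_floor n u)) (dyadic R n (dyadic_floor n t2))|
    <= M2 * `|dyadic R n (dyadic_floor n t) - dyadic R n (dyadic_floor n t2)|.
  by apply: hF; exact: dyadic_floor_le.
rewrite -(cvg_lim _ lhs)// -(cvg_lim _ rhs)//.
by apply: ler_lim; [apply/cvg_ex; eexists; exact: lhs|apply/cvg_ex; eexists; exact: rhs|exact: nearW].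
Qed.

End FieldLipschitz.

(** * Tail bounds and the Borel-Cantelli lemma *)

Section Probability.
Context (R : realType) (d : measure_display) (T : measurableType d) (P : probability T R).

Lemma markov_tail (Y : T -> R) (c K : R) : measurable_fun setT Y -> (forall w, 0 <= Y w) ->
  0 < c -> (\int[P]_w (Y w)%:E <= K%:E)%E -> (P [set w | (c < Y w)%R] <= (K / c)%:E)%E.
Proof.
move=> mY Y0 c0 hK; pose A := [set w | (c < Y w)%R].
have mA : measurable A.
  rewrite (_ : A = setT `&` Y @^-1` `]c, +oo[); first exact: mY.
  by rewrite setTI; apply/seteqP; split => w; rewrite /A/= in_itv/= andbT.
rewrite -/A EFinM lee_pdivlMr//; apply: le_trans hK.
rewrite muleC -integral_cst//.
apply: (@le_trans _ _ (\int[P]_(w in A) (Y w)%:E)%E).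
  apply: ge0_le_integral => //.
  - by move=> w _; rewrite lee_fin ltW.
  - by apply/measurable_EFinP; exact: measurable_funTS.
  - by move=> w Aw; rewrite lee_fin ltW.
apply: ge0_subset_integral => //; first exact/measurable_EFinP.
by move=> w _; rewrite lee_fin.
Qed.

(** The defect vanishes for y <= M, and otherwise y - M <= y <= y^2 / M. *)
Lemma min_defect_le (y M : R) : 0 < M -> 0 <= y -> y - Num.min y M <= y ^+ 2 / M.
Proof.
move=> M0 y0; rewrite ler_pdivlMr//; have [yM|My] := leP y M.
  by rewrite subrr mul0r sqr_ge0.
by nra.
Qed.

Lemma expR_decay (y : R) (j : nat) : (0 < j)%N -> 0 < y -> expR (- y) <= (j%:R / y) ^+ j.
Proof.
move=> j0 y0; have j0' : 0 < j%:R :> R by rewrite ltr0n.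
rewrite expRN -[j%:R / y]invrK exprVn invf_div lef_pV2 ?posrE ?expR_gt0 ?exprn_gt0 ?divr_gt0//.
have -> : expR y = expR (y / j%:R) ^+ j.
  by rewrite -expRM_natl mulrC mulfVK// gt_eqF.
apply: lerXn2r; rewrite ?nnegrE ?expR_ge0 ?divr_ge0 ?(ltW y0)//.
by apply: le_trans (expR_ge1Dx _); rewrite lerDr.
Qed.

(** Comparison with the telescoping series of 2 / sqrt(n) - 2 / sqrt(n+1). *)
Lemma le_nneseries_three_halves : (\sum_(0 <= i <oo) ((i.+1%:R `^ (- (3 / 2)) : R)%:E) <= 3%:E)%E.
Proof.
apply: lime_le; first by apply: is_cvg_nneseries => n _ _; rewrite lee_fin powR_ge0.
apply: nearW => n; rewrite sumEFin lee_fin.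
suff : \sum_(0 <= i < n.+1) i.+1%:R `^ (- (3 / 2)) <= 3 - 2 * n.+1%:R `^ (- 2^-1) :> R.
  rewrite big_nat_recr//= => h; have := powR_ge0 (n.+1%:R : R) (- (3 / 2)).
  have := powR_ge0 (n.+1%:R : R) (- 2^-1); lra.
elim: n => [|n IH]; first by rewrite big_nat1 !powR1; lra.
rewrite big_nat_recr//=; apply: (le_trans (lerD IH (lexx _))).
pose a : R := Num.sqrt n.+1%:R; pose b : R := Num.sqrt n.+2%:R.
have a0 : 0 < a by rewrite sqrtr_gt0 ltr0n.
have b0 : 0 < b by rewrite sqrtr_gt0 ltr0n.
have ab : a <= b by rewrite ler_sqrt ?ler_nat ?ltr0n.
have aE : n.+1%:R `^ (- 2^-1) = a^-1 :> R by rewrite powRN powR12_sqrt.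
have bE : n.+2%:R `^ (- 2^-1) = b^-1 :> R by rewrite powRN powR12_sqrt.
have a2 : a ^+ 2 = n.+1%:R by rewrite sqr_sqrtr.
have b2 : b ^+ 2 = n.+2%:R by rewrite sqr_sqrtr.
have -> : n.+2%:R `^ (- (3 / 2)) = b^-1 * b^-1 * b^-1 :> R.
  rewrite -bE -!powRD ?pnatr_eq0 ?implybT//.
  by congr (_ `^ _); field.
rewrite aE bE.
have d1 : b ^+ 2 - a ^+ 2 = 1 by rewrite a2 b2 -[n.+2%:R]natr1; ring.
have e : a^-1 - b^-1 = (b - a) * (a^-1 * b^-1) by field; rewrite !gt_eqF.
have e2 : (b - a) * (a + b) = 1 by rewrite -d1; ring.
suff : b^-1 * b^-1 * b^-1 <= 2 * (a^-1 - b^-1) by lra.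
rewrite e.
have : b^-1 <= 2 * (b - a) by rewrite -div1r ler_pdivrMr//; nra.
have : b^-1 <= a^-1 by rewrite lef_pV2.
have : 0 < b^-1 by rewrite invr_gt0.
have : 0 <= b - a by lra.
move: (b^-1) (a^-1) (b - a) => x y z z0 x0 xy xz; have : 0 <= x * y by nra.
have h : x * x <= x * y by nra.
move=> h2; have : x * (x * x) <= x * (x * y) by nra.
have : x * (x * y) <= 2 * z * (x * y) by nra.
nra.
Qed.

Lemma borel_cantelli_eventually (F : nat -> set T) (C : R) : (forall N, measurable (F N)) ->
  (forall N, (0 < N)%N -> (P (F N) <= (C * N%:R `^ (- (3 / 2)))%:E)%E) ->
  {ae P, forall w, exists N0, forall N, (N0 <= N)%N -> ~ F N w}.
Proof.
move=> mF hF; have C0 : 0 <= C.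
  have := le_trans (measure_ge0 P _) (hF 1%N isT); rewrite powR1 mulr1 lee_fin//.
pose G N := F N.+1.
have mG N : measurable (G N) by exact: mF.
have sG : (\sum_(0 <= i <oo) P (G i) < +oo)%E.
  apply: (@le_lt_trans _ _ (\sum_(0 <= i <oo) (C%:E * (i.+1%:R `^ (- (3 / 2)))%:E))%E).
    by apply: lee_nneseries => [i _ _|i _]; [exact: measure_ge0|rewrite -EFinM; exact: hF].
  rewrite nneseriesZl; last by move=> i _; rewrite lee_fin powR_ge0.
  apply: lte_mul_pinfty => //; apply: le_lt_trans le_nneseries_three_halves _; exact: ltry.
have h := lim_sup_set_cvg0 mG sG.
(* The events are shifted by one because the bound is vacuous for N = 0. *)
exists (lim_sup_set G); split => //.
  by apply: bigcap_measurable => // n _; apply: bigcup_measurable.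
move=> w /= hw n _; apply: contrapT => hn; apply: hw.
exists n.+1 => -[|N]//; rewrite ltnS => nN FN; apply: hn.
by exists N.
Qed.

End Probability.

(** * Near and far parts of the frozen increments *)

Section NearFar.
Context (R : realType) (d : measure_display) (T : measurableType d) (P : probability T R).
Context (alpha : R) (Z : set R -> {RV P >-> R}) (J : (R -> R) -> {RV P >-> R}).
Context (L : nat).

(** The factor N^m brings all increments to order at most 1, since their scale is N^(-v) with
    v >= m. *)
Definition scaled_abs (N : nat) (m p : R) (f : R -> R) (w : T) : R :=
  (N%:R `^ m * `|J f w|) `^ p.

Lemma measurable_scaled_abs N m p f : measurable_fun setT (scaled_abs N m p f).
Proof.
apply: (measurableT_comp (measurable_powR p)); apply: measurable_funM => //.
exact: measurableT_comp.
Qed.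

Lemma scaled_moment_le (p : R) : is_SaS_integral alpha Z J -> 1 < alpha -> 0 < p < alpha ->
  exists2 C : R, 0 <= C & forall (N k : nat) (v m K : R) (g : R -> R), (0 < N)%N -> m <= v ->
    measurable_fun [set: R] g -> 0 <= K -> (alpha_mass alpha g <= K%:E)%E ->
    (\int[P]_w (scaled_abs N m p
       (fun s => N%:R `^ (- (v - alpha^-1)) * g (k%:R - N%:R * s)%R) w)%:E
      <= (C * K `^ (p / alpha))%:E)%E.
Proof.
move=> HJ al1 /[dup] hp /andP[p0 pa]; have al0 : 0 < alpha by lra.
have [C C0 HC] := integral_moment_le HJ hp.
exists C => // N k v m K g N0 mv mg K0 hK.
have N0' : 0 < N%:R :> R by rewrite ltr0n.
have N1 : 1 <= N%:R :> R by rewrite ler1n.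
set f := fun s : R => _.
have mf : measurable_fun [set: R] f by exact: measurable_scaled.
have k0 : 0 <= N%:R `^ (- (alpha * v)) * K by rewrite mulr_ge0// powR_ge0.
have hf : (alpha_mass alpha f <= (N%:R `^ (- (alpha * v)) * K)%:E)%E.
  by rewrite /f scaled_mass// EFinM lee_wpmul2l// lee_fin powR_ge0.
have := HC f _ mf k0 hf => h.
have E w : (scaled_abs N m p f w)%:E = ((N%:R `^ (m * p))%:E * (`|J f w| `^ p)%:E)%E.
  by rewrite /scaled_abs powRM ?powR_ge0// -powRrM.
under eq_integral do rewrite E.
rewrite ge0_integralZl_EFin ?powR_ge0//; last first.
- apply/measurable_EFinP; apply: (measurableT_comp (measurable_powR p)).
  exact: measurableT_comp.
apply: (@le_trans _ _ ((N%:R `^ (m * p))%:E * (C * (N%:R `^ (- (alpha * v)) * K) `^ (p / alpha))%:E)%E).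
  by apply: lee_wpmul2l; rewrite ?lee_fin ?powR_ge0.
rewrite -EFinM lee_fin powRM ?powR_ge0// -powRrM.
rewrite (_ : N%:R `^ (m * p) * _ = C * (K `^ (p / alpha)) * (N%:R `^ (m * p) * N%:R `^ (- (alpha * v) * (p / alpha)))); last by ring.
rewrite -powRD ?(gt_eqF N0') ?implybT//.
rewrite -[leRHS]mulr1 ler_wpM2l ?mulr_ge0 ?powR_ge0//.
rewrite -[leRHS](powRr0 (N%:R : R)) ler_powR//.
rewrite (_ : - (alpha * v) * (p / alpha) = - (p * v)); last by field; lra.
nra.
Qed.

Lemma frozen_near_mass (B : R) (N k : nat) v : 1 < alpha -> (2 <= L)%N -> (0 < N)%N ->
  alpha^-1 < v < 1 -> (alpha_mass alpha (cut_near B (psi alpha L v)) <= (psi_mass_bound alpha L)%:E)%E.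
Proof.
move=> al1 L2 N0 hv; have al0 : 0 < alpha by lra.
apply: le_trans (psi_mass_le al1 L2 hv).
apply: le_alpha_mass; rewrite ?(ltW al0)//.
- exact: measurable_cut_near (measurable_psi alpha L v).
- exact: measurable_psi.
- by move=> x; rewrite /cut_near; case: ifP; rewrite ?normr0.
Qed.

Lemma Lfun_scaled (N k : nat) v g (K : R) : 1 < alpha -> (0 < N)%N -> measurable_fun [set: R] g ->
  (alpha_mass alpha g <= K%:E)%E ->
  (fun s => N%:R `^ (- (v - alpha^-1)) * g (k%:R - N%:R * s)) \in Lfun lebesgue_measure alpha%:E.
Proof.
move=> al1 N0 mg hK; have al0 : 0 < alpha by lra.
apply: Lfun_alpha_mass => //; first exact: measurable_scaled.
rewrite scaled_mass//; apply: lte_mul_pinfty; rewrite ?lee_fin ?powR_ge0//.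
by apply: le_lt_trans hK _; rewrite ltry.
Qed.

(** The near kernel of index k is supported in an interval of length (B + L) / N that
    moves by 1 / N with k. *)
Lemma frozen_near_disjoint (B N k k' : nat) v v' s : (k != k')%N -> (0 < B + L)%N ->
  (k = k' %[mod B + L])%N ->
  frozen_near alpha L B%:R N k v s = 0 \/ frozen_near alpha L B%:R N k' v' s = 0.
Proof.
move=> kk BL0 kmod.
have supp (j : nat) u : frozen_near alpha L B%:R N j u s != 0 ->
    - L%:R < j%:R - N%:R * s <= B%:R.
  rewrite /frozen_near /cut_near mulf_eq0 negb_or => /andP[_].
  case: ifP => [h|_]; last by rewrite eqxx.
  by rewrite andbT => hp; rewrite ltNge; apply: contra hp => h2; rewrite psi_eq0.
have [->|h1] := eqVneq (frozen_near alpha L B%:R N k v s) 0; first by left.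
have [->|h2] := eqVneq (frozen_near alpha L B%:R N k' v' s) 0; first by right.
exfalso; have /andP[a1 a2] := supp _ _ h1; have /andP[b1 b2] := supp _ _ h2.
have lt_sum (i j : nat) : (i%:R : R) < j%:R + (B%:R + L%:R) -> (i < j + (B + L))%N.
  by rewrite -!natrD ltr_nat.
have c1 : (k < k' + (B + L))%N by apply: lt_sum; lra.
have c2 : (k' < k + (B + L))%N by apply: lt_sum; lra.
wlog kk' : k k' kk kmod c1 c2 {h1 h2 a1 a2 b1 b2} / (k < k')%N.
  move=> W; move: (kk); rewrite neq_ltn => /orP[h|h]; first exact: (W k k').
  by apply: (W k' k) => //; rewrite eq_sym.
have : (B + L %| k' - k)%N by rewrite -eqn_mod_dvd ?(ltnW kk')//; apply/eqP.
move=> /dvdn_leq; rewrite subn_gt0 => /(_ kk').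
by rewrite leqNgt ltn_subLR ?c2// ltnW.
Qed.

Context (N n B : nat) (A : {set 'I_n}) (h : nat -> R) (m b M : R).

Definition near_power (k : 'I_n) (w : T) : R :=
  scaled_abs N m b (frozen_near alpha L B%:R N k (h k)) w.

(** Clipping makes Chernoff's inequality applicable; it changes nothing outside an event of
    small probability. *)
Definition clipped_power (k : 'I_n) (w : T) : R := Num.min (near_power k w) M.

(** Split the indices into residue classes modulo B + L. In each class the near parts are
    independent. Indices outside the class, or outside A, get the kernel 0, so that every
    class is a family over all of the index type. *)
Lemma near_classes_deviation (t m2 : R) : is_SaS_integral alpha Z J -> 1 < alpha ->
  (2 <= L)%N -> (0 < N)%N -> 0 < M -> 0 <= m2 -> 0 < t ->
  (forall k : 'I_n, k \in A -> alpha^-1 < h k < 1) ->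
  (forall k : 'I_n, k \in A -> (\int[P]_w (clipped_power k w ^+ 2)%:E <= m2%:E)%E) ->
  (P [set w | t * (B + L)%:R < `|\sum_(k in A) (clipped_power k w - \int[P]_w' clipped_power k w')| ]%R
    <= ((B + L)%:R * (2 * expR (- (t / M) + n%:R * (m2 / M ^+ 2))))%:E)%E.
Proof.
move=> HJ al1 L2 N0 M0 m20 t0 hh hm2.
have BL0 : (0 < B + L)%N by rewrite addn_gt0 (ltnW L2) orbT.
pose inr (r : nat) (k : 'I_n) := (k \in A) && (k %% (B + L) == r)%N.
pose f r (k : 'I_n) := if inr r k then frozen_near alpha L B%:R N k (h k) else fun=> 0 : R.
pose g r (k : 'I_n) (x : R) := if inr r k then Num.min ((N%:R `^ m * `|x|) `^ b) M else 0.
have fL r k : f r k \in Lfun lebesgue_measure alpha%:E.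
  rewrite /f; case: ifP => [/andP[kA _]|_]; last exact: (cst0_Lfun al1).
  apply: Lfun_scaled (frozen_near_mass B%:R k al1 L2 N0 (hh k kA)) => //.
  exact: measurable_cut_near (measurable_psi alpha L _).
have ind r : mutually_independent P (fun k => J (f r k) : T -> R).
  apply: (SaSi_independent HJ) => // i j ij; apply: aeW => s; rewrite /f.
  case: ifP => [/andP[_ /eqP hi]|_]; last by left.
  case: ifP => [/andP[_ /eqP hj]|_]; last by right.
  by apply: frozen_near_disjoint => //; rewrite hi hj.
have mclip : measurable_fun setT (fun x : R => Num.min ((N%:R `^ m * `|x|) `^ b) M).
  apply: measurable_minr => //; apply: (measurableT_comp (measurable_powR b)).
  by apply: measurable_funM => //.
have mg r k : measurable_fun setT (g r k) by rewrite /g; case: (inr r k).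
have gM r k x : 0 <= g r k x <= M.
  rewrite /g; case: (inr r k); last by rewrite lexx ltW.
  by rewrite le_min powR_ge0 (ltW M0)/= ge_min lexx orbT.
have gE r k w : g r k (J (f r k) w) = if inr r k then clipped_power k w else 0.
  by rewrite /g /f; case: (inr r k).
have gm2 r k : (\int[P]_w (g r k (J (f r k) w) ^+ 2)%:E <= m2%:E)%E.
  under eq_integral do rewrite gE.
  have [/andP[kA _]|_] := boolP (inr r k); first exact: hm2.
  by under eq_integral do rewrite expr0n; rewrite integral0 lee_fin.
have mJ r k : measurable_fun setT (J (f r k) : T -> R) by [].
pose E (r : nat) := [set w | t <= `|\sum_i (g r i (J (f r i) w) - \int[P]_w' (g r i (J (f r i) w')))|].
have hE r : (P (E r) <= (2 * expR (- (t / M) + n%:R * (m2 / M ^+ 2)))%:E)%E.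
  exact: (chernoff_independent_sum (mJ r) (ind r) (mg r) M0 (gM r) (gm2 r) t).
have mE r : measurable (E r).
  rewrite -[E r]setTI; apply: (measurable_fun_le (f := cst t)) => //.
  apply: measurableT_comp => //; apply: measurable_sum => i.
  by apply: measurable_funB => //; exact: (measurableT_comp (mg r i)).
have mclp k : measurable_fun setT (clipped_power k).
  by apply: measurable_minr => //; exact: measurable_scaled_abs.
have mD : measurable [set w | t * (B + L)%:R < `|\sum_(k in A) (clipped_power k w - \int[P]_w' clipped_power k w')|].
  set Y := fun w => `|\sum_(k in A) (clipped_power k w - \int[P]_w' clipped_power k w')|.
  have mY : measurable_fun setT Y.
    apply: measurableT_comp => //; rewrite /Y.
    under eq_fun do rewrite big_mkcond/=.
    apply: measurable_sum => i; have [_|_] := boolP (i \in A); last exact: measurable_cst.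
    by apply: measurable_funB.
  rewrite (_ : [set w | _] = setT `&` Y @^-1` `]t * (B + L)%:R, +oo[); first exact: mY.
  by rewrite setTI; apply/seteqP; split => w; rewrite /= in_itv/= andbT.
have sub : [set w | t * (B + L)%:R < `|\sum_(k in A) (clipped_power k w - \int[P]_w' clipped_power k w')|]
    `<=` \big[setU/set0]_(r < B + L) E r.
  move=> w /= hw; apply: contrapT => hn.
  have hr (r : 'I_(B + L)) : `|\sum_i (g r i (J (f r i) w) - \int[P]_w' (g r i (J (f r i) w')))| <= t.
    rewrite leNgt; apply/negP => hr; apply: hn; rewrite (bigD1 r)//=; left.
    exact: ltW.
  move: hw; rewrite ltNge => /negP; apply.
  rewrite (partition_big (fun k : 'I_n => Ordinal (ltn_pmod k BL0)) xpredT)//=.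
  apply: (le_trans (ler_norm_sum _ _ _)).
  apply: (@le_trans _ _ (\sum_(r < B + L) t)); last first.
    by rewrite sumr_const card_ord mulr_natr.
  apply: ler_sum => r _; apply: le_trans (hr r); rewrite le_eqVlt; apply/orP; left; apply/eqP.
  congr `|_|; rewrite big_mkcond/=; apply: eq_bigr => i _.
  have -> : (fun w' => g r i (J (f r i) w')) = (fun w' => if inr r i then clipped_power i w' else 0).
    by apply/funext => w'; rewrite gE.
  rewrite gE /inr -(inj_eq val_inj)/=.
  case: (_ && _) => //; by rewrite /Rintegral integral0 subrr.
apply: (@le_trans _ _ (P (\big[setU/set0]_(r < B + L) E r))).
  by apply: le_measure; rewrite ?inE//; apply: bigsetU_measurable.
apply: (le_trans (Boole_inequality _ (fun r _ => mE r))).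
apply: (@le_trans _ _ (\sum_(r < B + L) (2 * expR (- (t / M) + n%:R * (m2 / M ^+ 2)))%:E)%E).
  by apply: lee_sum => r _; exact: hE.
by rewrite sumEFin sumr_const card_ord (mulr_natl (2 * _) (B + L)%N).
Qed.

End NearFar.

(** * Inequalities for powers, unions and means *)

Section PowerBounds.
Context (R : realType).
Implicit Types (x y e : R).

Lemma powR_subadditive x y e : 0 <= x -> 0 <= y -> 0 < e <= 1 ->
  (x + y) `^ e <= x `^ e + y `^ e.
Proof.
move=> x0 y0 /andP[e0 e1]; have [s0|] := ltP 0 (x + y); last first.
  move=> s0; have -> : x = 0 by lra.
  by rewrite add0r powR0 ?gt_eqF// add0r.
have key z : 0 <= z <= x + y -> z / (x + y) * (x + y) `^ e <= z `^ e.
  move=> /andP[z0 zs]; have [->|zn0] := eqVneq z 0.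
    by rewrite mul0r mul0r powR_ge0.
  have zp : 0 < z by rewrite lt_neqAle eq_sym zn0.
  have -> : z `^ e = (z / (x + y)) `^ e * (x + y) `^ e.
    by rewrite -powRM ?divr_ge0 ?mulfVK ?gt_eqF// ltW.
  rewrite ler_wpM2r ?powR_ge0//.
  rewrite -[leLHS]powRr1 ?divr_ge0 ?(ltW s0)//; apply: ger_powR => //.
  by rewrite divr_gt0//= ler_pdivrMr// mul1r.
have kx := key x ltac:(apply/andP; split; lra); have ky := key y ltac:(apply/andP; split; lra).
have -> : (x + y) `^ e = x / (x + y) * (x + y) `^ e + y / (x + y) * (x + y) `^ e.
  by rewrite -mulrDl -mulrDl divff ?mul1r// gt_eqF.
exact: lerD.
Qed.

(** Subadditivity of the concave power x^e. *)
Lemma normr_powR_sub_le x y e : 0 <= x -> 0 <= y -> 0 < e <= 1 ->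
  `|x `^ e - y `^ e| <= `|x - y| `^ e.
Proof.
move=> x0 y0 he; have /andP[e0 _] := he.
wlog xy : x y x0 y0 / y <= x.
  move=> W; have [|/ltW] := leP y x; first exact: W.
  by rewrite distrC (distrC x); exact: W.
have d0 : 0 <= x - y by lra.
rewrite (ger0_norm d0) ger0_norm; last first.
  by rewrite subr_ge0; apply: ge0_ler_powR; rewrite ?nnegrE ?(ltW e0).
have := powR_subadditive y0 d0 he; rewrite (_ : y + (x - y) = x); last by ring.
lra.
Qed.

Lemma expR_powR_decay : exists2 C : R, 0 <= C & forall x, 1 <= x ->
  expR (- (x `^ (1 / 50))) <= C * x `^ (- 2).
Proof.
exists (100%:R ^+ 100); first by rewrite exprn_ge0.
move=> x x1; have x0 : 0 < x by lra.
have := @expR_decay R (x `^ (1 / 50)) 100 isT (powR_gt0 _ x0).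
rewrite expr_div_n => /le_trans; apply.
rewrite ler_wpM2l ?exprn_ge0//.
rewrite -powRX ?(ltW x0)// -[leLHS]powR_inv1 ?powR_ge0//.
rewrite -powR_mulrn ?(ltW x0)// -!powRrM.
rewrite le_eqVlt; apply/orP; left; apply/eqP; congr (_ `^ _).
by field.
Qed.

End PowerBounds.

Section UnionBound.
Context (R : realType) (d : measure_display) (T : measurableType d) (P : probability T R).

Lemma union_bound (n : nat) (A : {set 'I_n}) (F : 'I_n -> set T) (c : R) :
  (forall k, measurable (F k)) -> 0 <= c -> (forall k, k \in A -> (P (F k) <= c%:E)%E) ->
  measurable (\big[setU/set0]_(k in A) F k) /\
  (P (\big[setU/set0]_(k in A) F k) <= (n%:R * c)%:E)%E.
Proof.
move=> mF c0 hF; split; first by apply: bigsetU_measurable.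
have h (s : seq 'I_n) : (P (\big[setU/set0]_(k <- s | k \in A) F k) <= ((size s)%:R * c)%:E)%E.
  elim: s => [|k s IH]; first by rewrite big_nil measure0 mul0r.
  rewrite big_cons; case: ifP => kA; last first.
    apply: (le_trans IH); rewrite lee_fin ler_wpM2r// ler_nat.
    exact: leqnSn.
  apply: (le_trans (measureU2 _ _ _)) => //; first exact: bigsetU_measurable.
  by rewrite -natr1 mulrDl mul1r addrC EFinD; apply: leeD => //; exact: hF.
have sz : size (index_enum 'I_n) = n by rewrite -[RHS](card_ord n) cardE enumT [index_enum _]unlock.
by have := h (index_enum 'I_n); rewrite sz.
Qed.

Lemma integrable_of_moment (f : T -> R) (K : R) : measurable_fun setT f -> (forall w, 0 <= f w) ->
  (\int[P]_w (f w)%:E <= K%:E)%E -> P.-integrable setT (EFin \o f).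
Proof.
move=> mf f0 hK; apply/integrableP; split; first exact/measurable_EFinP.
apply: (@le_lt_trans _ _ K%:E); last exact: ltry.
apply: le_trans hK; rewrite le_eqVlt; apply/orP; left; apply/eqP.
by apply: eq_integral => w _ /=; rewrite ger0_norm.
Qed.

Lemma Rintegral_dist_le (f g h : T -> R) (K : R) :
  P.-integrable setT (EFin \o f) -> P.-integrable setT (EFin \o g) ->
  measurable_fun setT h -> {ae P, forall w, `|f w - g w| <= h w} -> (forall w, 0 <= h w) ->
  (\int[P]_w (h w)%:E <= K%:E)%E ->
  `|(\int[P]_w f w)%R - (\int[P]_w g w)%R| <= K.
Proof.
move=> fi gi mh fgh h0 hK.
rewrite -(RintegralB measurableT fi gi).
have dI : P.-integrable setT (EFin \o (fun w => f w - g w)) by exact: (integrableB measurableT fi gi).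
apply: (le_trans (le_normr_Rintegral measurableT dI)).
have aI : P.-integrable setT (EFin \o (fun w => `|f w - g w|)) by exact: (integrable_norm dI).
rewrite -lee_fin /Rintegral fineK; last exact: (integrable_fin_num _ aI).
apply: le_trans hK; apply: ae_ge0_le_integral => //.
- by have /integrableP[] := aI.
- by move=> w _; rewrite lee_fin.
- exact/measurable_EFinP.
- by apply: filterS fgh => w hw _; rewrite lee_fin.
Qed.

End UnionBound.

(** * Deviation of the frozen variation outside small events *)

Section Concentration.
Context (R : realType) (d : measure_display) (T : measurableType d) (P : probability T R).
Context (alpha : R) (Z : set R -> {RV P >-> R}) (J : (R -> R) -> {RV P >-> R}).
Context (L : nat).

(** Self-similarity gives the factor N^(-p v), absorbed by N^(p m). *)
Lemma near_far_moments (p : R) : is_SaS_integral alpha Z J -> 1 < alpha -> (2 <= L)%N ->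
  0 < p < alpha -> exists2 C : R, 0 <= C &
  forall (N k B : nat) (v m : R), (0 < N)%N -> (0 < B)%N -> m <= v -> alpha^-1 < v < 1 ->
  [/\ (\int[P]_w (scaled_abs J N m p (frozen_kernel alpha L N k v) w)%:E <= C%:E)%E,
      (\int[P]_w (scaled_abs J N m p (frozen_near alpha L B%:R N k v) w)%:E <= C%:E)%E &
      (\int[P]_w (scaled_abs J N m p (frozen_far alpha L B%:R N k v) w)%:E
         <= (C * B%:R `^ (- (p * (L%:R - 1))))%:E)%E].
Proof.
move=> HJ al1 L2 hp; have /andP[p0 pa] := hp; have al0 : 0 < alpha by lra.
have [C C0 HC] := scaled_moment_le HJ al1 hp.
have e1 := L_exponent al1 L2.
have f0 : 0 <= far_mass_const alpha L by rewrite divr_ge0 ?powR_ge0//; lra.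
exists (C * psi_mass_bound alpha L `^ (p / alpha) + C * far_mass_const alpha L `^ (p / alpha)).
  by rewrite addr_ge0// mulr_ge0// powR_ge0.
move=> N k B v m N0 B0 mv hv.
have B1 : 1 <= B%:R :> R by rewrite ler1n.
have K0 : 0 <= psi_mass_bound alpha L.
  by rewrite -lee_fin; apply: le_trans (psi_mass_le al1 L2 hv); exact: alpha_mass_ge0.
have mpsi := measurable_psi alpha L v.
have c1 : 0 <= C * psi_mass_bound alpha L `^ (p / alpha) by rewrite mulr_ge0// powR_ge0.
have c2 : 0 <= C * far_mass_const alpha L `^ (p / alpha) by rewrite mulr_ge0// powR_ge0.
split.
- apply: (le_trans (HC N k v m _ _ N0 mv mpsi K0 (psi_mass_le al1 L2 hv))).
  by rewrite lee_fin lerDl.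
- apply: (le_trans (HC N k v m _ _ N0 mv (measurable_cut_near _ mpsi) K0 (frozen_near_mass B%:R k al1 L2 N0 hv))).
  by rewrite lee_fin lerDl.
- apply: (le_trans (HC N k v m _ _ N0 mv (measurable_cut_far _ mpsi) _ (psi_far_mass_le al1 L2 hv B1))).
    by rewrite mulr_ge0// powR_ge0.
  rewrite lee_fin powRM ?powR_ge0// -powRrM.
  rewrite (_ : - (alpha * (L%:R - 1)) * (p / alpha) = - (p * (L%:R - 1))); last by field; lra.
  by rewrite mulrA ler_wpM2r ?powR_ge0// lerDr.
Qed.

Lemma frozen_near_far_ae (N k B : nat) (v : R) : is_SaS_integral alpha Z J -> 1 < alpha ->
  (2 <= L)%N -> (0 < N)%N -> (0 < B)%N -> alpha^-1 < v < 1 ->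
  {ae P, forall w, J (frozen_kernel alpha L N k v) w =
    J (frozen_near alpha L B%:R N k v) w + J (frozen_far alpha L B%:R N k v) w}.
Proof.
move=> HJ al1 L2 N0 B0 hv; have mpsi := measurable_psi alpha L v.
have B1 : 1 <= B%:R :> R by rewrite ler1n.
have ln := Lfun_scaled k v al1 N0 (measurable_cut_near B%:R mpsi) (frozen_near_mass B%:R k al1 L2 N0 hv).
have lf := Lfun_scaled k v al1 N0 (measurable_cut_far B%:R mpsi) (psi_far_mass_le al1 L2 hv B1).
have := SaSi_linear HJ 1 ln lf; apply: filterS => w.
rewrite mul1r => <-; congr (J _ w); apply/funext => s.
by rewrite (frozen_near_far _ _ B%:R) mul1r.
Qed.

(** The integer part of x^(3/10), plus one. *)
Lemma window_size x : 1 <= x ->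
  exists B : nat, [/\ (0 < B)%N, x `^ (3 / 10) <= B%:R & (B + L)%:R <= (2 + L%:R) * x `^ (3 / 10) :> R].
Proof.
move=> x1; have y1 : 1 <= x `^ (3 / 10) by rewrite -[leLHS](powRr0 x); apply: ler_powR => //; lra.
have y0 : 0 <= x `^ (3 / 10) by lra.
exists (Num.trunc (x `^ (3 / 10))).+1; split => //.
  by apply: ltW; exact: truncnS_gt.
have h : (Num.trunc (x `^ (3 / 10)))%:R <= x `^ (3 / 10) by rewrite truncn_le.
rewrite natrD -natr1.
have : 0 <= L%:R * (x `^ (3 / 10) - 1) by rewrite mulr_ge0//; lra.
move: h; move: (Num.trunc _)%:R (L%:R : R) => a l; nra.
Qed.

(** Compare successively the frozen power with the clipped near power, the latter with its
    mean, and the means back; each index costs tau^b for the far part, C1 / M for clipping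
    the mean and C2 for dropping the far part from the mean. *)
Lemma deviation_on_good_event (N n B : nat) (A : {set 'I_n}) (hu : nat -> R) (m b M t tau C1 C2 : R) (w : T) :
  0 < b <= 1 -> 0 < M -> 0 <= tau -> 0 <= C1 -> 0 <= C2 ->
  (forall k : 'I_n, k \in A -> J (frozen_kernel alpha L N k (hu k)) w =
    J (frozen_near alpha L B%:R N k (hu k)) w + J (frozen_far alpha L B%:R N k (hu k)) w) ->
  (forall k : 'I_n, k \in A -> {ae P, forall w, J (frozen_kernel alpha L N k (hu k)) w =
    J (frozen_near alpha L B%:R N k (hu k)) w + J (frozen_far alpha L B%:R N k (hu k)) w}) ->
  (forall k : 'I_n, k \in A ->
    (\int[P]_w (scaled_abs J N m b (frozen_kernel alpha L N k (hu k)) w)%:E <= C1%:E)%E) ->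
  (forall k : 'I_n, k \in A ->
    (\int[P]_w (scaled_abs J N m b (frozen_near alpha L B%:R N k (hu k)) w)%:E <= C1%:E)%E) ->
  (forall k : 'I_n, k \in A ->
    (\int[P]_w (near_power alpha J L N B hu m b k w ^+ 2)%:E <= C1%:E)%E) ->
  (forall k : 'I_n, k \in A ->
    (\int[P]_w (scaled_abs J N m b (frozen_far alpha L B%:R N k (hu k)) w)%:E <= C2%:E)%E) ->
  `|\sum_(k in A) (clipped_power alpha J L N B hu m b M k w
      - \int[P]_w' clipped_power alpha J L N B hu m b M k w')| <= t ->
  (forall k : 'I_n, k \in A -> near_power alpha J L N B hu m b k w <= M) ->
  (forall k : 'I_n, k \in A -> scaled_abs J N m 1 (frozen_far alpha L B%:R N k (hu k)) w <= tau) ->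
  `|\sum_(k in A) (scaled_abs J N m b (frozen_kernel alpha L N k (hu k)) w
      - \int[P]_w' scaled_abs J N m b (frozen_kernel alpha L N k (hu k)) w')|
   <= t + n%:R * (tau `^ b + C1 / M + C2).
Proof.
move=> hb M0 tau0 C10 C20 sumw sumae mF mN mN2 mFar dev clip far.
have /andP[b0 b1] := hb.
pose F (k : 'I_n) := scaled_abs J N m b (frozen_kernel alpha L N k (hu k)).
pose z (k : 'I_n) := clipped_power alpha J L N B hu m b M k.
pose y (k : 'I_n) := near_power alpha J L N B hu m b k.
have dist (k : 'I_n) w' : J (frozen_kernel alpha L N k (hu k)) w' =
    J (frozen_near alpha L B%:R N k (hu k)) w' + J (frozen_far alpha L B%:R N k (hu k)) w' ->
  `|F k w' - y k w'| <= scaled_abs J N m b (frozen_far alpha L B%:R N k (hu k)) w'.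
  move=> E; rewrite /F /y /near_power /scaled_abs E.
  apply: (le_trans (normr_powR_sub_le _ _ hb)); rewrite ?mulr_ge0 ?powR_ge0//.
  apply: ge0_ler_powR; rewrite ?nnegrE ?(ltW b0) ?mulr_ge0 ?powR_ge0//.
  rewrite -mulrBr normrM ger0_norm ?powR_ge0// ler_wpM2l ?powR_ge0//.
  apply: (le_trans (ler_dist_dist _ _)); rewrite addrAC subrr add0r//.
have mfF k : measurable_fun setT (F k) by exact: measurable_scaled_abs.
have mfy k : measurable_fun setT (y k) by exact: measurable_scaled_abs.
have y0 k w' : 0 <= y k w' by exact: powR_ge0.
have F0 k w' : 0 <= F k w' by exact: powR_ge0.
have zy k w' : 0 <= z k w' <= y k w'.
  by rewrite /z /clipped_power le_min ge_min lexx/= andbT (ltW M0) andbT y0.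
have mfz k : measurable_fun setT (z k) by exact: measurable_minr.
have iF k : k \in A -> P.-integrable setT (EFin \o F k).
  by move=> kA; exact: (integrable_of_moment (mfF k) (F0 k) (mF k kA)).
have iy k : k \in A -> P.-integrable setT (EFin \o y k).
  by move=> kA; exact: (integrable_of_moment (mfy k) (y0 k) (mN k kA)).
have iz k : k \in A -> P.-integrable setT (EFin \o z k).
  move=> kA; apply: (@integrable_of_moment _ _ _ _ _ C1) => //.
    by move=> w'; have /andP[] := zy k w'.
  apply: le_trans (mN k kA); apply: ge0_le_integral => //.
  - by move=> w' _; rewrite lee_fin; have /andP[] := zy k w'.
  - by apply/measurable_EFinP; exact: mfz.
  - by apply/measurable_EFinP; exact: mfy.
  - by move=> w' _; rewrite lee_fin; have /andP[] := zy k w'.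
have b1' k : k \in A -> `|F k w - z k w| <= tau `^ b.
  move=> kA; have -> : z k w = y k w by rewrite /z /clipped_power; apply/min_idPl; exact: clip.
  apply: (le_trans (dist k w (sumw k kA))).
  have := far k kA; rewrite /scaled_abs powRr1 ?mulr_ge0 ?powR_ge0// => h.
  by apply: ge0_ler_powR; rewrite ?nnegrE ?(ltW b0) ?mulr_ge0 ?powR_ge0.
have b2' k : k \in A -> `|(\int[P]_w' y k w')%R - (\int[P]_w' z k w')%R| <= C1 / M.
  move=> kA; apply: (@Rintegral_dist_le _ _ _ _ _ _ (fun w' => M^-1 * y k w' ^+ 2)).
  - exact: iy.
  - exact: iz.
  - by apply: measurable_funM => //; apply: measurable_funX.
  - apply: aeW => w'; have /andP[z1 z2] := zy k w'.
    by rewrite ger0_norm ?subr_ge0// mulrC; exact: min_defect_le.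
  - by move=> w'; rewrite mulr_ge0 ?invr_ge0 ?sqr_ge0// ltW.
  - under eq_integral do rewrite EFinM.
    rewrite ge0_integralZl_EFin ?invr_ge0 ?(ltW M0)//; last 2 first.
    + by move=> w' _; rewrite lee_fin sqr_ge0.
    + by apply/measurable_EFinP; exact: measurable_funX.
    by rewrite mulrC EFinM; apply: lee_wpmul2l; [rewrite lee_fin invr_ge0 ltW|exact: mN2].
have b3' k : k \in A -> `|(\int[P]_w' F k w')%R - (\int[P]_w' y k w')%R| <= C2.
  move=> kA; apply: (@Rintegral_dist_le _ _ _ _ _ _ (scaled_abs J N m b (frozen_far alpha L B%:R N k (hu k)))).
  - exact: iF.
  - exact: iy.
  - exact: measurable_scaled_abs.
  - by apply: filterS (sumae k kA) => w' E; exact: dist.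
  - by move=> w'; exact: powR_ge0.
  - exact: mFar.
have -> : \sum_(k in A) (F k w - \int[P]_w' F k w')%R =
  \sum_(k in A) (z k w - \int[P]_w' z k w')%R + \sum_(k in A) ((F k w - z k w)
    - ((\int[P]_w' F k w')%R - (\int[P]_w' y k w')%R) - ((\int[P]_w' y k w')%R - (\int[P]_w' z k w')%R)).
  have alg (f e z' g y' : R) : f - e = (z' - g) + (f - z' - (e - y') - (y' - g)) by ring.
  by rewrite -big_split/=; apply: eq_bigr => k _; exact: alg.
apply: (le_trans (ler_normD _ _)); apply: lerD => //.
apply: (le_trans (ler_norm_sum _ _ _)).
have tot0 : 0 <= tau `^ b + C1 / M + C2.
  by rewrite !addr_ge0 ?powR_ge0// divr_ge0// ltW.
apply: (@le_trans _ _ (\sum_(k in A) (tau `^ b + C1 / M + C2))).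
  apply: ler_sum => k kA.
  have q1 := b1' k kA; have q2 := b2' k kA; have q3 := b3' k kA.
  apply: (le_trans (ler_normB _ _)).
  have := ler_normB (F k w - z k w) ((\int[P]_w' F k w')%R - (\int[P]_w' y k w')%R).
  move: q1 q2 q3; lra.
rewrite sumr_const -(mulr_natl _ #|A|); apply: ler_wpM2r => //; rewrite ler_nat.
by rewrite -[X in (_ <= X)%N](card_ord n); exact: max_card.
Qed.
End Concentration.

(** * Concentration of the frozen variation *)

Section BadEvent.
Context (R : realType) (d : measure_display) (T : measurableType d) (P : probability T R).
Context (alpha : R) (Z : set R -> {RV P >-> R}) (J : (R -> R) -> {RV P >-> R}).
Context (L : nat).

Lemma powRN_antitone (a c e : R) : 0 < a -> a <= c -> 0 <= e -> c `^ (- e) <= a `^ (- e).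
Proof.
move=> a0 ac e0; have c0 : 0 < c by lra.
rewrite !powRN lef_pV2 ?posrE ?powR_gt0//.
by apply: ge0_ler_powR; rewrite ?nnegrE ?(ltW a0) ?(ltW c0).
Qed.

Ltac forget := clear - R d T P alpha Z J L.

(** Let x = N. With B = x^(3/10), clipping level M = x^(16/25), deviation t = x^(33/50) per class
    and far level tau = x^(-1/10): the Chernoff term is exp(-x^(1/50) + O(1)); clipping fails
    with probability at most x M^(-1/b) <= x^(1-64/25), as b <= 1/4; the far part is large with
    probability at most x B^(-(L-1)) / tau <= x^(1-26/10), as L >= 10. All three are
    O(x^(-3/2)). The resulting error is at most t (B + L) + x tau^b + x / M
    + x B^(-b(L-1)), where the last exponent is at most 1 - 6/10 because b (L - 1) >= 2. *)
Lemma frozen_bad_event (b m h2 : R) : is_SaS_integral alpha Z J -> 1 < alpha < 2 ->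
  0 < b <= 4^-1 -> 2 / b + 1 < L%:R -> alpha^-1 < m -> h2 < 1 ->
  exists2 C : R, 0 <= C & forall (N n : nat) (A : {set 'I_n}) (hu : nat -> R),
    (0 < N)%N -> (n <= N)%N -> (forall k : 'I_n, k \in A -> m <= hu k <= h2) ->
    exists2 bad : set T, measurable bad /\ (P bad <= (C * N%:R `^ (- (3 / 2)))%:E)%E &
    {ae P, forall w, ~ bad w ->
      `|\sum_(k in A) (scaled_abs J N m b (frozen_kernel alpha L N k (hu k)) w
         - \int[P]_w' scaled_abs J N m b (frozen_kernel alpha L N k (hu k)) w')|
      <= C * N%:R `^ (1 - b / 10)}.
Proof.
move=> HJ /andP[al1 al2] /andP[b0 b4] Lb hm h21.
have bi : 4 <= b^-1 by rewrite -[leLHS]invrK lef_pV2 ?posrE ?invr_gt0.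
have L9 : 9 < L%:R :> R by lra.
have L10 : 10 <= L%:R :> R by rewrite (ler_nat R 10) -(ltr_nat R).
have L2 : (2 <= L)%N by rewrite -(ler_nat R); lra.
have bL : 2 <= b * (L%:R - 1).
  have : 2 / b * b < (L%:R - 1) * b by rewrite ltr_pM2r//; lra.
  by rewrite mulfVK ?gt_eqF// => ?; rewrite mulrC ltW.
have pa : 0 < b < alpha by apply/andP; split; lra.
have pb : 0 < 2 * b < alpha by apply/andP; split; lra.
have pc : 0 < (1 : R) < alpha by rewrite ltr01.
have [Ca Ca0 Ha] := near_far_moments HJ al1 L2 pa.
have [Cb Cb0 Hb] := near_far_moments HJ al1 L2 pb.
have [Cc Cc0 Hc] := near_far_moments HJ al1 L2 pc.
have [Cd Cd0 Hd] := expR_powR_decay R.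
pose CD := (2 + L%:R) * (2 * (Cd * expR Cb)).
have CD0 : 0 <= CD by rewrite /CD !mulr_ge0 ?expR_ge0 ?addr_ge0.
pose Cf := 3 + L%:R + (Ca + Cb) + Ca.
have Cf0 : 0 <= Cf by rewrite /Cf; have : 0 <= L%:R :> R by []; lra.
have bad_le : 0 <= CD + Cc + Cc by lra.
exists (CD + Cc + Cc + Cf); first by lra.
move=> N n A hu N0 nN hhu.
have [x xE] : exists x : R, x = N%:R by exists N%:R.
have x1 : 1 <= x by rewrite xE ler1n.
have x0 : 0 < x by lra.
have nx : n%:R <= x by rewrite xE ler_nat.
have ple e1 e2 : e1 <= e2 -> x `^ e1 <= x `^ e2 by move=> ?; exact: ler_powR.
have pD e1 e2 : x `^ e1 * x `^ e2 = x `^ (e1 + e2) by rewrite powRD// (gt_eqF x0) implybT.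
have pM e1 e2 : (x `^ e1) `^ e2 = x `^ (e1 * e2) by rewrite powRrM.
have p0 e : 0 < x `^ e by rewrite powR_gt0.
have pV e : (x `^ e)^-1 = x `^ (- e) by rewrite powRN.
have px : x = x `^ 1 by rewrite powRr1// ltW.
have [B [B0 Bx BLx]] := window_size L x1.
have hv (k : 'I_n) : k \in A -> m <= hu k /\ alpha^-1 < hu k < 1.
  by move=> /hhu/andP[h1 h3]; split => //; apply/andP; split; move: h1 h3 hm h21; forget; lra.
pose near k := frozen_near alpha L B%:R N k (hu k).
pose far k := frozen_far alpha L B%:R N k (hu k).
pose M := x `^ (16 / 25); pose t := x `^ (33 / 50); pose tau := x `^ (- (1 / 10)).
have M0 : 0 < M by exact: p0.
have t0 : 0 < t by exact: p0.
have tau0 : 0 < tau by exact: p0.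
pose D := [set w | t * (B + L)%:R < `|\sum_(k in A) (clipped_power alpha J L N B hu m b M k w
      - \int[P]_w' clipped_power alpha J L N B hu m b M k w')| ].
pose E (k : 'I_n) := [set w | M < near_power alpha J L N B hu m b k w].
pose F (k : 'I_n) := [set w | tau < scaled_abs J N m 1 (far k) w].
have near2 (k : 'I_n) w : near_power alpha J L N B hu m b k w ^+ 2 = scaled_abs J N m (2 * b) (near k) w.
  by rewrite /near_power /scaled_abs -powR_mulrn ?powR_ge0// -powRrM [b * _]mulrC.
have m2near (k : 'I_n) : k \in A -> (\int[P]_w (near_power alpha J L N B hu m b k w ^+ 2)%:E <= Cb%:E)%E.
  move=> kA; have [mh ah] := hv k kA; have [_ h _] := Hb N k B _ m N0 B0 mh ah.
  by under eq_integral do rewrite near2.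
have mnear (k : 'I_n) : measurable_fun setT (near_power alpha J L N B hu m b k).
  exact: measurable_scaled_abs.
have mclip (k : 'I_n) : measurable_fun setT (clipped_power alpha J L N B hu m b M k).
  exact: measurable_minr.
have clip_le (k : 'I_n) w : 0 <= clipped_power alpha J L N B hu m b M k w <= near_power alpha J L N B hu m b k w.
  by rewrite /clipped_power le_min ge_min lexx/= andbT (ltW M0) andbT powR_ge0.
have m2clip (k : 'I_n) : k \in A ->
    (\int[P]_w (clipped_power alpha J L N B hu m b M k w ^+ 2)%:E <= Cb%:E)%E.
  move=> kA; apply: le_trans (m2near k kA); apply: ge0_le_integral => //.
  - by move=> w _; rewrite lee_fin sqr_ge0.
  - by apply/measurable_EFinP; exact: measurable_funX.
  - by apply/measurable_EFinP; exact: measurable_funX.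
  - move=> w _; rewrite lee_fin; have /andP[c1 c2] := clip_le k w.
    by apply: lerXn2r; rewrite ?nnegrE// (le_trans c1).
have gt_meas (Y : T -> R) (c : R) : measurable_fun setT Y -> measurable [set w | c < Y w].
  move=> mY; rewrite (_ : [set w | _] = setT `&` Y @^-1` `]c, +oo[); first exact: mY.
  by rewrite setTI; apply/seteqP; split => w; rewrite /= in_itv/= andbT.
have mD : measurable D.
  apply: gt_meas; apply: measurableT_comp => //.
  under eq_fun do rewrite big_mkcond/=.
  apply: measurable_sum => i; have [_|_] := boolP (i \in A); last exact: measurable_cst.
  exact: measurable_funB.
have PD : (P D <= (CD * x `^ (- (3 / 2)))%:E)%E.
  have h := near_classes_deviation HJ al1 L2 N0 M0 Cb0 t0 (fun k kA => (hv k kA).2) m2clip.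
  apply: (le_trans h); rewrite lee_fin.
  have tM : t / M = x `^ (1 / 50) by rewrite /t /M pV pD; congr (_ `^ _); field.
  have nM : n%:R * (Cb / M ^+ 2) <= Cb.
    rewrite mulrCA -[leRHS]mulr1 ler_wpM2l// ler_pdivrMr ?exprn_gt0// mul1r.
    apply: (le_trans nx); rewrite {1}px -powR_mulrn ?(ltW M0)// pM.
    by apply: ple; forget; lra.
  have e1 : expR (- (t / M) + n%:R * (Cb / M ^+ 2)) <= (Cd * expR Cb) * x `^ (- 2).
    rewrite expRD mulrAC; apply: ler_pM; rewrite ?expR_ge0//; last by rewrite ler_expR.
    by rewrite tM; exact: Hd.
  apply: (@le_trans _ _ ((2 + L%:R) * x `^ (3 / 10) * (2 * ((Cd * expR Cb) * x `^ (- 2))))).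
    by apply: ler_pM => //; rewrite ?mulr_ge0 ?expR_ge0// ler_wpM2l.
  rewrite (_ : _ * (2 * _) = CD * (x `^ (3 / 10) * x `^ (- 2))); last by rewrite /CD; ring.
  by rewrite pD ler_wpM2l//; apply: ple; forget; lra.
have mE k : measurable (E k) by exact: gt_meas.
have mF k : measurable (F k) by apply: gt_meas; exact: measurable_scaled_abs.
have PE k : k \in A -> (P (E k) <= (Cc * x `^ (- (64 / 25)))%:E)%E.
  move=> kA; have [mh ah] := hv k kA; have [_ h _] := Hc N k B _ m N0 B0 mh ah.
  have Mb0 : 0 < M `^ b^-1 by rewrite powR_gt0.
  have := markov_tail (measurable_scaled_abs J N m 1 (near k)) (fun w => powR_ge0 _ _) Mb0 h.
  move=> hk; apply: (@le_trans _ _ (P [set w | M `^ b^-1 < scaled_abs J N m 1 (near k) w])).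
    apply: le_measure; rewrite ?inE//; first by apply: gt_meas; exact: measurable_scaled_abs.
    move=> w /= Mw; rewrite /scaled_abs powRr1 ?mulr_ge0 ?powR_ge0//.
    have -> : N%:R `^ m * `|J (near k) w| = (near_power alpha J L N B hu m b k w) `^ b^-1.
      by rewrite /near_power /scaled_abs -powRrM mulfV ?gt_eqF// powRr1 ?mulr_ge0 ?powR_ge0.
    by apply: gt0_ltr_powR; rewrite ?invr_gt0 ?nnegrE ?(ltW M0) ?powR_ge0.
  apply: (le_trans hk); rewrite lee_fin ler_wpM2l//.
  by rewrite /M pM pV; apply: ple; move: bi; forget; lra.
have PF k : k \in A -> (P (F k) <= (Cc * x `^ (- (26 / 10)))%:E)%E.
  move=> kA; have [mh ah] := hv k kA; have [_ _ h] := Hc N k B _ m N0 B0 mh ah.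
  have := markov_tail (measurable_scaled_abs J N m 1 (far k)) (fun w => powR_ge0 _ _) tau0 h.
  move=> hk; apply: (le_trans hk); rewrite lee_fin -mulrA ler_wpM2l//.
  apply: (@le_trans _ _ ((x `^ (3 / 10)) `^ (- (1 * (L%:R - 1))) / tau)).
    apply: ler_wpM2r; first by rewrite invr_ge0 ltW.
    by apply: powRN_antitone => //; move: L10; forget; lra.
  by rewrite /tau pM pV pD; apply: ple; move: L10; forget; lra.
pose bad := D `|` (\big[setU/set0]_(k in A) E k `|` \big[setU/set0]_(k in A) F k).
have cE0 : 0 <= Cc * x `^ (- (64 / 25)) by rewrite mulr_ge0// ltW.
have cF0 : 0 <= Cc * x `^ (- (26 / 10)) by rewrite mulr_ge0// ltW.
have [mUE PUE] := union_bound mE cE0 PE.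
have [mUF PUF] := union_bound mF cF0 PF.
have mUEF : measurable (\big[setU/set0]_(k in A) E k `|` \big[setU/set0]_(k in A) F k).
  exact: measurableU.
have q0 : 0 < x `^ (- (3 / 2)) by [].
exists bad; first split.
- exact: measurableU.
- apply: (@le_trans _ _ ((CD * x `^ (- (3 / 2)))%:E + ((Cc * x `^ (- (3 / 2)))%:E + (Cc * x `^ (- (3 / 2)))%:E))%E).
    apply: (le_trans (measureU2 _ mD mUEF)); apply: leeD => //.
    apply: (le_trans (measureU2 _ mUE mUF)); apply: leeD.
      apply: (le_trans PUE); rewrite lee_fin mulrCA ler_wpM2l//.
      apply: (@le_trans _ _ (x * x `^ (- (64 / 25)))); first by rewrite ler_wpM2r// ltW.
      by rewrite {1}px pD; apply: ple; forget; lra.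
    apply: (le_trans PUF); rewrite lee_fin mulrCA ler_wpM2l//.
    apply: (@le_trans _ _ (x * x `^ (- (26 / 10)))); first by rewrite ler_wpM2r// ltW.
    by rewrite {1}px pD; apply: ple; forget; lra.
  by rewrite -!EFinD lee_fin -xE -!mulrDl ler_wpM2r ?(ltW q0)//; move: Cf0; forget; lra.
have hsum : {ae P, forall w, forall k : 'I_n, k \in A -> J (frozen_kernel alpha L N k (hu k)) w =
    J (near k) w + J (far k) w}.
  have : {ae P, forall w, forall k : nat, (exists2 i : 'I_n, i \in A & k = i) ->
     J (frozen_kernel alpha L N k (hu k)) w = J (near k) w + J (far k) w}.
    apply: ae_foralln => k; have [[i iA ->]|nk] := pselect (exists2 i : 'I_n, i \in A & k = i).
      have [_ ah] := hv i iA; apply: filterS (frozen_near_far_ae i HJ al1 L2 N0 B0 ah) => w h _.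
      exact: h.
    by apply: aeW => w h; case: nk.
  by apply: filterS => w h k kA; apply: h; exists k.
have C20 : 0 <= Ca * B%:R `^ (- (b * (L%:R - 1))) by rewrite mulr_ge0// powR_ge0.
have b1 : 0 < b <= 1 by apply/andP; split; move: b0 b4; forget; lra.
apply: filterS hsum => w hw nbad.
have nD : ~ D w by move=> ?; apply: nbad; left.
have nE k : k \in A -> ~ E k w.
  by move=> kA Ek; apply: nbad; right; left; rewrite (bigD1 k)//=; left.
have nF k : k \in A -> ~ F k w.
  by move=> kA Ek; apply: nbad; right; right; rewrite (bigD1 k)//=; left.
apply: (le_trans (@deviation_on_good_event _ _ _ P alpha J L N n B A hu m b M (t * (B + L)%:R) tau (Ca + Cb) _ w
   b1 M0 (ltW tau0) (addr_ge0 Ca0 Cb0) C20 hw _ _ _ _ _ _ _ _)).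
- by move=> k kA; have [_ ah] := hv k kA; exact: (frozen_near_far_ae k HJ al1 L2 N0 B0 ah).
- move=> k kA; have [mh ah] := hv k kA; have [h _ _] := Ha N k B _ m N0 B0 mh ah.
  by apply: (le_trans h); rewrite lee_fin lerDl.
- move=> k kA; have [mh ah] := hv k kA; have [_ h _] := Ha N k B _ m N0 B0 mh ah.
  by apply: (le_trans h); rewrite lee_fin lerDl.
- by move=> k kA; apply: (le_trans (m2near k kA)); rewrite lee_fin lerDr.
- by move=> k kA; have [mh ah] := hv k kA; have [_ _ h] := Ha N k B _ m N0 B0 mh ah.
- by rewrite leNgt; apply/negP.
- by move=> k kA; rewrite leNgt; apply/negP; exact: nE.
- by move=> k kA; rewrite leNgt; apply/negP; exact: nF.
rewrite -xE; set y := x `^ (1 - b / 10).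
have y0 : 0 < y by exact: p0.
have s1 : t * (B + L)%:R <= (2 + L%:R) * y.
  apply: (@le_trans _ _ (t * ((2 + L%:R) * x `^ (3 / 10)))); first by rewrite ler_wpM2l// ltW.
  rewrite mulrCA ler_wpM2l ?addr_ge0// /t pD; apply: ple; move: b4; forget; lra.
have s2 : n%:R * tau `^ b <= y.
  apply: (@le_trans _ _ (x * tau `^ b)); first by rewrite ler_wpM2r// powR_ge0.
  by rewrite /tau pM {1}px pD; apply: ple; forget; lra.
have s3 : n%:R * ((Ca + Cb) / M) <= (Ca + Cb) * y.
  rewrite mulrCA ler_wpM2l ?addr_ge0//.
  apply: (@le_trans _ _ (x / M)); first by rewrite ler_wpM2r// invr_ge0 ltW.
  by rewrite /M pV {1}px pD; apply: ple; move: b4; forget; lra.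
have s4 : n%:R * (Ca * B%:R `^ (- (b * (L%:R - 1)))) <= Ca * y.
  rewrite mulrCA ler_wpM2l//.
  apply: (@le_trans _ _ (x * (x `^ (3 / 10)) `^ (- (b * (L%:R - 1))))).
    apply: ler_pM; rewrite ?powR_ge0//; apply: powRN_antitone => //; move: bL; forget; lra.
  rewrite pM {1}px pD; apply: ple; move: bL b4; forget; lra.
have : 0 <= (CD + Cc + Cc) * y by rewrite mulr_ge0// ltW.
rewrite /Cf; move: s1 s2 s3 s4; rewrite !mulrDr !mulrDl; forget; lra.
Qed.

(** Borel-Cantelli applied to [frozen_bad_event]. *)
Lemma frozen_variation_concentration (b m h2 : R) (n : nat -> nat) (A : forall N, {set 'I_(n N)})
    (hu : nat -> nat -> R) : is_SaS_integral alpha Z J -> 1 < alpha < 2 ->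
  0 < b <= 4^-1 -> 2 / b + 1 < L%:R -> alpha^-1 < m -> h2 < 1 ->
  (forall N, (0 < N)%N -> (n N <= N)%N) ->
  (forall N (k : 'I_(n N)), k \in A N -> m <= hu N k <= h2) ->
  exists2 C : R, 0 <= C & {ae P, forall w, exists N0, forall N, (N0 <= N)%N ->
    `|\sum_(k in A N) (scaled_abs J N m b (frozen_kernel alpha L N k (hu N k)) w
         - \int[P]_w' scaled_abs J N m b (frozen_kernel alpha L N k (hu N k)) w')|
      <= C * N%:R `^ (1 - b / 10)}.
Proof.
move=> HJ al hb Lb hm h21 hn hhu.
have [C C0 HC] := frozen_bad_event HJ al hb Lb hm h21; exists C => //.
have ex N : exists bad : set T, [/\ measurable bad,
    ((0 < N)%N -> (P bad <= (C * N%:R `^ (- (3 / 2)))%:E)%E) &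
    (0 < N)%N -> {ae P, forall w, ~ bad w ->
      `|\sum_(k in A N) (scaled_abs J N m b (frozen_kernel alpha L N k (hu N k)) w
         - \int[P]_w' scaled_abs J N m b (frozen_kernel alpha L N k (hu N k)) w')|
      <= C * N%:R `^ (1 - b / 10)}].
  have [->|N0] := posnP N; first by exists set0.
  have [bad [h1 h2'] h3] := HC N (n N) (A N) (hu N) N0 (hn N N0) (hhu N).
  by exists bad.
have [F HF] := choice ex.
have mF N : measurable (F N) by have [] := HF N.
have PF N : (0 < N)%N -> (P (F N) <= (C * N%:R `^ (- (3 / 2)))%:E)%E by have [] := HF N.
have h := borel_cantelli_eventually mF PF.
have g : {ae P, forall w, forall N, (0 < N)%N -> ~ F N w ->
      `|\sum_(k in A N) (scaled_abs J N m b (frozen_kernel alpha L N k (hu N k)) w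
         - \int[P]_w' scaled_abs J N m b (frozen_kernel alpha L N k (hu N k)) w')|
      <= C * N%:R `^ (1 - b / 10)}.
  apply: ae_foralln => N; have [->|N0] := posnP N; first by apply: aeW.
  by have [_ _ h3] := HF N; apply: filterS (h3 N0) => w hw _.
apply: filterS2 h g => w [N0 hN0] hw; exists N0.+1 => N hN.
by apply: hw; [exact: leq_ltn_trans hN|apply: hN0; exact: ltnW].
Qed.

End BadEvent.

(** * From frozen to actual increments *)

Section Increments.
Context (R : realType) (d : measure_display) (T : measurableType d) (P : probability T R).
Context (alpha : R) (Z : set R -> {RV P >-> R}) (J : (R -> R) -> {RV P >-> R}).
Context (X : R -> R -> {RV P >-> R}) (L : nat).

Ltac forget := clear - R d T P alpha Z J X L.

(** The scale parameter of the integral of [psi] at v, to the power b. *)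
Definition psi_scale (b v : R) : R := fine (alpha_mass alpha (psi alpha L v)) `^ (b / alpha).

Lemma frozen_mean (b : R) : is_SaS_integral alpha Z J -> 1 < alpha -> (2 <= L)%N -> 0 < b < 1 ->
  exists2 M : R, 0 < M & forall (N k : nat) (m v : R), (0 < N)%N -> alpha^-1 < v < 1 ->
    (\int[P]_w scaled_abs J N m b (frozen_kernel alpha L N k v) w)%R
      = M * (N%:R `^ (b * (m - v)) * psi_scale b v).
Proof.
move=> HJ al1 L2 /andP[b0 b1]; have al0 : 0 < alpha by lra.
have ba : 0 < b < alpha by apply/andP; split; lra.
have [M M0 HM] := integral_moment_eq HJ ba b1.
exists M => // N k m v N0 hv; have N0' : 0 < N%:R :> R by rewrite ltr0n.
have mpsi := measurable_psi alpha L v.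
have mE := scaled_mass k v al1 N0 mpsi.
have mf : measurable_fun [set: R] (frozen_kernel alpha L N k v) by exact: measurable_scaled.
have fin : (alpha_mass alpha (frozen_kernel alpha L N k v) < +oo)%E.
  rewrite mE; apply: lte_mul_pinfty; rewrite ?lee_fin ?powR_ge0//.
  exact: psi_mass_fin.
have h := HM _ mf fin.
rewrite /Rintegral.
have E w : (scaled_abs J N m b (frozen_kernel alpha L N k v) w)%:E =
    ((N%:R `^ (m * b))%:E * (`|J (frozen_kernel alpha L N k v) w| `^ b)%:E)%E.
  by rewrite /scaled_abs powRM ?powR_ge0// -powRrM.
under eq_integral do rewrite E.
rewrite ge0_integralZl_EFin ?powR_ge0//; last first.
  apply/measurable_EFinP; apply: (measurableT_comp (measurable_powR b)).
  exact: measurableT_comp.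
have pfin : alpha_mass alpha (psi alpha L v) \is a fin_num.
  by rewrite ge0_fin_numE; [exact: psi_mass_fin|exact: alpha_mass_ge0].
have Efin : fine (alpha_mass alpha (frozen_kernel alpha L N k v)) =
    N%:R `^ (- (alpha * v)) * fine (alpha_mass alpha (psi alpha L v)).
  by rewrite mE fineM.
rewrite h -EFinM/= Efin.
rewrite /= powRM ?powR_ge0 ?fine_ge0 ?alpha_mass_ge0// -powRrM.
rewrite mulrCA; congr (M * _); rewrite [LHS]mulrA; congr (_ * _).
rewrite -powRD ?(gt_eqF N0') ?implybT//; congr (_ `^ _); field.
by rewrite gt_eqF.
Qed.

(** The increment of the field with second argument v is the integral of the combined
    kernel, by linearity. *)
Lemma frozen_increment_ae (N k : nat) (v : R) : is_SaS_integral alpha Z J -> is_lmsm_field alpha J X ->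
  1 < alpha -> (0 < N)%N -> (0 < L)%N -> (k + L <= N)%N -> alpha^-1 < v < 1 ->
  {ae P, forall w, \sum_(l < L.+1) filter_coef R L l * X ((k + l)%N%:R / N%:R) v w
    = J (frozen_kernel alpha L N k v) w}.
Proof.
move=> HJ HX al1 N0 L0 kN hv; have N0' : 0 < N%:R :> R by rewrite ltr0n.
have hu (l : 'I_L.+1) : 0 <= ((k + l)%N%:R / N%:R : R) <= 1.
  rewrite divr_ge0//= ler_pdivrMr// mul1r ler_nat; apply: leq_trans kN.
  by rewrite leq_add2l -ltnS.
have h1 : {ae P, forall w, forall l : nat, (l < L.+1)%N ->
    X ((k + l)%N%:R / N%:R) v w = J (lmsm_kernel alpha ((k + l)%N%:R / N%:R) v) w}.
  apply: ae_foralln => l; have [lL|lL] := ltnP l L.+1; last by apply: aeW.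
  have hd : field_domain alpha ((k + l)%N%:R / N%:R, v).
    by split; rewrite /= in_itv//=; exact: (hu (Ordinal lL)).
  by apply: filterS (field_version HX hd) => w.
have h2 := integral_lincomb HJ al1 (fun l : 'I_L.+1 => filter_coef R L l)
  (fun l => lmsm_kernel_Lfun al1 hv (hu l)).
apply: filterS2 h1 h2 => w e1.
rewrite (_ : (fun s => _) = frozen_kernel alpha L N k v); last first.
  by apply/funext => s; exact: frozen_kernel_sum.
by move=> ->; apply: eq_bigr => l _; rewrite e1.
Qed.

(** The error of freezing, K N^(-rho) with a random K, contributes (N^m K N^(-rho))^b to each
    power, by subadditivity. *)
Lemma increment_concentration (b m h1 h2 cH rho : R) (H : R -> R) (I : set R) :
  is_SaS_integral alpha Z J -> is_lmsm_field alpha J X -> 1 < alpha < 2 ->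
  0 < b <= 4^-1 -> 2 / b + 1 < L%:R -> alpha^-1 < h1 -> h2 < 1 ->
  (forall t, 0 <= t <= 1 -> h1 <= H t <= h2) ->
  (forall t1 t2, 0 <= t1 <= 1 -> 0 <= t2 <= 1 -> `|H t1 - H t2| <= cH * `|t1 - t2| `^ rho) ->
  m < rho -> alpha^-1 < m -> (forall t, I t -> 0 <= t <= 1 /\ m <= H t) ->
  exists2 M : R, 0 < M & exists2 e : R, 0 < e & {ae P, forall w, exists2 C : R, 0 <= C &
    exists N0, forall N, (N0 <= N)%N ->
    `|\sum_(k in nu L N I) ((N%:R `^ m * `|gen_increment L (fun t => lmsm X H t w) N k|) `^ b
        - M * (N%:R `^ (b * (m - H (k%:R / N%:R))) * psi_scale b (H (k%:R / N%:R))))|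
      <= C * N%:R `^ (1 - e)}.
Proof.
move=> HJ HX al hb Lb hh1 hh2 Hr Hh mrho hm hI.
have /andP[al1 al2] := al; have /andP[b0 b4] := hb.
have i0 : 0 < alpha^-1 by rewrite invr_gt0; lra.
have bi : 4 <= b^-1 by rewrite -[leLHS]invrK lef_pV2 ?posrE ?invr_gt0.
have L2 : (2 <= L)%N by rewrite -(ler_nat R); lra.
have L0 : (0 < L)%N by exact: ltnW.
have b01 : 0 < b < 1 by apply/andP; split; lra.
have b01' : 0 < b <= 1 by apply/andP; split; lra.
have [M M0 HM] := frozen_mean HJ al1 L2 b01.
pose n N := (N - L).+1.
have hn N : (0 < N)%N -> (n N <= N)%N.
  by move=> N0; rewrite /n -[X in (_ <= X)%N](prednK N0) ltnS -subn1 leq_sub2l.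
pose hu N k := H (k%:R / N%:R).
have hA N (k : 'I_(n N)) : k \in nu L N I -> 0 <= (k%:R / N%:R : R) <= 1 /\ m <= hu N k.
  by rewrite inE => /set_mem /hI.
have hv N (k : 'I_(n N)) : k \in nu L N I -> m <= hu N k <= h2.
  by move=> /hA[/Hr/andP[? ?] ?]; apply/andP.
have [C0 C00 hC0] := frozen_variation_concentration HJ al hb Lb hm hh2 hn hv.
pose g2 := (h2 + 1) / 2.
have h12 : h1 <= h2 by have /andP[] := Hr 0 ltac:(by rewrite lexx ler01); exact: le_trans.
have g12 : h1 < g2 by rewrite /g2; move: h12 hh2; forget; lra.
have g21 : g2 < 1 by rewrite /g2; move: hh2; forget; lra.
have Hg t : 0 <= t <= 1 -> h1 <= H t <= g2.
  by move=> /Hr /andP[-> /=]; rewrite /g2; lra.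
have hlip := field_lipschitz HJ HX al hh1 g12 g21.
pose e := Num.min (b / 10) (b * (rho - m)).
have e0 : 0 < e.
  have b10 : 0 < b / 10 by move: b0; forget; lra.
  have br : 0 < b * (rho - m) by rewrite mulr_gt0// subr_gt0.
  by rewrite /e lt_min b10.
have e1 : e <= b / 10 by rewrite /e ge_min lexx.
have e2 : e <= b * (rho - m) by rewrite /e ge_min lexx orbT.
have hfr : {ae P, forall w, forall N k : nat, (L <= N)%N -> (k < (N - L).+1)%N -> alpha^-1 < hu N k < 1 ->
    \sum_(l < L.+1) filter_coef R L l * X ((k + l)%N%:R / N%:R) (hu N k) w
    = J (frozen_kernel alpha L N k (hu N k)) w}.
  apply: ae_foralln => N; apply: ae_foralln => k.
  have [LN|LN] := leqP L N; last by apply: aeW.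
  have [kN|kN] := ltnP k (N - L).+1; last by apply: aeW.
  have [hh|hh] := boolP (alpha^-1 < hu N k < 1); last by apply: aeW.
  apply: filterS (frozen_increment_ae HJ HX al1 (leq_trans L0 LN) L0 _ hh) => [w h _ _ _|].
    exact: h.
  by rewrite -(subnK LN) leq_add2r -ltnS.
exists M => //; exists e => //.
apply: filterS3 hC0 hlip hfr => w [N0 HN0] [Cl Cl0 Hl] hf.
have rho0 : 0 < rho by move: mrho hm i0; forget; lra.
pose K := \sum_(l < L.+1) `|filter_coef R L l| * (Cl * (`|cH| * L%:R `^ rho)).
have K0 : 0 <= K by apply: sumr_ge0 => l _; rewrite !mulr_ge0 ?powR_ge0.
exists (C0 + K `^ b); first by rewrite addr_ge0// powR_ge0.
exists (maxn N0 L) => N; rewrite geq_max => /andP[N0N LN].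
have Np : (0 < N)%N by exact: leq_trans LN.
have [x xE] : exists x : R, x = N%:R by exists N%:R.
have x1 : 1 <= x by rewrite xE ler1n.
have x0 : 0 < x by move: x1; forget; lra.
have hk (k : 'I_(n N)) : k \in nu L N I ->
    `|gen_increment L (fun t => lmsm X H t w) N k - J (frozen_kernel alpha L N k (hu N k)) w| <= K * x `^ (- rho).
  move=> kA; have [ht mh] := hA N k kA; have /andP[v1 v2] := hv N k kA.
  rewrite -hf//; last by apply/andP; split; move: v1 v2 hm hh2; forget; lra.
  rewrite /gen_increment -sumrB; apply: (le_trans (ler_norm_sum _ _ _)).
  rewrite /K mulr_suml; apply: ler_sum => l _.
  rewrite -mulrBr normrM -mulrA ler_wpM2l// /lmsm.
  have hul : 0 <= ((k + l)%N%:R / N%:R : R) <= 1.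
    rewrite divr_ge0//= ler_pdivrMr ?ltr0n// mul1r ler_nat.
    have kk : (k <= N - L)%N by rewrite -ltnS.
    apply: (@leq_trans (N - L + L)); last by rewrite subnK.
    by apply: leq_add => //; rewrite -ltnS.
  apply: (le_trans (Hl _ _ _ hul (Hg _ hul) (Hg _ ht))).
  rewrite -mulrA ler_wpM2l//.
  apply: (le_trans (Hh _ _ hul ht)).
  apply: (@le_trans _ _ (`|cH| * `|(k + l)%N%:R / N%:R - k%:R / N%:R| `^ rho)).
    by rewrite ler_wpM2r ?powR_ge0// ler_norm.
  rewrite -mulrA ler_wpM2l// -mulrBl natrD addrAC subrr add0r.
  rewrite ger0_norm ?divr_ge0// -xE.
  have -> : L%:R `^ rho * x `^ (- rho) = (L%:R / x) `^ rho.
    by rewrite powRM ?invr_ge0 ?(ltW x0)// -(powR_inv1 (ltW x0)) -powRrM mulN1r.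
  apply: ge0_ler_powR; rewrite ?nnegrE ?(ltW rho0) ?divr_ge0 ?(ltW x0)//.
  by rewrite ler_wpM2r ?invr_ge0 ?(ltW x0)// ler_nat -ltnS.
have hk2 (k : 'I_(n N)) : k \in nu L N I ->
    `|(N%:R `^ m * `|gen_increment L (fun t => lmsm X H t w) N k|) `^ b
      - scaled_abs J N m b (frozen_kernel alpha L N k (hu N k)) w| <= K `^ b * x `^ (- e).
  move=> kA; rewrite /scaled_abs.
  apply: (le_trans (normr_powR_sub_le _ _ b01')); rewrite ?mulr_ge0 ?powR_ge0//.
  apply: (@le_trans _ _ ((x `^ m * (K * x `^ (- rho))) `^ b)).
    apply: ge0_ler_powR; rewrite ?nnegrE ?(ltW b0) ?mulr_ge0 ?powR_ge0//.
    rewrite -mulrBr normrM ger0_norm ?powR_ge0// -xE ler_wpM2l ?powR_ge0//.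
    exact: le_trans (ler_dist_dist _ _) (hk k kA).
  rewrite mulrCA powRM ?mulr_ge0 ?powR_ge0// ler_wpM2l ?powR_ge0//.
  rewrite -powRD ?(gt_eqF x0) ?implybT// -powRrM; apply: ler_powR => //.
  by move: e2; forget; lra.
rewrite (_ : \sum_(k in nu L N I) _ =
   \sum_(k in nu L N I) ((N%:R `^ m * `|gen_increment L (fun t => lmsm X H t w) N k|) `^ b
      - scaled_abs J N m b (frozen_kernel alpha L N k (hu N k)) w) +
   \sum_(k in nu L N I) (scaled_abs J N m b (frozen_kernel alpha L N k (hu N k)) w
         - \int[P]_w' scaled_abs J N m b (frozen_kernel alpha L N k (hu N k)) w')); last first.
  rewrite -big_split/=; apply: eq_bigr => k kA; rewrite addrA subrK; congr (_ - _).
  by rewrite (HM N k m)//; have /andP[q1 q2] := hv N k kA; apply/andP; split; move: q1 q2 hm hh2; forget; lra.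
apply: (le_trans (ler_normD _ _)); rewrite addrC mulrDl; apply: lerD.
  apply: (le_trans (HN0 N N0N)); rewrite -xE ler_wpM2l//; apply: ler_powR => //.
  by move: e1; forget; lra.
apply: (le_trans (ler_norm_sum _ _ _)).
apply: (@le_trans _ _ (\sum_(k in nu L N I) K `^ b * x `^ (- e))); first exact: ler_sum.
rewrite sumr_const -(mulr_natl _ #|_|) -xE.
apply: (@le_trans _ _ (x * (K `^ b * x `^ (- e)))).
  apply: ler_wpM2r; first by rewrite mulr_ge0 ?powR_ge0.
  rewrite xE ler_nat; apply: leq_trans (hn N Np).
  by rewrite -[X in (_ <= X)%N](card_ord (n N)); exact: max_card.
rewrite mulrCA ler_wpM2l ?powR_ge0// -{1}(powRr1 (ltW x0)) -powRD ?(gt_eqF x0) ?implybT//.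
Qed.

End Increments.

(** * Pairing the indices at scales N and 2N *)

Section PairedSums.
Context (R : realType).
Implicit Types (a c : R) (L N k : nat).

(** The condition of belonging to nu L N [a, c], on natural numbers, so that sums for
    different N can be compared. *)
Definition in_window L a c N k : bool := (k <= N - L)%N && (a <= k%:R / N%:R <= c).

Definition window_sum L a c N (f : nat -> R) : R :=
  \sum_(0 <= k < N.+1) (if in_window L a c N k then f k else 0).

Lemma nu_sum L a c N (f : nat -> R) :
  \sum_(k in nu L N `[a, c]) f k = window_sum L a c N f.
Proof.
rewrite /window_sum (@big_cat_nat _ _ _ (N - L).+1)//=; last by rewrite ltnS leq_subr.
rewrite [X in _ + X]big_nat_cond [X in _ + X]big1 ?addr0; last first.
  by move=> k /andP[/andP[h _] _]; rewrite /in_window leqNgt h.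
rewrite big_mkord big_mkcond/=; apply: eq_bigr => k _.
rewrite /in_window inE -ltnS ltn_ord/= mem_setE in_itv/=.
by [].
Qed.

Lemma sum_even_odd (f : nat -> R) n :
  \sum_(0 <= j < n.*2) f j = \sum_(0 <= k < n) (f k.*2 + f k.*2.+1).
Proof.
elim: n => [|n IH]; first by rewrite !big_geq.
by rewrite doubleS !big_nat_recr//= IH addrA.
Qed.

Lemma sum_indic_le (p : pred nat) (k0 n : nat) (S : R) : 0 <= S -> (forall k, p k -> k = k0) ->
  \sum_(0 <= k < n) (if p k then S else 0) <= S.
Proof.
move=> S0 hp; apply: (@le_trans _ _ (\sum_(0 <= k < n) (if k == k0 then S else 0))).
  by apply: ler_sum => k _; case: ifP => [/hp ->|_]; rewrite ?eqxx//; case: ifP.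
elim: n => [|n IH]; first by rewrite big_geq.
have [nk|nk] := eqVneq n k0; last by rewrite big_nat_recr//= (negbTE nk) addr0.
rewrite big_nat_recr//= nk eqxx big_nat_cond big1 ?add0r// => i /andP[/andP[_ i0] _].
by rewrite ltn_eqF.
Qed.

Lemma sum_tail_le (L N : nat) (S : R) : 0 <= S ->
  \sum_(0 <= k < N.+1) (if (N - L < k)%N then S else 0) <= L%:R * S.
Proof.
move=> S0; rewrite (@big_cat_nat _ _ _ (N - L).+1)//=; last by rewrite ltnS leq_subr.
rewrite big_nat_cond big1 ?add0r; last first.
  by move=> k /andP[/andP[_ h] _]; rewrite ltnNge -ltnS h.
apply: (@le_trans _ _ (\sum_((N - L).+1 <= k < N.+1) S)).
  by apply: ler_sum => k _; case: ifP.
rewrite sumr_const_nat -(mulr_natl S) ler_wpM2r// ler_nat subSS.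
by rewrite leq_subLR addnC -leq_subLR.
Qed.

Lemma trunc_unique (x : R) (k : nat) : k%:R <= x -> x < k%:R + 1 -> k = Num.trunc x.
Proof.
move=> h1 h2; apply/esym/eqP; rewrite truncn_eq; last exact: le_trans h1.
by rewrite h1 -natr1.
Qed.

(** The indices 2k and 2k + 1 at scale 2N are compared with the index k at scale N. The
    pairing fails only for one k at each end of [a, c] and for the L indices
    k > N - L, hence the term (2 L + 3) S. *)
Lemma paired_window_sums L a c N (F h E : nat -> R) (S : R) : (0 < L)%N -> (L <= N)%N -> 0 <= S ->
  0 <= a ->
  (forall j, in_window L a c (2 * N) j -> 0 <= F j <= S) ->
  (forall k, in_window L a c N k -> 0 <= h k <= S) ->
  (forall k, in_window L a c N k -> 0 <= E k) ->
  (forall k, in_window L a c N k -> `|F k.*2 - h k| <= E k) ->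
  (forall k, in_window L a c N k -> in_window L a c (2 * N) k.*2.+1 -> `|F k.*2.+1 - h k| <= E k) ->
  `|window_sum L a c (2 * N) F - 2 * window_sum L a c N h|
    <= 2 * window_sum L a c N E + (2 * L%:R + 3) * S.
Proof.
move=> L0 LN S0 a0 hF hh hE h1 h2.
have N0 : (0 < N)%N by exact: leq_trans LN.
have N0' : 0 < N%:R :> R by rewrite ltr0n.
have -> : window_sum L a c (2 * N) F =
   \sum_(0 <= k < N.+1) ((if in_window L a c (2 * N) k.*2 then F k.*2 else 0) +
     (if in_window L a c (2 * N) k.*2.+1 then F k.*2.+1 else 0)).
  rewrite -(sum_even_odd (fun j => if in_window L a c (2 * N) j then F j else 0)).
  rewrite doubleS big_nat_recr//= -mul2n ifF ?addr0//.
  apply/negbTE; rewrite /in_window negb_and -ltnNge ltnS.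
  by rewrite leq_subr.
rewrite /window_sum !mulr_sumr -sumrB.
(* Ac: the last k of the window, whose partner 2k + 1 may fall beyond c;
   Bc: the k just before the window, whose partner 2k + 1 may fall in it. *)
pose Ac (k : nat) := (k%:R <= c * N%:R) && (c * N%:R < k%:R + 2^-1).
pose Bc (k : nat) := (k%:R < a * N%:R) && (a * N%:R <= k%:R + 2^-1).
have key (k : nat) : `|(if in_window L a c (2 * N) k.*2 then F k.*2 else 0) +
     (if in_window L a c (2 * N) k.*2.+1 then F k.*2.+1 else 0)
     - 2 * (if in_window L a c N k then h k else 0)| <=
   2 * (if in_window L a c N k then E k else 0) + ((if (N - L < k)%N then 2 * S else 0)
     + ((if Ac k then S else 0) + (if Bc k then 2 * S else 0))).
  have e2 : k.*2%:R / (2 * N)%:R = k%:R / N%:R :> R.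
    by rewrite -muln2 !natrM; field; rewrite gt_eqF.
  have e3 : k.*2.+1%:R / (2 * N)%:R = (k%:R + 2^-1) / N%:R :> R.
    by rewrite -natr1 -muln2 !natrM; field; rewrite gt_eqF.
  have p1 : 0 <= (if (N - L < k)%N then 2 * S else 0) by case: ifP => // _; rewrite mulr_ge0.
  have p2 : 0 <= (if Ac k then S else 0) by case: ifP.
  have p3 : 0 <= (if Bc k then 2 * S else 0) by case: ifP => // _; rewrite mulr_ge0.
  have [wk|wk] := boolP (in_window L a c N k).
    have /andP[kN /andP[ka kc]] := wk.
    have w2 : in_window L a c (2 * N) k.*2.
      rewrite /in_window e2 ka kc !andbT -mul2n.
      apply: (@leq_trans (2 * (N - L))); first by rewrite leq_mul2l.
      by rewrite mulnBr leq_sub2l// leq_pmull.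
    rewrite w2; have d1 := h1 k wk; have e0 := hE k wk.
    have [w3|w3] := boolP (in_window L a c (2 * N) k.*2.+1).
      have d2 := h2 k wk w3.
      have := ler_normD (F k.*2 - h k) (F k.*2.+1 - h k).
      rewrite (_ : F k.*2 - h k + (F k.*2.+1 - h k) = F k.*2 + F k.*2.+1 - 2 * h k); last by ring.
      by move: d1 d2 p1 p2 p3; lra.
    have AcT : Ac k.
      apply: contraR w3 => nA; rewrite /in_window e3; apply/andP; split.
        apply: (@leq_trans (2 * (N - L)).+1); first by rewrite ltnS -mul2n leq_mul2l.
        rewrite mulnBr; apply: ltn_sub2l; last exact: ltn_Pmull.
        by apply: leq_ltn_trans LN _; exact: ltn_Pmull.
      rewrite ler_pdivlMr// ler_pdivrMr//.
      move: ka kc; rewrite ler_pdivlMr// ler_pdivrMr// => ka kc.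
      move: nA; rewrite /Ac kc/= -leNgt => nA.
      by apply/andP; split; lra.
    rewrite AcT addr0; have := hh k wk => /andP[q1 q2].
    have := ler_normB (F k.*2 - h k) (h k); rewrite (ger0_norm q1).
    rewrite (_ : F k.*2 - h k - h k = F k.*2 - 2 * h k); last by ring.
    by move: d1 p1 p3; lra.
  rewrite !mulr0 subr0 add0r.
  have Fle j : 0 <= (if in_window L a c (2 * N) j then F j else 0) <= S.
    by case: ifP => [/hF//|_]; rewrite lexx S0.
  have /andP[f1 f2] := Fle k.*2; have /andP[f3 f4] := Fle k.*2.+1.
  rewrite ger0_norm ?addr_ge0//.
  have [kN|kN] := leqP k (N - L); last by move: p2 p3; lra.
  have {}wk : ~~ (a <= k%:R / N%:R <= c) by move: wk; rewrite /in_window kN.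
  have -> : (in_window L a c (2 * N) k.*2) = false.
    by rewrite /in_window e2 (negbTE wk) andbF.
  rewrite add0r.
  have [w3|w3] := boolP (in_window L a c (2 * N) k.*2.+1); last by move: p2 p3; lra.
  have BcT : Bc k.
    move: w3 wk; rewrite /in_window e3 => /andP[_ /andP[]].
    rewrite ler_pdivlMr// ler_pdivrMr// => u1 u2.
    rewrite ler_pdivlMr// ler_pdivrMr// negb_and -!ltNge => /orP[u3|u3].
      by rewrite /Bc u3 u1.
    by exfalso; lra.
  by have /hF/andP[g1 g2] := w3; rewrite BcT; move: p2; lra.
apply: (le_trans (ler_norm_sum _ _ _)).
apply: (le_trans (ler_sum _ (fun k _ => key k))).
rewrite !big_split/=.
have s1 := @sum_tail_le L N (2 * S) (mulr_ge0 (ler0n _ 2) S0).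
have s2 : \sum_(0 <= k < N.+1) (if Ac k then S else 0) <= S.
  apply: (sum_indic_le (k0 := Num.trunc (c * N%:R))) => // k /andP[u1 u2].
  by apply: trunc_unique => //; lra.
have s3 : \sum_(0 <= k < N.+1) (if Bc k then 2 * S else 0) <= 2 * S.
  apply: (sum_indic_le (k0 := Num.trunc (a * N%:R))); first by rewrite mulr_ge0.
  by move=> k /andP[u1 u2]; apply: trunc_unique; lra.
by move: s1 s2 s3; lra.
Qed.

End PairedSums.

(** * Sums over a window and asymptotic comparisons *)

Section WindowBounds.
Context (R : realType).
Implicit Types (a c : R) (L N k : nat).

Lemma le_window_sum L a c N (f g : nat -> R) :
  (forall k, in_window L a c N k -> f k <= g k) -> window_sum L a c N f <= window_sum L a c N g.
Proof. by move=> h; apply: ler_sum => k _; case: ifP => // /h. Qed.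

Lemma window_sumD L a c N (f g : nat -> R) :
  window_sum L a c N (fun k => f k + g k) = window_sum L a c N f + window_sum L a c N g.
Proof.
by rewrite /window_sum -big_split/=; apply: eq_bigr => k _; case: ifP; rewrite ?addr0.
Qed.

Lemma window_sumZ L a c N (z : R) (f : nat -> R) :
  window_sum L a c N (fun k => z * f k) = z * window_sum L a c N f.
Proof.
by rewrite /window_sum mulr_sumr; apply: eq_bigr => k _; case: ifP; rewrite ?mulr0.
Qed.

Lemma window_sum_const_le L a c N (z : R) : (0 < L)%N -> (0 < N)%N -> 0 <= z ->
  window_sum L a c N (fun=> z) <= N%:R * z.
Proof.
move=> L0 N0 z0; rewrite -nu_sum sumr_const -(mulr_natl z) ler_wpM2r// ler_nat.
apply: (@leq_trans (N - L).+1).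
  by rewrite -[X in (_ <= X)%N](card_ord (N - L).+1); exact: max_card.
by rewrite -[X in (_ <= X)%N](prednK N0) ltnS -subn1 leq_sub2l.
Qed.

(** An interval of length r in [a, c] contains at least r N - 1 multiples of 1/N; up to L + 1 of
    them are given up because of the constraint k <= N - L. *)
Lemma window_sum_lower L a c N (f : nat -> R) (u r f0 : R) :
  0 <= a -> a <= u -> u + r <= c -> c <= 1 -> 0 <= r -> (0 < N)%N -> 0 <= f0 ->
  (forall k, in_window L a c N k -> 0 <= f k) ->
  (forall k, in_window L a c N k -> u <= k%:R / N%:R <= u + r -> f0 <= f k) ->
  (r * N%:R - (L%:R + 2)) * f0 <= window_sum L a c N f.
Proof.
move=> a0 au urc c1 r0 N0 f00 hf hf0; have N0' : 0 < N%:R :> R by rewrite ltr0n.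
(* The indices k0, ..., k0 + q - 1 lie in the window, and k / N in [u, u + r]. *)
pose k0 := (Num.trunc (u * N%:R)).+1; pose q := (Num.trunc (r * N%:R) - L.+1)%N.
have uN0 : 0 <= u * N%:R by rewrite mulr_ge0// (le_trans a0).
have rN0 : 0 <= r * N%:R by rewrite mulr_ge0.
have k0l : u * N%:R < k0%:R by exact: truncnS_gt.
have k0u : k0%:R <= u * N%:R + 1.
  by rewrite /k0 -natr1 lerD2r truncn_le.
have ru : r * N%:R < (Num.trunc (r * N%:R))%:R + 1 by rewrite natr1; exact: truncnS_gt.
have rl : (Num.trunc (r * N%:R))%:R <= r * N%:R by rewrite truncn_le.
have ql : r * N%:R - (L%:R + 2) <= q%:R.
  have : (Num.trunc (r * N%:R) <= q + L.+1)%N by rewrite /q; case: (leqP L.+1 (Num.trunc (r * N%:R))) => [h|/ltnW h];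
    [rewrite subnK|apply: leq_trans h _; exact: leq_addl].
  by rewrite -(ler_nat R) natrD -natr1; move: ru; lra.
have sum0 i j : 0 <= \sum_(i <= k < j) (if in_window L a c N k then f k else 0).
  by apply: sumr_ge0 => k _; case: ifP => // /hf.
apply: (@le_trans _ _ (q%:R * f0)); first exact: ler_wpM2r.
have [q0|q0] := posnP q; first by rewrite q0 mul0r; exact: sum0.
have qu : q%:R <= r * N%:R - L%:R - 1.
  have : (q + L.+1 = Num.trunc (r * N%:R))%N by rewrite /q subnK//; move: q0; rewrite /q subn_gt0 => /ltnW.
  by move=> h; move: rl; rewrite -h natrD -natr1; lra.
have kub k : (k < k0 + q)%N -> k%:R <= (u + r) * N%:R - L%:R.
  move=> h; have : k.+1%:R <= (k0 + q)%:R :> R by rewrite ler_nat.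
  by rewrite natrD -natr1 mulrDl; move: k0u qu; lra.
have urN : (u + r) * N%:R <= N%:R.
  by rewrite -[leRHS]mul1r ler_wpM2r//; apply: le_trans c1.
have kNL k : (k < k0 + q)%N -> (k + L <= N)%N.
  move=> /kub h; rewrite -(ler_nat R) natrD; move: urN; lra.
have kN : (k0 + q <= N.+1)%N.
  have := kNL (k0 + q).-1; rewrite prednK ?addn_gt0 ?q0 ?orbT// leqnn => /(_ isT) h.
  by rewrite -(@prednK (k0 + q)) ?addn_gt0 ?q0 ?orbT// ltnS (leq_trans _ h)// leq_addr.
rewrite /window_sum (@big_cat_nat _ _ _ k0)//=; last exact: leq_trans (leq_addr _ _) kN.
rewrite (@big_cat_nat _ _ _ (k0 + q) k0)//= ?leq_addr//.
rewrite -[leLHS]add0r; apply: lerD; first exact: sum0.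
rewrite -[leLHS]addr0; apply: lerD; last exact: sum0.
apply: (@le_trans _ _ (\sum_(k0 <= k < k0 + q) f0)).
  by rewrite sumr_const_nat addKn -(mulr_natl f0).
apply: ler_sum_nat => k /andP[kk0 kq].
have h1 : u <= k%:R / N%:R <= u + r.
  rewrite ler_pdivlMr// ler_pdivrMr//; apply/andP; split.
    by apply: (le_trans (ltW k0l)); rewrite ler_nat.
  have := kub k kq; have : 0 <= L%:R :> R by []; lra.
have h2 : in_window L a c N k.
  rewrite /in_window; apply/andP; split; last first.
    by move/andP: h1 => [u1 u2]; rewrite (le_trans au u1) (le_trans u2 urc).
  by rewrite leq_subRL ?(leq_trans (leq_addl k L) (kNL k kq))// addnC; exact: kNL.
by rewrite h2; exact: hf0.
Qed.

End WindowBounds.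

Section Asymptotics.
Context (R : realType).

Lemma ln_nat_eventually (A : R) : exists N0 : nat, forall N, (N0 <= N)%N -> A <= ln (N%:R : R).
Proof.
exists (Num.trunc (expR A)).+1 => N hN.
have h : expR A < N%:R.
  by apply: (lt_le_trans (truncnS_gt _)); rewrite ler_nat.
by rewrite -[leLHS]expRK ler_ln ?posrE ?expR_gt0 ?(lt_trans (expR_gt0 A))// ltW.
Qed.

Lemma ln_le_powR (x e : R) : 1 <= x -> 0 < e -> ln x <= e^-1 * x `^ e.
Proof.
move=> x1 e0; have x0 : 0 < x by lra.
rewrite ler_pdivlMl// -ln_powR.
have p0 : 0 < x `^ e by rewrite powR_gt0.
have := expR_ge1Dx (ln (x `^ e)); rewrite lnK ?posrE//; lra.
Qed.

(** From exp(y) >= (1 + y / 3)^3 with y = ln x. *)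
Lemma cube_le_exp (x : R) : 1 <= x -> 0 < ln x -> 1 <= 27 * (x / ln x ^+ 3).
Proof.
move=> x1 l0; have x0 : 0 < x by lra.
rewrite mulrA ler_pdivlMr ?exprn_gt0// mul1r.
have -> : ln x ^+ 3 = 27 * (ln x / 3) ^+ 3 by field.
rewrite ler_wpM2l//.
have e : x = expR (ln x / 3) ^+ 3.
  by rewrite -expRM_natl mulrC mulfVK// lnK.
rewrite [leRHS]e; apply: lerXn2r; rewrite ?nnegrE ?expR_ge0 ?divr_ge0 ?(ltW l0)//.
by apply: le_trans (expR_ge1Dx _); rewrite lerDr.
Qed.

(** Any power of x beats ln(x)^4; the comparison quantity x / (ln x)^3 is the common unit of
    all error terms. *)
Lemma power_saving (e : R) : 0 < e -> exists2 C : R, 0 <= C & forall x, 1 <= x -> 1 <= ln x ->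
  x `^ (1 - e) * ln x <= C * (x / ln x ^+ 3).
Proof.
move=> e0; exists ((e / 4)^-1 ^+ 4); first by rewrite exprn_ge0// invr_ge0 divr_ge0// ltW.
move=> x x1 l1; have x0 : 0 < x by lra.
have l0 : 0 < ln x by lra.
rewrite mulrA ler_pdivlMr ?exprn_gt0// -mulrA -exprS.
have h := ln_le_powR x1 (divr_gt0 e0 (ltr0n _ 4)).
apply: (@le_trans _ _ (x `^ (1 - e) * ((e / 4)^-1 * x `^ (e / 4)) ^+ 4)).
  rewrite ler_wpM2l ?powR_ge0//; apply: lerXn2r; rewrite ?nnegrE ?(ltW l0)//.
  exact: le_trans (ltW l0) h.
rewrite exprMn mulrCA ler_wpM2l ?exprn_ge0 ?invr_ge0 ?divr_ge0 ?(ltW e0)//.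
rewrite -powR_mulrn ?powR_ge0// -powRrM -powRD ?(gt_eqF x0) ?implybT//.
rewrite -[leRHS](powRr1 (ltW x0)) le_eqVlt; apply/orP; left; apply/eqP.
by congr (_ `^ _); field.
Qed.

Lemma ratio_bound (n n2 g d d2 A : R) : 0 < n -> 0 < g -> 0 <= A <= 1 ->
  `|n2 - 2 * n| <= A * n -> `|d - g| <= A * g -> `|d2 - 2 * g| <= A * g ->
  `|n2 / n * (d / d2) - 1| <= 5 * A.
Proof.
move=> n0 g0 /andP[A0 A1] h1 h2 h3.
have Ag : A * g <= g by rewrite -[leRHS]mul1r ler_wpM2r// ltW.
have d20 : g <= d2 by move: h3; rewrite ler_norml; lra.
have d2p : 0 < d2 by lra.
have E : n2 / n * (d / d2) - 1 = (n2 * d - n * d2) / (n * d2) by field; rewrite !gt_eqF.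
rewrite E normrM normfV (gtr0_norm (mulr_gt0 n0 d2p)) ler_pdivrMr ?mulr_gt0//.
have nd : n2 * d - n * d2 = (n2 - 2 * n) * d + 2 * n * (d - g) - n * (d2 - 2 * g) by ring.
rewrite nd.
have dg : `|d| <= 2 * g.
  have := ler_normD (d - g) g; rewrite subrK (gtr0_norm g0); lra.
apply: (@le_trans _ _ (A * n * (2 * g) + 2 * n * (A * g) + n * (A * g))).
  apply: (le_trans (ler_normB _ _)); apply: lerD; last first.
    by rewrite normrM (gtr0_norm n0) ler_wpM2l// ltW.
  apply: (le_trans (ler_normD _ _)); apply: lerD.
    by rewrite normrM; apply: ler_pM.
  by rewrite normrM gtr0_norm ?mulr_gt0// ler_wpM2l// mulr_ge0// ltW.
rewrite (_ : _ + _ = 5 * A * (n * g)); last by ring.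
by rewrite ler_wpM2l ?mulr_ge0// ler_wpM2l// ltW.
Qed.

Lemma one_sub_expR_le (y : R) : 1 - expR (- y) <= y.
Proof. by have := expR_ge1Dx (- y); lra. Qed.

Lemma expR_lip (y z : R) : y <= 0 -> z <= 0 -> `|expR y - expR z| <= `|y - z|.
Proof.
move=> y0 z0; wlog yz : y z y0 z0 / z <= y.
  move=> W; have [|/ltW] := leP z y; first exact: W.
  by rewrite distrC (distrC y); exact: W.
rewrite !ger0_norm ?subr_ge0 ?ler_expR//.
have -> : expR y - expR z = expR y * (1 - expR (- (y - z))).
  by rewrite mulrBr mulr1 -expRD; congr (_ - expR _); ring.
have e1 : expR y <= 1 by rewrite -expR0 ler_expR.
have := one_sub_expR_le (y - z); have := expR_ge0 y.
have : 0 <= 1 - expR (- (y - z)) by rewrite subr_ge0 -expR0 ler_expR; lra.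
nra.
Qed.

End Asymptotics.

(** * The mean variation at scales N and 2N *)

Section MeanVariation.
Context (R : realType) (b a c m cH rho smin S Cs kap t0 : R) (L : nat) (H s : R -> R).
Context (L0 : (0 < L)%N) (hb : 0 < b <= 4^-1) (a0 : 0 <= a) (ac : a < c) (c1 : c <= 1).
Context (Hm : forall t, a <= t <= c -> m <= H t <= m + 1) (ht0 : a <= t0 <= c) (Ht0 : H t0 = m).
Context (cH0 : 0 <= cH) (hrho : 2^-1 <= rho)
  (Hh : forall t t', a <= t <= c -> a <= t' <= c -> `|H t - H t'| <= cH * `|t - t'| `^ rho).
Context (smin0 : 0 < smin) (hs : forall t, a <= t <= c -> smin <= s (H t) <= S).
Context (Cs0 : 0 <= Cs) (hkap : 0 < kap <= 1)
  (sh : forall t t', a <= t <= c -> a <= t' <= c -> `|s (H t) - s (H t')| <= Cs * `|H t - H t'| `^ kap).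

(** The contribution of the point t to the mean of the variation, multiplied by N^(b m), with
    y = ln N: since m is the minimum of H, the exponent is nonpositive. *)
Definition gain_at (y t : R) : R := expR (b * (m - H t) * y) * s (H t).
Definition gain (N k : nat) : R := gain_at (ln N%:R) (k%:R / N%:R).
Definition mean_sum (N : nat) : R := window_sum L a c N (gain N).

Let S0 : 0 <= S.
Proof. by have /andP[h1 h2] := hs ht0; rewrite (le_trans _ (le_trans h1 h2))// ltW. Qed.

Lemma gain_exponent t y : a <= t <= c -> 0 <= y -> b * (m - H t) * y <= 0.
Proof.
move=> /Hm /andP[h1 h2] y0; have /andP[b0 _] := hb.
by rewrite mulr_le0_ge0// mulr_ge0_le0 ?(ltW b0)// subr_le0.
Qed.

Lemma gain_bounds t y : a <= t <= c -> 0 <= y -> 0 <= gain_at y t <= S.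
Proof.
move=> ht y0; have /andP[s1 s2] := hs ht.
have sp : 0 <= s (H t) by apply: le_trans s1; apply: ltW; exact: smin0.
rewrite /gain_at mulr_ge0 ?expR_ge0//=; apply: le_trans s2.
rewrite -[leRHS]mul1r ler_wpM2r// -expR0 ler_expR; exact: gain_exponent.
Qed.

(** Passing from N to 2N multiplies the contribution by 2^(b(m - H t)), which differs from 1 by at
    most H t - m. *)
Lemma gain_double t y : a <= t <= c -> 0 <= y ->
  `|gain_at (ln 2 + y) t - gain_at y t| <= gain_at y t * (H t - m).
Proof.
move=> ht y0; have /andP[g0 _] := gain_bounds ht y0; have /andP[m1 _] := Hm ht.
have /andP[b0 b4] := hb.
have l20 : 0 <= ln 2 :> R by rewrite ln_ge0// ler1n.
have l21 : ln 2 <= 1 :> R.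
  by have := @le_ln1Dx R 1; rewrite (_ : 1 + 1 = 2)//; apply; lra.
pose z := b * (H t - m) * ln 2.
have z0 : 0 <= z by rewrite /z !mulr_ge0// ?(ltW b0)// subr_ge0.
have -> : gain_at (ln 2 + y) t - gain_at y t = - (gain_at y t * (1 - expR (- z))).
  rewrite /gain_at mulrDr expRD (_ : b * (m - H t) * ln 2 = - z); last by rewrite /z; ring.
  by ring.
rewrite normrN normrM (ger0_norm g0) ler_wpM2l// ger0_norm; last first.
  by rewrite subr_ge0 -expR0 ler_expR; lra.
apply: (le_trans (one_sub_expR_le z)); rewrite /z -[leRHS]mul1r mulrAC ler_wpM2r ?subr_ge0//.
by nra.
Qed.

(** The factor s is Hoelder in H, and the exponential is 1-Lipschitz on the negative
    half-line. *)
Lemma gain_neighbour t t' y z : a <= t <= c -> a <= t' <= c -> 0 <= y -> 0 <= z ->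
  `|H t - H t'| <= z ->
  `|gain_at y t - gain_at y t'| <= Cs * z `^ kap + S * y * z.
Proof.
move=> ht ht' y0 z0 hz; have /andP[b0 b4] := hb; have /andP[k0 _] := hkap.
have -> : gain_at y t - gain_at y t' = expR (b * (m - H t) * y) * (s (H t) - s (H t'))
    + s (H t') * (expR (b * (m - H t) * y) - expR (b * (m - H t') * y)) by rewrite /gain_at; ring.
apply: (le_trans (ler_normD _ _)); rewrite !normrM; apply: lerD.
  apply: (@le_trans _ _ (1 * (Cs * `|H t - H t'| `^ kap))).
    apply: ler_pM => //; last exact: sh.
    rewrite ger0_norm ?expR_ge0// -expR0 ler_expR; exact: gain_exponent.
  by rewrite mul1r ler_wpM2l//; apply: ge0_ler_powR; rewrite ?nnegrE ?(ltW k0).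
have /andP[s1 s2] := hs ht'.
rewrite -[leRHS]mulrA; apply: ler_pM => //.
  by rewrite ger0_norm// (le_trans _ s1)// ltW.
apply: (le_trans (expR_lip (gain_exponent ht y0) (gain_exponent ht' y0))).
have -> : b * (m - H t) * y - b * (m - H t') * y = (b * y) * (H t' - H t) by ring.
rewrite normrM ger0_norm ?mulr_ge0 ?(ltW b0)// distrC.
apply: ler_pM => //; first by rewrite mulr_ge0// ltW.
by rewrite -[leRHS]mul1r ler_wpM2r//; lra.
Qed.

(** Either H t - m is at most (3 / b) ln y / y, or the exponential is at most y^(-3). *)
Lemma gain_excess t y : a <= t <= c -> 1 <= y -> 
  gain_at y t * (H t - m) <= (3 / b) * (ln y / y) * gain_at y t + S * y ^- 3.
Proof.
move=> ht y1; have y0 : 0 < y by lra.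
have /andP[g0 _] := gain_bounds ht (ltW y0); have /andP[m1 m2] := Hm ht.
have /andP[b0 b4] := hb; have /andP[s1 s2] := hs ht.
have ly : 0 <= ln y by rewrite ln_ge0.
have [h|h] := leP (H t - m) ((3 / b) * (ln y / y)).
  apply: (@le_trans _ _ (gain_at y t * ((3 / b) * (ln y / y)))); first by rewrite ler_wpM2l.
  by rewrite mulrC lerDl mulr_ge0// invr_ge0 exprn_ge0// ltW.
apply: (@le_trans _ _ (S * y ^- 3)); last first.
  by rewrite lerDr mulr_ge0// mulr_ge0 ?divr_ge0 ?(ltW b0) ?(ltW y0).
rewrite -[leRHS]mulr1; apply: ler_pM => //; first by rewrite subr_ge0.
  rewrite mulrC; apply: ler_pM => //; rewrite ?expR_ge0 ?(le_trans (ltW smin0) s1)//.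
  have -> : y ^- 3 = expR (- (3 * ln y)).
    by rewrite expRN mulrC expRM_natr lnK.
  rewrite ler_expR; have : 3 / b * (ln y / y) * (b * y) <= (H t - m) * (b * y).
    by rewrite ler_wpM2r ?mulr_ge0 ?(ltW b0) ?(ltW y0)// ltW.
  have -> : 3 / b * (ln y / y) * (b * y) = 3 * ln y.
    by field; rewrite !gt_eqF.
  lra.
by lra.
Qed.

Lemma window_in N k : in_window L a c N k -> a <= k%:R / N%:R <= c.
Proof. by move=> /andP[]. Qed.

(** On an interval of length r = (ln N)^(-2) around the minimum, H - m is at most
    cH r^rho <= cH / ln N because rho >= 1/2, so that the contributions are bounded below by
    exp(-b cH) smin. *)
Lemma mean_sum_lower N : (0 < N)%N -> 1 <= ln (N%:R : R) -> 54 * (L%:R + 2) <= ln (N%:R : R) ->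
  2 / (c - a) <= ln (N%:R : R) ->
  expR (- (b * cH)) * smin / 2 * (ln N%:R * (N%:R / ln N%:R ^+ 3)) <= mean_sum N.
Proof.
move=> N0; set x := N%:R; set l := ln x => l1 l2 l3.
have l0 : 0 < l by lra.
have /andP[b0 b4] := hb; have cH0' := cH0; have ac' := ac.
have x1 : 1 <= x by rewrite /x ler1n.
have ca : 0 < c - a by rewrite subr_gt0.
pose r := l ^- 2.
have r0 : 0 <= r by rewrite invr_ge0 exprn_ge0// ltW.
have rl : r <= l^-1.
  by rewrite /r lef_pV2 ?posrE ?exprn_gt0// expr2 ler_peMr// ltW.
have r2 : r <= (c - a) / 2.
  by apply: (le_trans rl); rewrite -[leRHS]invrK lef_pV2 ?posrE ?invr_gt0 ?divr_gt0// invf_div.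
have [u [u1 u2 u3]] : exists u, [/\ a <= u, u + r <= c &
    forall t, u <= t <= u + r -> `|t - t0| <= r].
  have /andP[ta tc] := ht0; have [h|h] := leP (t0 + r) c.
    exists t0; split => // t /andP[? ?]; rewrite ger0_norm; lra.
  exists (t0 - r); split; [lra|lra|move=> t /andP[? ?]].
  rewrite ler0_norm; lra.
pose f0 := expR (- (b * cH)) * smin.
have f00 : 0 <= f0 by rewrite /f0 mulr_ge0 ?expR_ge0// ltW.
have low : (r * x - (L%:R + 2)) * f0 <= mean_sum N.
  apply: (window_sum_lower a0 u1 u2 c1 r0 N0 f00).
    by move=> k /window_in hk; have /andP[] := gain_bounds hk (ltW l0).
  move=> k /window_in hk hu; rewrite /gain /gain_at -/x -/l /f0.
  have /andP[s1 _] := hs hk.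
  apply: ler_pM => //; rewrite ?expR_ge0 ?(ltW smin0)// ler_expR.
  set t := _ / _ in hk hu *.
  have hH : H t - m <= cH * l^-1.
    have := Hh hk ht0; rewrite Ht0 => /(le_trans (ler_norm _)) /le_trans; apply.
    rewrite ler_wpM2l//; apply: (@le_trans _ _ (r `^ rho)).
      apply: ge0_ler_powR; rewrite ?nnegrE//; first by have := hrho; lra.
      exact: u3.
    apply: (@le_trans _ _ (r `^ 2^-1)).
      apply: ger_powR => //; rewrite lt_neqAle eq_sym /r invr_eq0 expf_neq0 ?gt_eqF//=.
      by rewrite -/r r0 (le_trans rl)// invf_le1.
    have -> : r = l^-1 ^+ 2 by rewrite exprVn.
    by rewrite powR12_sqrt ?sqr_ge0// sqrtr_sqr ger0_norm// invr_ge0 ltW.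
  have : (H t - m) * l <= cH.
    by rewrite -ler_pdivlMr.
  nra.
have xl : l * (x / l ^+ 3) = r * x by rewrite /r; field; rewrite gt_eqF.
rewrite xl; apply: le_trans low.
have Q1 := cube_le_exp x1 l0; rewrite -/l in Q1.
have : 2 * (L%:R + 2) <= r * x.
  rewrite -xl; move: l2 Q1; move: (x / l ^+ 3) => Q l2 Q1.
  have L0' : 0 <= L%:R :> R by [].
  have : 54 * (L%:R + 2) * Q <= l * Q by rewrite ler_wpM2r//; lra.
  nra.
rewrite -/f0; move: f00 (r * x); move: f0 => z z0 w hw; nra.
Qed.

(** Apply [paired_window_sums] with the error (H - m) times the contribution from doubling, plus
    the cost of moving from 2k to 2k + 1. *)
Lemma mean_sum_double N : (0 < N)%N -> (L <= N)%N -> 1 <= ln (N%:R : R) -> 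
  `|mean_sum (2 * N) - 2 * mean_sum N| <=
    2 * ((3 / b) * (ln (ln N%:R) / ln N%:R) * mean_sum N + N%:R * (S * (ln N%:R) ^- 3)
      + N%:R * ((Cs * cH `^ kap + 2 * S * cH) * N%:R `^ (- (rho * kap)) * ln N%:R))
    + (2 * L%:R + 3) * S.
Proof.
move=> N0 LN l1; set x := N%:R; set l := ln x; rewrite -/x -/l in l1.
have l0 : 0 < l by lra.
have x1 : 1 <= x by rewrite /x ler1n.
have x0 : 0 < x by lra.
have cH0' := cH0; have hrho' := hrho; have /andP[k0 k1] := hkap.
pose D := (Cs * cH `^ kap + 2 * S * cH) * x `^ (- (rho * kap)) * l.
have D0 : 0 <= D.
  apply: mulr_ge0; last exact: ltW.
  by apply: mulr_ge0; rewrite ?powR_ge0// addr_ge0 ?mulr_ge0 ?powR_ge0.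
have l2 : ln (2 * N)%:R = ln 2 + l :> R by rewrite natrM lnM ?posrE.
have l20 : 0 <= ln 2 :> R by rewrite ln_ge0// ler1n.
have l21 : ln 2 <= 1 :> R.
  by have := @le_ln1Dx R 1; rewrite (_ : 1 + 1 = 2)//; apply; lra.
have y2 : 0 <= ln 2 + l by lra.
pose E k := gain N k * (H (k%:R / N%:R) - m) + D.
have e2 k : k.*2%:R / (2 * N)%:R = k%:R / N%:R :> R.
  by rewrite -muln2 !natrM; field; rewrite gt_eqF.
have dbl k : in_window L a c N k -> `|gain (2 * N) k.*2 - gain N k| <= gain N k * (H (k%:R / N%:R) - m).
  by move=> /window_in hk; rewrite /gain e2 l2; exact: gain_double (ltW l0).
have nb k : in_window L a c N k -> in_window L a c (2 * N) k.*2.+1 ->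
    `|gain (2 * N) k.*2.+1 - gain (2 * N) k.*2| <= D.
  move=> /window_in hk /window_in hk'; rewrite /gain e2 l2.
  have hz : `|H (k.*2.+1%:R / (2 * N)%:R) - H (k%:R / N%:R)| <= cH * x `^ (- rho).
    apply: (le_trans (Hh hk' hk)); rewrite ler_wpM2l//.
    rewrite powRN -(powR_inv1 (powR_ge0 _ _)) -powRrM mulrN1 -[leRHS]mul1r.
    have -> : x `^ (- rho) = (x^-1) `^ rho by rewrite -(powR_inv1 (ltW x0)) -powRrM mulN1r.
    rewrite mul1r; apply: ge0_ler_powR; rewrite ?nnegrE ?invr_ge0 ?(ltW x0)//; first lra.
    have -> : k.*2.+1%:R / (2 * N)%:R - k%:R / N%:R = 2^-1 * x^-1 :> R.
      by rewrite -natr1 -muln2 !natrM; field; rewrite gt_eqF.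
    have xi : 0 < x^-1 by rewrite invr_gt0.
    by rewrite ger0_norm; lra.
  have z0 : 0 <= cH * x `^ (- rho) by rewrite mulr_ge0// powR_ge0.
  apply: (le_trans (gain_neighbour hk' hk y2 z0 hz)).
  have DE : D = Cs * (cH `^ kap * (x `^ (- (rho * kap)) * l)) + S * (2 * l) * (cH * x `^ (- (rho * kap))).
    by rewrite /D; ring.
  rewrite powRM ?powR_ge0// -powRrM mulNr DE; apply: lerD.
    by rewrite ler_wpM2l// ler_wpM2l ?powR_ge0// ler_peMr ?powR_ge0.
  have h1 : x `^ (- rho) <= x `^ (- (rho * kap)).
    by apply: ler_powR => //; nra.
  apply: ler_pM; rewrite ?mulr_ge0 ?powR_ge0//; last by rewrite ler_wpM2l.
  by rewrite ler_wpM2l//; lra.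
have h := @paired_window_sums R L a c N (gain (2 * N)) (gain N) E S L0 LN S0 a0.
have {h} : `|mean_sum (2 * N) - 2 * mean_sum N| <= 2 * window_sum L a c N E + (2 * L%:R + 3) * S.
  apply: h.
  - by move=> j /window_in hj; rewrite /gain l2; exact: gain_bounds.
  - by move=> j /window_in hj; exact: (gain_bounds hj (ltW l0)).
  - move=> k /window_in hk; rewrite /E addr_ge0// mulr_ge0//.
      by have /andP[] := gain_bounds hk (ltW l0).
    by rewrite subr_ge0; have /andP[] := Hm hk.
  - by move=> k wk; apply: (le_trans (dbl k wk)); rewrite /E lerDl.
  - move=> k wk wk'; have := nb k wk wk'; have := dbl k wk; rewrite /E.
    have := ler_normD (gain (2 * N) k.*2.+1 - gain (2 * N) k.*2) (gain (2 * N) k.*2 - gain N k).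
    by rewrite addrA subrK; move: (gain N k * _) => z; lra.
move=> /le_trans; apply; rewrite lerD2r ler_wpM2l//.
rewrite /E window_sumD; apply: lerD; last first.
  by apply: window_sum_const_le.
apply: (@le_trans _ _ (window_sum L a c N (fun k => (3 / b) * (ln l / l) * gain N k + S * l ^- 3))).
  by apply: le_window_sum => k /window_in hk; exact: gain_excess.
rewrite window_sumD (window_sumZ L a c N (3 / b * (ln l / l)) (gain N)); apply: lerD; first exact: lexx.
apply: window_sum_const_le => //.
by rewrite mulr_ge0// invr_ge0 exprn_ge0// ltW.
Qed.

Ltac forget := clear - R b a c m cH rho smin S Cs kap t0 L H s L0 hb a0 ac c1 Hm ht0 Ht0
  cH0 hrho Hh smin0 hs Cs0 hkap sh S0.

(** All errors are at most a constant times x / (ln x)^3, while the sum of the means is at least a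
    constant times x / (ln x)^2; the quotient 1 / ln x is at most ln(ln x) / ln x as soon as
    ln x >= e. *)
Lemma variation_ratio (M e C : R) (N0 : nat) (D : nat -> R) : 0 < M -> 0 < e -> 0 <= C ->
  (forall N, (N0 <= N)%N -> `|D N - M * mean_sum N| <= C * N%:R `^ (1 - e)) ->
  exists2 K : R, 0 <= K & exists N1 : nat, forall N, (N1 <= N)%N ->
    `|window_sum L a c (2 * N) (fun=> 1) / window_sum L a c N (fun=> 1) * (D N / D (2 * N)%N) - 1|
      <= K * (ln (ln N%:R) / ln N%:R).
Proof.
move=> M0 e0 C0 hD; have /andP[b0 b4] := hb; have /andP[k0 k1] := hkap.
have hrho' := hrho; have smin0' := smin0; have a0' := a0.
have ca : 0 < c - a by rewrite subr_gt0.
have rk0 : 0 < rho * kap by rewrite mulr_gt0//; lra.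
have [Cd Cd0 Hd] := power_saving rk0.
have [Ce Ce0 He] := power_saving e0.
have [c3 [c3E c30]] : exists c3 : R, c3 = Cs * cH `^ kap + 2 * S * cH /\ 0 <= c3.
  by eexists; split; first reflexivity; rewrite addr_ge0 ?mulr_ge0 ?powR_ge0.
have [c2 [c2E c20]] : exists c2 : R, c2 = expR (- (b * cH)) * smin / 2 /\ 0 < c2.
  by eexists; split; first reflexivity; rewrite divr_gt0 ?mulr_gt0 ?expR_gt0.
have [l0 [l0E l00]] : exists l0 : R, l0 = L%:R /\ 0 <= l0 by exists L%:R.
have h230 : 0 <= 2 * l0 + 3 by lra.
have [B2 [B2E B20]] : exists B2 : R, B2 = 2 * S + 2 * c3 * Cd + 27 * (2 * l0 + 3) * S /\ 0 <= B2.
  eexists; split; first reflexivity.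
  by rewrite !addr_ge0 ?mulr_ge0 ?addr_ge0 ?mulr_ge0.
have [A2 [A2E A20]] : exists A2 : R, A2 = 6 / b + B2 / c2 /\ 0 <= A2.
  eexists; split; first reflexivity.
  by rewrite addr_ge0 ?divr_ge0 ?(ltW b0) ?(ltW c20).
have [A1 [A1E A10]] : exists A1 : R, A1 = C * Ce / (M * c2) /\ 0 <= A1.
  eexists; split; first reflexivity.
  by rewrite divr_ge0 ?mulr_ge0 ?(ltW M0) ?(ltW c20).
have [A4 [A4E A40]] : exists A4 : R, A4 = 54 * (2 * l0 + 3) / (c - a) /\ 0 <= A4.
  eexists; split; first reflexivity.
  by rewrite divr_ge0 ?(ltW ca)// mulr_ge0.
have [A [AE A0]] : exists A : R, A = 3 * A1 + A2 + A4 /\ 0 <= A.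
  by eexists; split; first reflexivity; lra.
have A1A : A1 <= A by move: A10 A20 A40 AE; forget; lra.
have A4A : A4 <= A by move: A10 A20 A40 AE; forget; lra.
(* The threshold on ln N collects what the steps below need; the last term makes
   A ln(ln N) / ln N at most 1. *)
have [N2 HN2] := ln_nat_eventually (expR 1 + 54 * (l0 + 2) + 2 * (l0 + 2) / (c - a) + (2 * A) ^+ 2).
exists (5 * A); first by rewrite mulr_ge0.
exists (maxn (maxn N0 N2) 1) => N; rewrite !geq_max => /andP[/andP[NN0 NN2] Np].
have x1 : 1 <= N%:R :> R by rewrite ler1n.
have x0 : 0 < N%:R :> R by lra.
have hl := HN2 N NN2.
have e1 : 1 <= expR 1 :> R by rewrite -[leLHS]expR0 ler_expR.
have q0 : 0 <= 2 * (l0 + 2) / (c - a).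
  by rewrite divr_ge0 ?(ltW ca)// mulr_ge0//; lra.
have q1 : 0 <= (2 * A) ^+ 2 by rewrite sqr_ge0.
have [l [lE [l1 l2 l3 l4 l5]]] : exists l : R, l = ln N%:R /\ [/\ expR 1 <= l, 54 * (l0 + 2) <= l,
    2 * (l0 + 2) / (c - a) <= l, (2 * A) ^+ 2 <= l & l + 1 <= N%:R].
  exists (ln N%:R); split => //; split; try by move: hl q0 q1 e1 l00; forget; lra.
  by have := expR_ge1Dx (ln (N%:R : R)); rewrite lnK ?posrE//; lra.
have ll1 : 1 <= ln l by rewrite -[leLHS](@expRK R 1) ler_ln ?posrE ?expR_gt0//; move: l1 e1; forget; lra.
have lp : 0 < l by move: l1 e1; forget; lra.
have l1' : 1 <= ln (N%:R : R) by rewrite -lE (le_trans e1).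
have LN : (L <= N)%N by rewrite -(ler_nat R) -l0E; move: l2 l5 l00; forget; lra.
have l3' : 2 / (c - a) <= ln (N%:R : R).
  rewrite -lE; apply: le_trans l3; rewrite ler_wpM2r ?invr_ge0 ?(ltW ca)//; move: l00; forget; lra.
rewrite -lE.
have [eta [etaE eta0 eta1]] : exists eta : R, [/\ eta = ln l / l, 0 <= eta & 1 <= eta * l].
  exists (ln l / l); split => //; first by rewrite divr_ge0 ?(ltW lp)// (le_trans ler01).
  by rewrite mulfVK ?gt_eqF.
have [Q [QE Q0 Q27 Ql]] : exists Q : R, [/\ Q = N%:R / l ^+ 3, 0 <= Q, 1 <= 27 * Q & Q <= eta * N%:R].
  exists (N%:R / l ^+ 3); split => //.
  - by rewrite divr_ge0// exprn_ge0// ltW.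
  - by rewrite lE; apply: cube_le_exp => //; rewrite -lE.
  - rewrite ler_pdivrMr ?exprn_gt0//.
    rewrite (_ : eta * N%:R * l ^+ 3 = (eta * l) * l ^+ 2 * N%:R); last by ring.
    rewrite -[leLHS]mul1r ler_wpM2r ?(ltW x0)//.
    have l2' : 1 <= l ^+ 2 by rewrite exprn_ege1// (le_trans e1).
    by move: eta1 l2'; move: (eta * l) (l ^+ 2); forget => u v; nra.
have G1 := @mean_sum_lower N Np l1' _ l3'; rewrite -lE -l0E -c2E -QE in G1.
have {}G1 := G1 l2.
have Gp : 0 < mean_sum N.
  by apply: lt_le_trans G1; rewrite mulr_gt0// mulr_gt0// QE divr_gt0 ?exprn_gt0.
have QG : Q <= c2^-1 * (eta * mean_sum N).
  rewrite ler_pdivlMl//; apply: (@le_trans _ _ (eta * (c2 * (l * Q)))); last by rewrite ler_wpM2l.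
  rewrite (_ : eta * (c2 * (l * Q)) = (eta * l) * (c2 * Q)); last by ring.
  by rewrite ler_peMl// mulr_ge0// ltW.
have G2 := mean_sum_double Np LN l1'; rewrite -lE -l0E -c3E -etaE in G2.
have p1 : N%:R * (c3 * N%:R `^ (- (rho * kap)) * l) <= c3 * (Cd * Q).
  have := Hd N%:R x1 l1'; rewrite -lE -QE => h.
  rewrite (_ : N%:R * _ = c3 * (N%:R `^ (1 - rho * kap) * l)); first by rewrite ler_wpM2l.
  rewrite powRD ?(gt_eqF x0) ?implybT// powRr1 ?(ltW x0)//; ring.
have p2 : N%:R * (S * l ^- 3) = S * Q by rewrite QE; ring.
have p3 : (2 * l0 + 3) * S <= 27 * (2 * l0 + 3) * S * Q.
  rewrite (_ : 27 * (2 * l0 + 3) * S * Q = (2 * l0 + 3) * S * (27 * Q)); last by ring.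
  by rewrite ler_peMr// mulr_ge0.
have dG : `|mean_sum (2 * N) - 2 * mean_sum N| <= A2 * eta * mean_sum N.
  apply: (le_trans G2); rewrite p2.
  apply: (@le_trans _ _ (6 / b * eta * mean_sum N + B2 * Q)).
    rewrite B2E; move: p1 p3; rewrite (_ : 6 / b * eta * mean_sum N = 2 * (3 / b * eta * mean_sum N)); last by ring.
    by move: (3 / b * eta * mean_sum N) => z; forget; lra.
  rewrite A2E !mulrDl lerD2l (_ : B2 / c2 * eta * mean_sum N = B2 * (c2^-1 * (eta * mean_sum N))); last by ring.
  by rewrite ler_wpM2l.
have pe : C / M * N%:R `^ (1 - e) <= A1 * eta * mean_sum N.
  have := He N%:R x1 l1'; rewrite -lE -QE => h.
  have h2 : N%:R `^ (1 - e) <= Ce * Q.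
    by apply: le_trans h; rewrite ler_peMr ?powR_ge0// (le_trans e1).
  apply: (@le_trans _ _ (C / M * (Ce * (c2^-1 * (eta * mean_sum N))))).
    rewrite ler_wpM2l ?divr_ge0 ?(ltW M0)//; apply: (le_trans h2).
    by rewrite ler_wpM2l.
  rewrite le_eqVlt; apply/orP; left; apply/eqP; rewrite A1E invfM; ring.
have dn n : (N0 <= n)%N -> `|D n / M - mean_sum n| <= C / M * n%:R `^ (1 - e).
  move=> /hD h; have -> : D n / M - mean_sum n = (D n - M * mean_sum n) / M.
    by field; rewrite gt_eqF.
  by rewrite normrM normfV (gtr0_norm M0) mulrAC ler_pM2r ?invr_gt0.
have d1 : `|D N / M - mean_sum N| <= A * eta * mean_sum N.
  apply: (le_trans (dn N NN0)); apply: (le_trans pe).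
  by rewrite ler_wpM2r ?(ltW Gp)// ler_wpM2r.
have d2 : `|D (2 * N)%N / M - 2 * mean_sum N| <= A * eta * mean_sum N.
  have h := dn (2 * N)%N (leq_trans NN0 (leq_pmull N (isT : (0 < 2)%N))).
  have h2 : C / M * (2 * N)%:R `^ (1 - e) <= 2 * (A1 * eta * mean_sum N).
    apply: (@le_trans _ _ (2 * (C / M * N%:R `^ (1 - e)))); last by rewrite ler_wpM2l.
    rewrite [leRHS]mulrCA ler_wpM2l ?divr_ge0 ?(ltW M0)// natrM powRM// ler_wpM2r ?powR_ge0//.
    by rewrite -[leRHS](@powRr1 _ 2)//; apply: ler_powR; [rewrite ler1n|move: e0; forget; lra].
  have := ler_normD (D (2 * N)%N / M - mean_sum (2 * N)) (mean_sum (2 * N) - 2 * mean_sum N).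
  rewrite addrA subrK => h3.
  have -> : A * eta * mean_sum N = 3 * (A1 * eta * mean_sum N) + A2 * eta * mean_sum N + A4 * eta * mean_sum N.
    by rewrite AE; ring.
  have : 0 <= A1 * eta * mean_sum N by rewrite !mulr_ge0// ltW.
  have : 0 <= A4 * eta * mean_sum N by rewrite !mulr_ge0// ltW.
  by move: h h2 dG h3; forget; lra.
pose n1 := window_sum L a c N (fun=> 1).
have n1l : (c - a) / 2 * N%:R <= n1.
  have h := @window_sum_lower R L a c N (fun=> 1) a (c - a) 1 a0 (lexx a).
  have {h} := h ltac:(by rewrite addrC subrK) c1 (ltW ca) Np ler01 (fun k _ => ler01) (fun k _ _ => lexx 1).
  rewrite -l0E mulr1; apply: le_trans.
  have : (c - a) * (2 * (l0 + 2) / (c - a)) <= (c - a) * l by rewrite ler_wpM2l// ltW.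
  rewrite mulrC mulfVK ?gt_eqF// => h.
  have this : (c - a) * l <= (c - a) * N%:R by rewrite ler_wpM2l ?(ltW ca)//; move: l5; forget; lra.
  by move: h this; forget; lra.
have n1p : 0 < n1 by apply: lt_le_trans n1l; rewrite mulr_gt0// divr_gt0.
have nn : `|window_sum L a c (2 * N) (fun=> 1) - 2 * n1| <= A * eta * n1.
  have := @paired_window_sums R L a c N (fun=> 1) (fun=> 1) (fun=> 0) 1 L0 LN ler01 a0
    (fun _ _ => ltac:(by rewrite ler01 lexx)) (fun _ _ => ltac:(by rewrite ler01 lexx))
    (fun _ _ => lexx 0) (fun _ _ => ltac:(by rewrite subrr normr0)) (fun _ _ _ => ltac:(by rewrite subrr normr0)).
  have -> : window_sum L a c N (fun=> 0) = 0 :> R by rewrite /window_sum big1// => k _; case: ifP.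
  rewrite mulr0 add0r mulr1 -l0E => /le_trans; apply.
  apply: (@le_trans _ _ (27 * (2 * l0 + 3) * (eta * N%:R))).
    apply: (@le_trans _ _ ((2 * l0 + 3) * (27 * Q))).
      by rewrite ler_peMr.
    by rewrite mulrCA mulrA ler_wpM2l// mulr_ge0.
  apply: (@le_trans _ _ (A4 * eta * n1)).
    apply: (@le_trans _ _ (A4 * eta * ((c - a) / 2 * N%:R))); last by rewrite ler_wpM2l// mulr_ge0.
    rewrite le_eqVlt; apply/orP; left; apply/eqP; rewrite A4E; field; rewrite gt_eqF//.
  by rewrite ler_wpM2r ?(ltW n1p)// ler_wpM2r.
have Aeta : A * eta <= 1.
  rewrite etaE mulrA ler_pdivrMr// mul1r.
  have h := ln_le_powR (le_trans e1 l1) (_ : 0 < 2^-1); rewrite invrK in h.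
  apply: (@le_trans _ _ (A * (2 * l `^ 2^-1))).
    by rewrite ler_wpM2l//; apply: h; rewrite invr_gt0.
  rewrite mulrA [A * 2]mulrC powR12_sqrt ?(ltW lp)//.
  rewrite -{2}(sqr_sqrtr (ltW lp)) expr2 ler_wpM2r ?sqrtr_ge0//.
  rewrite -(ger0_norm (mulr_ge0 (ler0n R 2) A0)) -sqrtr_sqr ler_sqrt ?(ltW lp)//.
have -> : D N / D (2 * N)%N = (D N / M) / (D (2 * N)%N / M).
  by rewrite invf_div mulrA mulfVK ?gt_eqF.
rewrite -etaE -[leRHS]mulrA; apply: (ratio_bound n1p Gp _ nn d1 d2).
by rewrite Aeta mulr_ge0.
Qed.

End MeanVariation.

(** * The scale function and the truncated estimator *)

Section ScaleFunction.
Context (R : realType) (d : measure_display) (T : measurableType d) (P : probability T R).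
Context (alpha : R) (Z : set R -> {RV P >-> R}) (J : (R -> R) -> {RV P >-> R}).
Context (L : nat).

Lemma psi_scale_bounds (b : R) : 1 < alpha -> (2 <= L)%N -> 0 < b ->
  exists smin S : R, 0 < smin /\ forall v, alpha^-1 < v < 1 -> smin <= psi_scale alpha L b v <= S.
Proof.
move=> al1 L2 b0; have al0 : 0 < alpha by lra.
exists ((2^-1 * 2^-1 `^ alpha) `^ (b / alpha)), (psi_mass_bound alpha L `^ (b / alpha)).
have p0 : 0 < 2^-1 `^ alpha by rewrite powR_gt0// invr_gt0.
have q0 : 0 < 2^-1 * 2^-1 `^ alpha by rewrite mulr_gt0// invr_gt0.
have e0 : 0 <= b / alpha by rewrite divr_ge0 ?(ltW b0) ?(ltW al0).
split=> [|v hv]; first exact: powR_gt0.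
have pfin : alpha_mass alpha (psi alpha L v) \is a fin_num.
  by rewrite ge0_fin_numE; [exact: psi_mass_fin|exact: alpha_mass_ge0].
have f0 : 0 <= fine (alpha_mass alpha (psi alpha L v)) by rewrite fine_ge0// alpha_mass_ge0.
have h1 : 2^-1 * 2^-1 `^ alpha <= fine (alpha_mass alpha (psi alpha L v)).
  by rewrite -lee_fin fineK//; exact: psi_mass_lower.
have h2 : fine (alpha_mass alpha (psi alpha L v)) <= psi_mass_bound alpha L.
  by rewrite -lee_fin fineK//; exact: psi_mass_le.
apply/andP; split; apply: ge0_ler_powR; rewrite ?nnegrE// ?(ltW q0)//.
exact: le_trans f0 h2.
Qed.

(** Up to a constant, the scale function is the moment of order b of the integral of [psi], and
    |E |J f|^b - E |J g|^b| <= E |J (f - g)|^b. *)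
Lemma psi_scale_hoelder (b h1 h2 : R) : is_SaS_integral alpha Z J -> 1 < alpha < 2 ->
  (5 <= L)%N -> 0 < b < 1 -> alpha^-1 < h1 -> h2 < 1 ->
  exists2 C : R, 0 <= C & forall v v', h1 <= v <= h2 -> h1 <= v' <= h2 ->
    `|psi_scale alpha L b v - psi_scale alpha L b v'| <= C * `|v - v'| `^ (b / 2).
Proof.
move=> HJ al L5 /[dup] hb /andP[b0 b1] hh1 hh2; have /andP[al1 al2] := al.
have al0 : 0 < alpha by lra.
have L2 : (2 <= L)%N by exact: leq_trans L5.
have ba : 0 < b < alpha by apply/andP; split; lra.
have [M M0 HM] := integral_moment_eq HJ ba b1.
have e0 : 0 <= b / alpha by rewrite divr_ge0 ?(ltW b0) ?(ltW al0).
have b01 : 0 < b <= 1 by rewrite b0 ltW.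
(* The maximum spares a proof that the constant is nonnegative. *)
pose K := Num.max 0 (psi_diff_const alpha L h1).
have K0 : 0 <= K by rewrite /K le_max lexx.
exists (K `^ (b / alpha)); first exact: powR_ge0.
move=> v v' hv hv'.
have hvv (u : R) : h1 <= u <= h2 -> alpha^-1 < u < 1.
  by move=> /andP[u1 u2]; rewrite (lt_le_trans hh1 u1) (le_lt_trans u2 hh2).
have mpsi := measurable_psi alpha L.
have fin u : h1 <= u <= h2 -> (alpha_mass alpha (psi alpha L u) < +oo)%E.
  by move=> hu; apply: psi_mass_fin => //; exact: hvv.
pose g x := psi alpha L v x - psi alpha L v' x.
have mg : measurable_fun [set: R] g by exact: measurable_funB.
have mass : (alpha_mass alpha g <= (K * `|v - v'| `^ (alpha / 2))%:E)%E.
  apply: (le_trans (psi_diff_mass_le al L5 hh1 hh2 hv hv')).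
  by rewrite lee_fin ler_wpM2r ?powR_ge0// /K le_max lexx orbT.
have gfin : (alpha_mass alpha g < +oo)%E by apply: le_lt_trans mass _; rewrite ltry.
pose A u w := `|J (psi alpha L u) w| `^ b.
have mA f : measurable_fun setT (fun w => `|J f w| `^ b).
  apply: (measurableT_comp (measurable_powR b)); exact: measurableT_comp.
have EA u : h1 <= u <= h2 -> (\int[P]_w A u w)%R = M * psi_scale alpha L b u.
  by move=> hu; rewrite /Rintegral (HM _ (mpsi u) (fin u hu)).
have iA u : h1 <= u <= h2 -> P.-integrable setT (EFin \o A u).
  move=> hu; apply: (@integrable_of_moment _ _ _ _ _ (M * psi_scale alpha L b u)).
  - exact: mA.
  - by move=> w; exact: powR_ge0.
  - by rewrite (HM _ (mpsi u) (fin u hu)).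
have lin : {ae P, forall w, J g w = J (psi alpha L v) w - J (psi alpha L v') w}.
  have := SaSi_linear HJ (- 1) (Lfun_alpha_mass al0 (mpsi v') (fin v' hv'))
     (Lfun_alpha_mass al0 (mpsi v) (fin v hv)).
  apply: filterS => w h; rewrite (_ : g = (fun s => - 1 * psi alpha L v' s + psi alpha L v s)).
    by rewrite h mulN1r addrC.
  by apply/funext => s; rewrite /g mulN1r addrC.
have lip : {ae P, forall w, `|A v w - A v' w| <= `|J g w| `^ b}.
  apply: filterS lin => w ->.
  apply: (le_trans (normr_powR_sub_le (normr_ge0 _) (normr_ge0 _) b01)).
  by apply: ge0_ler_powR; rewrite ?nnegrE ?(ltW b0)//; exact: ler_dist_dist.
have g0 w : 0 <= `|J g w| `^ b by exact: powR_ge0.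
have Ig : (\int[P]_w (`|J g w| `^ b)%:E <= (M * fine (alpha_mass alpha g) `^ (b / alpha))%:E)%E.
  by rewrite (HM g mg gfin).
have tr (x y x' y' k : R) : x = x' -> y = y' -> `|x - y| <= k -> `|x' - y'| <= k by move=> -> ->.
have dist := tr _ _ _ _ _ (EA v hv) (EA v' hv') (Rintegral_dist_le (iA v hv) (iA v' hv') (mA g) lip g0 Ig).
rewrite -(ler_pM2l M0) -[X in X * `|_ - _|](gtr0_norm M0) -normrM mulrBr.
apply: (le_trans dist); rewrite ler_pM2l//.
have -> : K `^ (b / alpha) * `|v - v'| `^ (b / 2) = (K * `|v - v'| `^ (alpha / 2)) `^ (b / alpha).
  rewrite powRM ?powR_ge0// -powRrM; congr (_ * _ `^ _); field; lra.
apply: (ge0_ler_powR e0); rewrite ?nnegrE ?mulr_ge0 ?powR_ge0 ?fine_ge0 ?alpha_mass_ge0//.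
by rewrite -lee_fin fineK// ge0_fin_numE// alpha_mass_ge0.
Qed.

End ScaleFunction.

Section EstimatorBounds.
Context (R : realType).

Lemma ln_lip_ge1 (u v : R) : 1 <= u -> 1 <= v -> `|ln u - ln v| <= `|u - v|.
Proof.
move=> u1 v1; wlog uv : u v u1 v1 / v <= u.
  move=> W; have [|/ltW] := leP v u; first exact: W.
  by rewrite distrC (distrC u); exact: W.
have u0 : 0 < u by lra.
have v0 : 0 < v by lra.
rewrite !ger0_norm ?subr_ge0 ?ler_ln ?posrE//.
rewrite -ln_div ?posrE//.
have -> : u / v = expR (ln (u / v)) by rewrite lnK// posrE divr_gt0.
rewrite expRK; have h := expR_ge1Dx (ln (u / v)); rewrite lnK ?posrE ?divr_gt0// in h.
have : u / v - 1 <= u - v.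
  have -> : u / v - 1 = (u - v) / v by field; rewrite gt_eqF.
  by rewrite ler_pdivrMr//; nra.
lra.
Qed.

Lemma truncation_itv (b x : R) : 0 <= b -> 2 `^ (b / 2) <= truncation b x <= 2 `^ b.
Proof.
move=> b0; rewrite /truncation ge_min lexx /= le_min le_max lexx orbT !andbT.
by apply: ler_powR; rewrite ?ler1n//; lra.
Qed.

(** Truncation is the projection onto the interval [2^(b/2), 2^b]. *)
Lemma truncation_dist (b x y : R) : 2 `^ (b / 2) <= y <= 2 `^ b -> `|truncation b x - y| <= `|x - y|.
Proof.
move=> /andP[]; rewrite /truncation; set lo := 2 `^ (b / 2); set hi := 2 `^ b => y1 y2.
have [h1|h1] := leP x lo.
  rewrite min_r; last exact: le_trans y2.
  by rewrite !ler0_norm; lra.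
have [h2|h2] := leP hi x; last by [].
by rewrite !ger0_norm; lra.
Qed.

(** Both the truncated quotient and 2^(b m) are at least 1, where the logarithm is
    1-Lipschitz. *)
Lemma estimator_error (b m x : R) : 0 < b -> 2^-1 <= m <= 1 ->
  `|b^-1 * log2 (truncation b x) - m| <= (b * ln 2)^-1 * `|x - 2 `^ (b * m)|.
Proof.
move=> b0 /andP[m1 m2].
have l2 : 0 < ln 2 :> R by rewrite ln_gt0// ltr1n.
have y1 : (2 : R) `^ (b / 2) <= 2 `^ (b * m) <= 2 `^ b.
  by apply/andP; split; apply: ler_powR; rewrite ?ler1n//; nra.
have /andP[t1 t2] := truncation_itv x (ltW b0).
have one : 1 <= 2 `^ (b / 2) :> R.
  by rewrite -[leLHS](powRr0 2); apply: ler_powR; rewrite ?ler1n// divr_ge0// ltW.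
have -> : b^-1 * log2 (truncation b x) - m = (b * ln 2)^-1 * (ln (truncation b x) - ln (2 `^ (b * m))).
  by rewrite /log2 ln_powR; field; rewrite !gt_eqF.
rewrite normrM gtr0_norm ?invr_gt0 ?mulr_gt0// ler_wpM2l ?invr_ge0 ?mulr_ge0 ?(ltW b0) ?(ltW l2)//.
have /andP[y1a y1b] := y1.
apply: le_trans (truncation_dist x y1); apply: ln_lip_ge1; exact: le_trans one _.
Qed.

Lemma estimator_le1 (b m x : R) : 0 < b -> 2^-1 <= m <= 1 ->
  `|b^-1 * log2 (truncation b x) - m| <= 1.
Proof.
move=> b0 /andP[m1 m2]; have /andP[t1 t2] := truncation_itv x (ltW b0).
have l2 : 0 < ln 2 :> R by rewrite ln_gt0// ltr1n.
have p1 : 0 < 2 `^ (b / 2) :> R by rewrite powR_gt0.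
have p2 : 0 < truncation b x by exact: lt_le_trans t1.
have q1 : b / 2 <= log2 (truncation b x).
  by rewrite /log2 ler_pdivlMr// -ln_powR ler_ln// posrE.
have q2 : log2 (truncation b x) <= b.
  by rewrite /log2 ler_pdivrMr// -ln_powR ler_ln// posrE powR_gt0.
have r1 : 2^-1 <= b^-1 * log2 (truncation b x) by rewrite ler_pdivlMl//.
have r2 : b^-1 * log2 (truncation b x) <= 1 by rewrite ler_pdivrMl// mulr1.
by rewrite ler_norml; apply/andP; split; lra.
Qed.

Lemma lnln_gt0 (N : nat) : (3 <= N)%N -> 0 < ln (ln (N%:R : R)) / ln N%:R.
Proof.
move=> N3; have h : 3 <= N%:R :> R by rewrite (ler_nat R 3).
have e3 : expR 1 < 3 :> R.
  have -> : expR 1 = expR (4^-1) ^+ 4 :> R by rewrite -expRM_natl mulfV.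
  have := @expR_le_quadratic R 4^-1 ltac:(lra) => q.
  apply: (@le_lt_trans _ _ ((21 / 16) ^+ 4)); last by rewrite !exprS expr0; lra.
  apply: lerXn2r; rewrite ?nnegrE ?expR_ge0//; apply: (le_trans q); rewrite expr2; lra.
have l1 : 1 < ln (N%:R : R).
  by rewrite -[ltLHS](@expRK R 1) ltr_ln ?posrE ?expR_gt0//; lra.
by rewrite divr_gt0 ?ln_gt0//; lra.
Qed.

End EstimatorBounds.

(** * Assembling the random constant *)

Section Assembly.
Context (R : realType) (d : measure_display) (T : measurableType d) (P : probability T R).

Lemma hoelder_attains_min (H : R -> R) (a c K rho : R) : 0 < rho -> a <= c -> 0 <= K ->
  (forall t t', a <= t <= c -> a <= t' <= c -> `|H t - H t'| <= K * `|t - t'| `^ rho) ->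
  exists2 t0, a <= t0 <= c & forall t, a <= t <= c -> H t0 <= H t.
Proof.
move=> rho0 ac K0 Hh.
have cH : {within `[a, c], continuous H}.
  apply/subspace_continuousP => x; rewrite /= in_itv/= => hx.
  apply/cvgrPdist_le => e e0; rewrite near_withinE.
  (* K + 1 instead of K, which may be 0. *)
  pose dl := (e / (K + 1)) `^ rho^-1.
  have q0 : 0 < e / (K + 1) by rewrite divr_gt0//; lra.
  have dl0 : 0 < dl by rewrite powR_gt0.
  near=> t; rewrite /= in_itv/= => ht; apply: (le_trans (Hh x t hx ht)).
  have hd : `|x - t| <= dl.
    near: t; exact: (@cvgr_dist_le _ _ _ _ _ id x (@cvg_id _ _) dl dl0).
  apply: (@le_trans _ _ (K * (e / (K + 1)))).
    rewrite ler_wpM2l//; apply: (@le_trans _ _ (dl `^ rho)).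
      by apply: ge0_ler_powR; rewrite ?nnegrE ?(ltW rho0) ?(ltW dl0).
    by rewrite /dl -powRrM mulVf ?gt_eqF// powRr1// ltW.
  rewrite mulrA ler_pdivrMr; nra.
have [t0 ht0 Hmin] := EVT_min ac cH.
by exists t0 => [|t ht]; [move: ht0; rewrite in_itv|apply: Hmin; rewrite in_itv].
Unshelve. all: by end_near.
Qed.

Lemma power_variation_ge0 (b : R) (L : nat) (y : R -> R) (N : nat) (I : set R) :
  0 <= power_variation b L y N I.
Proof. by rewrite mulr_ge0 ?invr_ge0//; apply: sumr_ge0 => k _; exact: powR_ge0. Qed.

Lemma measurable_hurst_estimator (b : R) (L : nat) (X : R -> R -> {RV P >-> R}) (H : R -> R)
    (N : nat) (I : set R) :
  measurable_fun setT (fun w => hurst_estimator b L (fun t => lmsm X H t w) N I).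
Proof.
have mV n : measurable_fun setT (fun w => power_variation b L (fun t => lmsm X H t w) n I).
  apply: measurable_funM => //.
  under eq_fun do rewrite big_mkcond/=.
  apply: measurable_sum => k; have [_|_] := boolP (k \in nu L n I); last exact: measurable_cst.
  apply: (measurableT_comp (measurable_powR b)); apply: measurableT_comp => //.
  apply: measurable_sum => l; apply: measurable_funM => //.
have mr : measurable_fun setT (fun w => power_variation b L (fun t => lmsm X H t w) N I
    * power_variation b L (fun t => lmsm X H t w) (2 * N)%N I `^ (- 1)).
  by apply: measurable_funM => //; apply: (measurableT_comp (measurable_powR _)).
have E w : hurst_estimator b L (fun t => lmsm X H t w) N I =
    b^-1 * ((ln (Num.min (2 `^ b) (Num.max (power_variation b L (fun t => lmsm X H t w) N I
    * power_variation b L (fun t => lmsm X H t w) (2 * N)%N I `^ (- 1)) (2 `^ (b / 2))))) * (ln 2)^-1).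
  by rewrite powR_inv1 ?power_variation_ge0.
under eq_fun do rewrite E.
apply: measurable_funM => //; apply: measurable_funM => //.
apply: (measurableT_comp (@measurable_ln R)).
by apply: measurable_minr => //; exact: measurable_maxr.
Qed.

(** The normalization N^(b m) contributes 2^(-b m) to the quotient of the sums at scales N and
    2N. *)
Lemma variation_ratio_scale (b m : R) (L N : nat) (a c : R) (y : R -> R) : (0 < N)%N ->
  let D n := \sum_(k in nu L n `[a, c]) (n%:R `^ m * `|gen_increment L y n k|) `^ b in
  power_variation b L y N `[a, c] / power_variation b L y (2 * N) `[a, c] =
  2 `^ (b * m) * (window_sum L a c (2 * N) (fun=> 1) / window_sum L a c N (fun=> 1)
    * (D N / D (2 * N)%N)).
Proof.
move=> N0 D; have N0' : 0 < N%:R :> R by rewrite ltr0n.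
pose S n := \sum_(k in nu L n `[a, c]) `|gen_increment L y n k| `^ b.
have DE n : D n = n%:R `^ (m * b) * S n.
  rewrite /D /S mulr_sumr; apply: eq_bigr => k _.
  by rewrite powRM ?powR_ge0// -powRrM.
have card n : window_sum L a c n (fun=> 1) = #|nu L n `[a, c]|%:R :> R.
  by rewrite -nu_sum sumr_const.
rewrite !card !DE /power_variation -!/(S _) natrM powRM//.
have x0 : N%:R `^ (m * b) != 0 :> R by rewrite gt_eqF// powR_gt0.
have y0 : 2 `^ (m * b) != 0 :> R by rewrite gt_eqF// powR_gt0.
rewrite [b * m]mulrC !invfM invrK.
move: (N%:R `^ (m * b)) (2 `^ (m * b)) x0 y0 (#|nu L N _|%:R^-1 : R) (#|nu L (2 * N) _|%:R : R) (S N) ((S (2 * N)%N)^-1).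
by move=> x z x0 z0 p q u v; field; rewrite x0 z0.
Qed.

(** The constant is 1 plus the supremum over N of the rescaled errors. It is finite as soon as
    an eventual bound holds, because the errors are at most 1 for the finitely many
    remaining N. *)
Lemma random_constant (V : nat -> T -> R) (eta : nat -> R) (n0 : nat) :
  (forall N, measurable_fun setT (V N)) -> (forall N, (n0 <= N)%N -> 0 < eta N) ->
  (forall N w, 0 <= V N w <= 1) ->
  {ae P, forall w, exists K : R, exists N1 : nat, forall N, (N1 <= N)%N -> V N w <= K * eta N} ->
  exists C : {RV P >-> \bar R}, [/\ forall w, (0 < C w)%E, {ae P, forall w, (C w < +oo)%E} &
    forall w N, (n0 <= N)%N -> ((V N w)%:E <= C w * (eta N)%:E)%E].
Proof.
move=> mV eta0 V01 hK.
pose Y (N : nat) (w : T) : \bar R := if (n0 <= N)%N then (V N w * (eta N)^-1)%:E else 0%E.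
have mY N : measurable_fun setT (Y N).
  rewrite /Y; have [_|_] := leqP n0 N; last exact: measurable_cst.
  by apply/measurable_EFinP; exact: measurable_funM.
have mC : measurable_fun setT (fun w => 1 + esups (Y ^~ w) 0%N)%E.
  apply: emeasurable_funD => //; exact: measurable_fun_esups.
have supE w : esups (Y ^~ w) 0%N = ereal_sup (range (Y ^~ w)).
  rewrite /esups/=; congr ereal_sup; apply/seteqP; split => z [k] _ <-; by exists k.
have Ysup w N : (Y N w <= esups (Y ^~ w) 0%N)%E by rewrite supE; apply: ereal_sup_ubound; exists N.
have Y0 w N : (0 <= Y N w)%E.
  rewrite /Y; case: ifP => // /eta0 e0; rewrite lee_fin mulr_ge0 ?invr_ge0 ?(ltW e0)//.
  by have /andP[] := V01 N w.
have s0 w : (0 <= esups (Y ^~ w) 0%N)%E by exact: le_trans (Y0 w 0) (Ysup w 0).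
have pos w : (0 < 1 + esups (Y ^~ w) 0%N)%E.
  by apply: (lt_le_trans lte01); rewrite leeDl.
pose C0 : {mfun T >-> \bar R} := HB.pack_for {mfun T >-> \bar R} (fun w => 1 + esups (Y ^~ w) 0%N)%E
  (isMeasurableFun.Build _ _ _ _ _ mC).
exists C0; split => //.
- apply: filterS hK => w [K [N1 hK]]; apply: lte_add_pinfty; first exact: ltry.
  pose S := `|K| + \sum_(i < N1) (if (n0 <= i)%N then (eta i)^-1 else 0).
  have t0 (i : 'I_N1) : 0 <= (if (n0 <= i)%N then (eta i)^-1 else 0).
    by case: ifP => // /eta0 e0; rewrite invr_ge0 ltW.
  apply: (@le_lt_trans _ _ S%:E); last exact: ltry.
  rewrite supE; apply: ge_ereal_sup => _ [N _ <-]; rewrite /Y; case: ifP => nN; last first.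
    by rewrite lee_fin addr_ge0// sumr_ge0.
  have e0 := eta0 N nN; have /andP[v0 v1] := V01 N w.
  rewrite lee_fin; have [N1N|NN1] := leqP N1 N.
    apply: (@le_trans _ _ `|K|); last by rewrite /S lerDl sumr_ge0.
    by rewrite ler_pdivrMr//; apply: (le_trans (hK N N1N)); rewrite ler_wpM2r ?(ltW e0)// ler_norm.
  apply: (@le_trans _ _ (\sum_(i < N1) (if (n0 <= i)%N then (eta i)^-1 else 0))); last by rewrite /S lerDr.
  rewrite (bigD1 (Ordinal NN1))//= nN; apply: (@le_trans _ _ (eta N)^-1).
    by rewrite -[leRHS]mul1r ler_wpM2r// invr_ge0 ltW.
  by rewrite lerDl sumr_ge0.
- move=> w N nN; have e0 := eta0 N nN.
  have h : ((V N w * (eta N)^-1)%:E <= 1 + esups (Y ^~ w) 0%N)%E.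
    have := Ysup w N; rewrite /Y nN => /le_trans; apply.
    by rewrite leeDr.
  have -> : (V N w)%:E = ((V N w * (eta N)^-1)%:E * (eta N)%:E)%E.
    by rewrite -EFinM mulfVK ?gt_eqF.
  by apply: lee_wpmul2r => //; rewrite lee_fin ltW.
Qed.

End Assembly.

Theorem theorem2p2 (R : realType) (d : measure_display) (T : measurableType d)
  (P : probability T R)
  (alpha : R) (alpha_bounds : 1 < alpha < 2)
  (Z : set R -> {RV P >-> R}) (Z_measure : is_SaS_random_measure alpha Z)
  (J : (R -> R) -> {RV P >-> R}) (J_integral : is_SaS_integral alpha Z J)
  (X : R -> R -> {RV P >-> R}) (X_field : is_lmsm_field alpha J X)
  (H : R -> R)
  (H_range : exists h1 h2 : R, [/\ alpha^-1 < h1, h2 < 1 &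
    forall t : R, 0 <= t <= 1 -> h1 <= H t <= h2])
  (cH rhoH : R)
  (H_hoelder : forall t1 t2 : R, 0 <= t1 <= 1 -> 0 <= t2 <= 1 ->
    `|H t1 - H t2| <= cH * `|t1 - t2| `^ rhoH)
  (rhoH_bounds : sup (H @` `[0, 1]%classic) < rhoH <= 1)
  (beta : R) (beta_bounds : 0 < beta <= 4^-1)
  (L : nat) (L_ge2 : (2 <= L)%N) (L_gt : 2 / beta + 1 < L%:R)
  (a b : R) (a_ge0 : 0 <= a) (a_lt_b : a < b) (b_le1 : b <= 1) :
  let I : set R := `[a, b]%classic in
  exists2 m : R, is_min (H @` I) m &
  exists C : {RV P >-> \bar R},
    [/\ forall w : T, (0 < C w)%E,
        {ae P, forall w : T, (C w < +oo)%E} &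
        {ae P, forall w : T, forall N : nat, (3 <= N)%N ->
          ((4 * L.+1%:R * N%:R^-1 * ln N%:R ^+ 2)%:E <= lebesgue_measure I)%E ->
          (`|hurst_estimator beta L (fun t => lmsm X H t w) N I - m|%:E
            <= C w * (ln (ln N%:R) / ln N%:R)%:E)%E}].
Proof.
move=> I; have [h1 [h2 [hh1 hh2 Hr]]] := H_range.
have /andP[al1 al2] := alpha_bounds; have /andP[b0 b4] := beta_bounds.
have /andP[rho_sup _] := rhoH_bounds.
have ai : 2^-1 < alpha^-1 by rewrite ltf_pV2 ?posrE//; lra.
have I01 t : a <= t <= b -> 0 <= t <= 1 by move=> /andP[? ?]; apply/andP; split; lra.
have Hh' t t' : 0 <= t <= 1 -> 0 <= t' <= 1 -> `|H t - H t'| <= `|cH| * `|t - t'| `^ rhoH.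
  by move=> ht ht'; apply: (le_trans (H_hoelder _ _ ht ht')); rewrite ler_wpM2r ?powR_ge0// ler_norm.
have Hsup t : 0 <= t <= 1 -> H t < rhoH.
  move=> ht; apply: le_lt_trans rho_sup; apply: ub_le_sup; last by exists t; rewrite //= in_itv.
  by exists h2 => y [u]; rewrite /= in_itv/= => hu <-; have /andP[] := Hr u hu.
have rho2 : 2^-1 <= rhoH.
  have u0 : 0 <= (0 : R) <= 1 by rewrite lexx ler01.
  have := Hsup 0 u0; have /andP[] := Hr 0 u0; lra.
have rho0 : 0 < rhoH by lra.
have [t0 ht0 Hmin] := hoelder_attains_min rho0 (ltW a_lt_b) (normr_ge0 cH)
  (fun t t' ht ht' => Hh' t t' (I01 t ht) (I01 t' ht')).
pose m := H t0.
have hm1 : h1 <= m by have /andP[] := Hr t0 (I01 t0 ht0).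
have hm2 : m <= h2 by have /andP[] := Hr t0 (I01 t0 ht0).
exists m.
  split; first by exists t0 => //; rewrite /I /= in_itv.
  by move=> y [t]; rewrite /I /= in_itv/= => ht <-; exact: Hmin.
have bi : 4 <= beta^-1 by rewrite -[leLHS]invrK lef_pV2 ?posrE ?invr_gt0.
have L5 : (5 <= L)%N by rewrite -(ler_nat R); lra.
have L0 : (0 < L)%N by exact: leq_trans L5.
have bb1 : 0 < beta < 1 by apply/andP; split; move: b0 b4; clear; lra.
have m12 : 2^-1 <= m <= 1 by apply/andP; split; move: hm1 hm2 hh1 hh2 ai; clear; lra.
have am : alpha^-1 < m by exact: lt_le_trans hm1.
have mrho : m < rhoH by exact: Hsup (I01 t0 ht0).
have HI t : I t -> 0 <= t <= 1 /\ m <= H t.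
  by rewrite /I /= in_itv/= => ht; split; [exact: I01|exact: Hmin].
have [M M0 [e e0 conc]] := increment_concentration J_integral X_field alpha_bounds beta_bounds L_gt
  hh1 hh2 Hr H_hoelder mrho am HI.
have [smin [S [smin0 hs]]] := psi_scale_bounds al1 L_ge2 b0.
have [Cs Cs0 hCs] := psi_scale_hoelder J_integral alpha_bounds L5 bb1 hh1 hh2.
have hv t : a <= t <= b -> alpha^-1 < H t < 1.
  by move=> /I01/Hr/andP[p q]; apply/andP; split; move: p q hh1 hh2; clear; lra.
have Hm t : a <= t <= b -> m <= H t <= m + 1.
  move=> ht; rewrite (Hmin t ht)/=; have /andP[_ q] := Hr t (I01 t ht).
  by move: q hm1 hh1 hh2 ai; clear; lra.
have k01 : 0 < beta / 2 <= 1 by apply/andP; split; move: b0 b4; clear; lra.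
pose V N w := `|hurst_estimator beta L (fun t => lmsm X H t w) N I - m|.
pose eta N : R := ln (ln N%:R) / ln N%:R.
have mV N : measurable_fun setT (V N).
  by apply: measurableT_comp => //; apply: measurable_funB => //; exact: measurable_hurst_estimator.
have V01 N w : 0 <= V N w <= 1 by rewrite normr_ge0 /V /hurst_estimator estimator_le1.
have ev : {ae P, forall w, exists K : R, exists N1 : nat, forall N, (N1 <= N)%N -> V N w <= K * eta N}.
  apply: filterS conc => w [C C0 [N0 hC]].
  pose D n := \sum_(k in nu L n I) (n%:R `^ m * `|gen_increment L (fun t => lmsm X H t w) n k|) `^ beta.
  have hD n : (maxn N0 1 <= n)%N ->
      `|D n - M * mean_sum beta a b m L H (psi_scale alpha L beta) n| <= C * n%:R `^ (1 - e).
    rewrite geq_max => /andP[N0n n0]; have := hC n N0n.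
    rewrite sumrB; congr (`|_ - _| <= _).
    rewrite -mulr_sumr /mean_sum -nu_sum; congr (M * _); apply: eq_bigr => k _.
    rewrite /gain /gain_at /powR ifF//.
    by apply/negbTE; rewrite pnatr_eq0 -lt0n.
  have [K K0 [N1 hK]] := variation_ratio L0 beta_bounds a_ge0 a_lt_b b_le1 Hm ht0 (erefl m) (normr_ge0 cH)
    rho2 (fun t t' ht ht' => Hh' t t' (I01 t ht) (I01 t' ht')) smin0 (fun t ht => hs _ (hv t ht)) Cs0 k01
    (fun t t' ht ht' => hCs _ _ (Hr _ (I01 t ht)) (Hr _ (I01 t' ht'))) M0 e0 C0 hD.
  exists ((beta * ln 2)^-1 * (2 `^ (beta * m) * K)), (maxn N1 1) => N.
  rewrite geq_max => /andP[N1N Np].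
  have l2 : 0 < ln 2 :> R by rewrite ln_gt0// ltr1n.
  rewrite /V /hurst_estimator; apply: (le_trans (estimator_error _ b0 m12)).
  have i0 : 0 <= (beta * ln 2)^-1 by rewrite invr_ge0 mulr_ge0 ?(ltW b0) ?(ltW l2).
  rewrite -[leRHS]mulrA; apply: (ler_wpM2l i0).
  rewrite (variation_ratio_scale beta m L a b _ Np) -/(D _).
  rewrite -[X in _ - X]mulr1 -mulrBr normrM ger0_norm ?powR_ge0// -[leRHS]mulrA.
  by apply: ler_wpM2l; [exact: powR_ge0|exact: hK].
have [C [C1 C2 C3]] := random_constant mV (fun N hN => lnln_gt0 R hN) V01 ev.
exists C; split => //; apply: aeW => w N N3 _; exact: C3.
Qed.
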